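(* Let $\mathcal C$ be a finite tensor category over $\Bbbk$ and let $T$ be a normal faithful $\Bbbk$-linear exact Hopf monad on $\mathcal C$ with induced Hopf algebra $H$. Then there is an equivalence of $\Bbbk$-linear categories $$(\mathcal C\rtimes T)^{\mathrm{rev}}\simeq H\text{-mod}\boxtimes\mathcal C .$$
   Context: $\Bbbk$ is an algebraically closed field of characteristic $0$; all functors are $\Bbbk$-linear. A tensor category over $\Bbbk$ is a $\Bbbk$-linear abelian rigid monoidal category with bilinear tensor product, finite-dimensional Hom spaces, all objects of finite length and simple unit $\mathbf 1$; it is assumed strict. It is finite if it has finitely many simple objects up to isomorphism and each has a projective cover. For a tensor category $\mathcal D$, $\mathcal D^{\mathrm{rev}}$ is $\mathcal D$ with reversed tensor product. $H\text{-mod}$ is the category of finite-dimensional left $H$-modules and $\boxtimes$ is the Deligne tensor product. A Hopf monad on $\mathcal C$ is a monad $(T,\mu,\eta)$ with a comonoidal structure $\xi_{X,Y}:T(X\otimes Y)\to T(X)\otimes T(Y)$, $\phi:T(\mathbf 1)\to\mathbf 1$ such that $\mu,\eta$ are comonoidal transformations and the fusion operators $(\mathrm{id}\otimes\mu_Y)\xi_{X,T(Y)}$, $(\mu_X\otimes\mathrm{id})\xi_{T(X),Y}$ are isomorphisms. $\mathcal C^T$ is the tensor category of $T$-modules, with $(X,r)\otimes(Y,s)=(X\otimes Y,(r\otimes s)\xi_{X,Y})$ and forgetful tensor functor $\mathcal F:\mathcal C^T\to\mathcal C$. $\mathcal C$ is a left $\mathcal C^T$-module category via $(X,s)\overline\otimes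 Y=X\otimes Y$, and $\mathcal C\rtimes T:=\operatorname{End}_{\mathcal C^T}(\mathcal C)$ is the category of $\Bbbk$-linear $\mathcal C^T$-module endofunctors of $\mathcal C$ (with composition as tensor product): functors $F:\mathcal C\to\mathcal C$ with coherent natural isomorphisms $F((X,s)\overline\otimes Y)\cong(X,s)\overline\otimes F(Y)$. An object of a tensor category is trivial if it is isomorphic to a finite direct sum of copies of $\mathbf 1$; $\langle\mathbf 1\rangle$ is the subcategory of trivial objects. $T$ is normal if $T(\mathbf 1)$ is trivial. In that case let $\mathfrak{Ker}_{\mathcal F}\subseteq\mathcal C^T$ be the full tensor subcategory of objects $X$ with $\mathcal F(X)$ trivial, with fiber functor $\omega(X)=\operatorname{Hom}_{\mathcal C}(\mathbf 1,\mathcal F(X))$ to finite-dimensional vector spaces. The induced Hopf algebra of $T$ is the coend $H=\int^{X\in\mathfrak{Ker}_{\mathcal F}}\omega(X)^\vee\otimes\omega(X)$; it is finite-dimensional and $\mathfrak{Ker}_{\mathcal F}$ is equivalent as a tensor category to the category of finite-dimensional left $H$-comodules. *)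

(* Defs.v *)
From HB Require Import structures.
From mathcomp Require Import all_boot all_algebra all_field.
From mathcomp Require Import boolp.

Set Implicit Arguments.
Unset Strict Implicit.
Unset Printing Implicit Defensive.

Import GRing.Theory.
Local Open Scope ring_scope.

Local Obligation Tactic := idtac.

Declare Scope cat_scope.
Delimit Scope cat_scope with cat.

(** * Linear algebra *)

Record submodule (k : fieldType) (V : lmodType k) := Submodule {
  smem :> V -> Prop;
  smem0 : smem 0;
  smem_lin : forall (a : k) u v, smem u -> smem v -> smem (a *: u + v)
}.

Record sublmod (k : fieldType) (V : lmodType k) (S : submodule V) :=
  Sublmod { smval :> V; smvalP : S smval }.

Section SubLmod.
Variables (k : fieldType) (V : lmodType k) (S : submodule V).

Lemma smval_inj : injective (@smval _ _ S).
Proof.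
move=> [u hu] [v hv] /= e; case: _ / e hv => hv.
by rewrite (Prop_irrelevance hu hv).
Qed.

Lemma smemD u v : S u -> S v -> S (u + v).
Proof. by move=> hu hv; rewrite -(scale1r u); apply: smem_lin. Qed.

Lemma smemZ a u : S u -> S (a *: u).
Proof. by move=> hu; rewrite -[X in S X]addr0; apply: smem_lin => //; exact: smem0. Qed.

Lemma smemN u : S u -> S (- u).
Proof. by move=> hu; rewrite -scaleN1r; apply: smemZ. Qed.

Local Notation U := (sublmod S).

HB.instance Definition _ := gen_eqMixin U.
HB.instance Definition _ := gen_choiceMixin U.

Definition sm_zero : U := Sublmod (smem0 S).
Definition sm_opp (u : U) : U := Sublmod (smemN (smvalP u)).
Definition sm_add (u v : U) : U := Sublmod (smemD (smvalP u) (smvalP v)).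
Definition sm_scale (a : k) (u : U) : U := Sublmod (smemZ a (smvalP u)).

Fact sm_addA : associative sm_add.
Proof. by move=> u v w; apply: smval_inj; rewrite /= addrA. Qed.
Fact sm_addC : commutative sm_add.
Proof. by move=> u v; apply: smval_inj; rewrite /= addrC. Qed.
Fact sm_add0 : left_id sm_zero sm_add.
Proof. by move=> u; apply: smval_inj; rewrite /= add0r. Qed.
Fact sm_addN : left_inverse sm_zero sm_opp sm_add.
Proof. by move=> u; apply: smval_inj; rewrite /= addNr. Qed.

HB.instance Definition _ :=
  GRing.isZmodule.Build U sm_addA sm_addC sm_add0 sm_addN.

Fact sm_scaleA a b u : sm_scale a (sm_scale b u) = sm_scale (a * b) u.
Proof. by apply: smval_inj; rewrite /= scalerA. Qed.
Fact sm_scale1 : left_id 1 sm_scale.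
Proof. by move=> u; apply: smval_inj; rewrite /= scale1r. Qed.
Fact sm_scaleDr : right_distributive sm_scale +%R.
Proof. by move=> a u v; apply: smval_inj; rewrite /= scalerDr. Qed.
Fact sm_scaleDl u : {morph sm_scale^~ u : a b / a + b}.
Proof. by move=> a b; apply: smval_inj; rewrite /= scalerDl. Qed.

HB.instance Definition _ :=
  GRing.Zmodule_isLmodule.Build k U sm_scaleA sm_scale1 sm_scaleDr sm_scaleDl.

Lemma smval_lin (a : k) (u v : U) : smval (a *: u + v) = a *: smval u + smval v.
Proof. by []. Qed.

End SubLmod.

(* The product of a family of vector spaces indexed by an arbitrary type. *)
Definition dprod (k : fieldType) (I : Type) (V : I -> lmodType k) : Type :=
  forall i, V i.

Section DProd.
Variables (k : fieldType) (I : Type) (V : I -> lmodType k).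
Local Notation P := (dprod V).

HB.instance Definition _ := gen_eqMixin P.
HB.instance Definition _ := gen_choiceMixin P.

Definition dp_zero : P := fun=> 0.
Definition dp_opp (u : P) : P := fun i => - u i.
Definition dp_add (u v : P) : P := fun i => u i + v i.
Definition dp_scale (a : k) (u : P) : P := fun i => a *: u i.

Fact dp_addA : associative dp_add.
Proof. by move=> u v w; apply: functional_extensionality_dep => i; exact: addrA. Qed.
Fact dp_addC : commutative dp_add.
Proof. by move=> u v; apply: functional_extensionality_dep => i; exact: addrC. Qed.
Fact dp_add0 : left_id dp_zero dp_add.
Proof. by move=> u; apply: functional_extensionality_dep => i; exact: add0r. Qed.
Fact dp_addN : left_inverse dp_zero dp_opp dp_add.
Proof. by move=> u; apply: functional_extensionality_dep => i; exact: addNr. Qed.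

HB.instance Definition _ :=
  GRing.isZmodule.Build P dp_addA dp_addC dp_add0 dp_addN.

Fact dp_scaleA a b u : dp_scale a (dp_scale b u) = dp_scale (a * b) u.
Proof. by apply: functional_extensionality_dep => i; exact: scalerA. Qed.
Fact dp_scale1 : left_id 1 dp_scale.
Proof. by move=> u; apply: functional_extensionality_dep => i; exact: scale1r. Qed.
Fact dp_scaleDr : right_distributive dp_scale +%R.
Proof. by move=> a u v; apply: functional_extensionality_dep => i; exact: scalerDr. Qed.
Fact dp_scaleDl u : {morph dp_scale^~ u : a b / a + b}.
Proof. by move=> a b; apply: functional_extensionality_dep => i; exact: scalerDl. Qed.

HB.instance Definition _ :=
  GRing.Zmodule_isLmodule.Build k P dp_scaleA dp_scale1 dp_scaleDr dp_scaleDl.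

End DProd.

Definition fin_dim (k : fieldType) (V : lmodType k) : Prop :=
  exists n, inhabited (Vector.axiom n V).

Section Dual.
Variable k : fieldType.

Program Definition linear_forms (V : lmodType k) : submodule (dprod (fun _ : V => k^o)) :=
  @Submodule k _ (fun f : dprod (fun _ : V => k^o) => linear (f : V -> k^o)) _ _.
Next Obligation. by move=> V a u v; rewrite /= [RHS]addr0 [RHS]mulr0. Qed.
Next Obligation.
move=> V a f g hf hg b u v.
change (a *: f (b *: u + v) + g (b *: u + v)
  = b *: (a *: f u + g u) + (a *: f v + g v)).
by rewrite hf hg !scalerDr !scalerA (mulrC a b) addrACA.
Qed.

Definition dual (V : lmodType k) : lmodType k := sublmod (linear_forms V).

Definition dual_eval (V : lmodType k) (f : dual V) (v : V) : k := smval f v.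

Program Definition dual_pullback (V W : lmodType k) (f : V -> W) (hf : linear f)
    (a : dual W) : dual V :=
  @Sublmod k _ (linear_forms V) (fun v => dual_eval a (f v)) _.
Next Obligation.
by move=> V W f hf [a ha] b u v /=; rewrite /dual_eval /= hf ha.
Qed.

End Dual.

Section Tensor.
Variable k : fieldType.

(* The tensor product of finite-dimensional spaces V and W, in the coordinates
   given by the chosen bases of V and W. *)
Definition tens (V W : vectType k) : vectType k :=
  'M[k]_(\dim (@fullv k V), \dim (@fullv k W)).

Definition ptens (V W : vectType k) (v : V) (w : W) : tens V W :=
  \matrix_(i, j) (coord (vbasis fullv) i v * coord (vbasis fullv) j w).

(* The linear map on V (x) W that sends v (x) w to f v w, for f bilinear. *)
Definition tlift (V W : vectType k) (Z : lmodType k) (f : V -> W -> Z)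
    (t : tens V W) : Z :=
  \sum_i \sum_j t i j *: f (vbasis (@fullv k V))`_i (vbasis (@fullv k W))`_j.

End Tensor.

(** * Linear categories *)

Record lincat (k : fieldType) := LinCat {
  ob :> Type;
  hom : ob -> ob -> lmodType k;
  idm : forall X, hom X X;
  comp : forall X Y Z, hom Y Z -> hom X Y -> hom X Z;
  comp_linl : forall X Y Z (f : hom X Y), linear (fun g : hom Y Z => comp g f);
  comp_linr : forall X Y Z (g : hom Y Z), linear (fun f : hom X Y => comp g f);
  compA : forall X Y Z W (h : hom Z W) (g : hom Y Z) (f : hom X Y),
    comp h (comp g f) = comp (comp h g) f;
  compIm : forall X Y (f : hom X Y), comp (idm Y) f = f;
  compmI : forall X Y (f : hom X Y), comp f (idm X) = f
}.

Arguments hom {k} l X Y.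
Arguments idm {k l} X.
Arguments comp {k l X Y Z} g f.

Notation "g \c f" := (comp g f) (at level 40, left associativity) : cat_scope.
Local Open Scope cat_scope.

Record iso (k : fieldType) (A : lincat k) (X Y : A) := Iso {
  fwd :> hom A X Y;
  bwd : hom A Y X;
  fwdK : bwd \c fwd = idm X;
  bwdK : fwd \c bwd = idm Y
}.

Section InCategory.
Variables (k : fieldType) (A : lincat k).
Implicit Types X Y Z : A.

Definition is_iso X Y (f : hom A X Y) : Prop :=
  exists g : hom A Y X, g \c f = idm X /\ f \c g = idm Y.

Definition isomorphic X Y : Prop := exists f : hom A X Y, is_iso f.

Definition mono X Y (f : hom A X Y) : Prop :=
  forall Z (g h : hom A Z X), f \c g = f \c h -> g = h.

Definition epi X Y (f : hom A X Y) : Prop :=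
  forall Z (g h : hom A Y Z), g \c f = h \c f -> g = h.

Definition is_zero X : Prop := idm X = 0.

Definition is_kernel X Y Z (i : hom A X Y) (f : hom A Y Z) : Prop :=
  f \c i = 0 /\
  forall W (g : hom A W Y), f \c g = 0 -> exists! h : hom A W X, i \c h = g.

Definition is_cokernel X Y Z (p : hom A Y Z) (f : hom A X Y) : Prop :=
  p \c f = 0 /\
  forall W (g : hom A Y W), g \c f = 0 -> exists! h : hom A Z W, h \c p = g.

(* S, with injections e and projections p, is the direct sum of the family X. *)
Definition is_biproduct (I : finType) (X : I -> A) (S : A)
    (e : forall i, hom A (X i) S) (p : forall i, hom A S (X i)) : Prop :=
  [/\ forall i, p i \c e i = idm (X i),
      forall i j, i <> j -> p j \c e i = 0
    & \sum_i e i \c p i = idm S].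

Definition is_direct_sum (I : finType) (X : I -> A) (S : A) : Prop :=
  exists (e : forall i, hom A (X i) S) (p : forall i, hom A S (X i)),
    is_biproduct e p.

Record abelian : Prop := Abelian {
  ab_zero : exists X, is_zero X;
  ab_sum : forall X Y, exists S, is_direct_sum (fun b : bool => if b then X else Y) S;
  ab_ker : forall X Y (f : hom A X Y), exists K (i : hom A K X), is_kernel i f;
  ab_coker : forall X Y (f : hom A X Y), exists Q (p : hom A Y Q), is_cokernel p f;
  ab_mono : forall X Y (f : hom A X Y), mono f ->
    exists Z (g : hom A Y Z), is_kernel f g;
  ab_epi : forall X Y (f : hom A X Y), epi f ->
    exists Z (g : hom A Z X), is_cokernel f g
}.

Definition simple S : Prop :=
  ~ is_zero S /\
  forall X (f : hom A X S), mono f -> is_zero X \/ is_iso f.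

Inductive finite_length : A -> Prop :=
| FLzero X of is_zero X : finite_length X
| FLext X Y S (i : hom A Y X) (p : hom A X S) of
    finite_length Y & simple S & is_kernel i p & is_cokernel p i : finite_length X.

Definition projective P : Prop :=
  forall X Y (p : hom A X Y) (f : hom A P Y), epi p -> exists g, p \c g = f.

Definition projective_cover P X (p : hom A P X) : Prop :=
  [/\ projective P, epi p
    & forall Q (f : hom A Q P), epi (p \c f) -> epi f].

Definition finite_cat : Prop :=
  (exists s : seq A, forall S, simple S ->
     exists i : 'I_(size s), isomorphic S (tnth (in_tuple s) i)) /\
  (forall S, simple S -> exists P (p : hom A P S), projective_cover p).

Definition fin_dim_homs : Prop := forall X Y, fin_dim (hom A X Y).

End InCategory.

(** * Functors *)

Record functor (k : fieldType) (A B : lincat k) := Functor {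
  fob :> A -> B;
  fmap : forall X Y, hom A X Y -> hom B (fob X) (fob Y);
  fmap_lin : forall X Y, linear (@fmap X Y);
  fmap_id : forall X, fmap (idm X) = idm (fob X);
  fmap_comp : forall X Y Z (g : hom A Y Z) (f : hom A X Y),
    fmap (g \c f) = fmap g \c fmap f
}.

Arguments fmap {k A B} f0 {X Y} f.

Section Functors.
Variable k : fieldType.

Program Definition id_functor (A : lincat k) : functor A A :=
  @Functor k A A (fun X => X) (fun _ _ f => f) _ _ _.
Next Obligation. by move=> A X Y a f g. Qed.
Next Obligation. by []. Qed.
Next Obligation. by []. Qed.

Program Definition comp_functor (A B D : lincat k) (G : functor B D) (F : functor A B) :
    functor A D :=
  @Functor k A D (fun X => G (F X)) (fun _ _ f => fmap G (fmap F f)) _ _ _.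
Next Obligation. by move=> A B D G F X Y a f g; rewrite /= !fmap_lin. Qed.
Next Obligation. by move=> A B D G F X; rewrite /= !fmap_id. Qed.
Next Obligation. by move=> A B D G F X Y Z g f; rewrite /= !fmap_comp. Qed.

Definition natural (A B : lincat k) (F G : functor A B)
    (a : forall X, hom B (F X) (G X)) : Prop :=
  forall X Y (f : hom A X Y), a Y \c fmap F f = fmap G f \c a X.

Definition nat_isomorphic (A B : lincat k) (F G : functor A B) : Prop :=
  exists a : forall X, hom B (F X) (G X), natural a /\ forall X, is_iso (a X).

Definition equivalent (A B : lincat k) : Prop :=
  exists (F : functor A B) (G : functor B A),
    nat_isomorphic (comp_functor G F) (id_functor A) /\
    nat_isomorphic (comp_functor F G) (id_functor B).

Definition faithful (A B : lincat k) (F : functor A B) : Prop :=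
  forall X Y, injective (@fmap k A B F X Y).

Definition left_exact (A B : lincat k) (F : functor A B) : Prop :=
  forall X Y Z (i : hom A X Y) (f : hom A Y Z),
    is_kernel i f -> is_kernel (fmap F i) (fmap F f).

Definition right_exact (A B : lincat k) (F : functor A B) : Prop :=
  forall X Y Z (p : hom A Y Z) (f : hom A X Y),
    is_cokernel p f -> is_cokernel (fmap F p) (fmap F f).

Definition exact (A B : lincat k) (F : functor A B) : Prop :=
  left_exact F /\ right_exact F.

End Functors.

Record bifunctor (k : fieldType) (A B D : lincat k) := Bifunctor {
  bob :> A -> B -> D;
  bmap : forall X X' Y Y', hom A X X' -> hom B Y Y' -> hom D (bob X Y) (bob X' Y');
  bmap_linl : forall X X' Y Y' (g : hom B Y Y'), linear (fun f : hom A X X' => bmap f g);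
  bmap_linr : forall X X' Y Y' (f : hom A X X'), linear (fun g : hom B Y Y' => bmap f g);
  bmap_id : forall X Y, bmap (idm X) (idm Y) = idm (bob X Y);
  bmap_comp : forall X X' X'' Y Y' Y'' (f' : hom A X' X'') (f : hom A X X')
      (g' : hom B Y' Y'') (g : hom B Y Y'),
    bmap (f' \c f) (g' \c g) = bmap f' g' \c bmap f g
}.

Arguments bmap {k A B D} b {X X' Y Y'} f g.

Lemma bmap_comp_idl (k : fieldType) (A B D : lincat k) (F : bifunctor A B D)
    (X : A) (Y Y' Y'' : B) (g : hom B Y' Y'') (f : hom B Y Y') :
  bmap F (idm X) (g \c f) = bmap F (idm X) g \c bmap F (idm X) f.
Proof. by rewrite -bmap_comp compIm. Qed.

Section Isomorphisms.
Variables (k : fieldType) (A B : lincat k).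

Definition iso_refl (X : A) : iso X X := Iso (compIm (idm X)) (compIm (idm X)).

Program Definition iso_comp (X Y Z : A) (g : iso Y Z) (f : iso X Y) : iso X Z :=
  @Iso k A X Z (g \c f) (bwd f \c bwd g) _ _.
Next Obligation. by move=> X Y Z g f; rewrite compA -(compA _ (bwd g)) fwdK compmI fwdK. Qed.
Next Obligation. by move=> X Y Z g f; rewrite compA -(compA _ (fwd f)) bwdK compmI bwdK. Qed.

Program Definition iso_map (F : functor A B) (X Y : A) (f : iso X Y) : iso (F X) (F Y) :=
  @Iso k B (F X) (F Y) (fmap F f) (fmap F (bwd f)) _ _.
Next Obligation. by move=> F X Y f; rewrite -fmap_comp fwdK fmap_id. Qed.
Next Obligation. by move=> F X Y f; rewrite -fmap_comp bwdK fmap_id. Qed.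

Definition iso_sym (X Y : A) (f : iso X Y) : iso Y X := Iso (bwdK f) (fwdK f).

Program Definition iso_bmap (D : lincat k) (F : bifunctor A B D) (X X' : A) (Y Y' : B)
    (f : iso X X') (g : iso Y Y') : iso (F X Y) (F X' Y') :=
  @Iso k D (F X Y) (F X' Y') (bmap F f g) (bmap F (bwd f) (bwd g)) _ _.
Next Obligation. by move=> *; rewrite -bmap_comp !fwdK bmap_id. Qed.
Next Obligation. by move=> *; rewrite -bmap_comp !bwdK bmap_id. Qed.

Lemma bwd_inj (X Y : A) (f g : iso X Y) : fwd f = fwd g -> bwd f = bwd g.
Proof.
by move=> e; rewrite -[LHS]compmI -(bwdK g) compA -e fwdK compIm.
Qed.

End Isomorphisms.

(** * The Deligne tensor product *)

Section Deligne.
Variable k : fieldType.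

Program Definition comp_bifunctor (A B D E : lincat k) (G : functor D E)
    (F : bifunctor A B D) : bifunctor A B E :=
  @Bifunctor k A B E (fun X Y => G (F X Y))
    (fun _ _ _ _ f g => fmap G (bmap F f g)) _ _ _ _.
Next Obligation. by move=> A B D E G F X X' Y Y' g a f f'; rewrite bmap_linl fmap_lin. Qed.
Next Obligation. by move=> A B D E G F X X' Y Y' f a g g'; rewrite bmap_linr fmap_lin. Qed.
Next Obligation. by move=> A B D E G F X Y; rewrite /= bmap_id fmap_id. Qed.
Next Obligation. by move=> *; rewrite /= bmap_comp fmap_comp. Qed.

Definition binatural (A B D : lincat k) (F G : bifunctor A B D)
    (a : forall X Y, hom D (F X Y) (G X Y)) : Prop :=
  forall X X' Y Y' (f : hom A X X') (g : hom B Y Y'),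
    a X' Y' \c bmap F f g = bmap G f g \c a X Y.

Definition binat_isomorphic (A B D : lincat k) (F G : bifunctor A B D) : Prop :=
  exists a : forall X Y, hom D (F X Y) (G X Y),
    binatural a /\ forall X Y, is_iso (a X Y).

Definition right_exact2 (A B D : lincat k) (F : bifunctor A B D) : Prop :=
  (forall Y X1 X2 X3 (p : hom A X2 X3) (f : hom A X1 X2),
     is_cokernel p f -> is_cokernel (bmap F p (idm Y)) (bmap F f (idm Y))) /\
  (forall X Y1 Y2 Y3 (p : hom B Y2 Y3) (f : hom B Y1 Y2),
     is_cokernel p f -> is_cokernel (bmap F (idm X) p) (bmap F (idm X) f)).

(* Deligne's universal property: for every k-linear abelian category E,
   precomposition with the bifunctor P is an equivalence from right exact functors
   D -> E to bifunctors A x B -> E that are right exact in each variable. *)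
Record is_deligne_product (A B D : lincat k) (P : bifunctor A B D) : Prop := {
  dp_abelian : abelian D;
  dp_rexact : right_exact2 P;
  dp_ess_surj : forall E : lincat k, abelian E ->
    forall F : bifunctor A B E, right_exact2 F ->
    exists G : functor D E, right_exact G /\ binat_isomorphic (comp_bifunctor G P) F;
  dp_full_faithful : forall E : lincat k, abelian E ->
    forall G G' : functor D E, right_exact G -> right_exact G' ->
    forall a : forall X Y, hom E (G (P X Y)) (G' (P X Y)),
    @binatural _ _ _ (comp_bifunctor G P) (comp_bifunctor G' P) a ->
    exists! b : forall Z, hom E (G Z) (G' Z),
      natural b /\ forall X Y, b (P X Y) = a X Y
}.

End Deligne.

(** * Tensor categories *)

(* Strictness is not required; the associator and the unitors are explicit. *)
Record moncat (k : fieldType) := MonCat {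
  mcat :> lincat k;
  tensor : bifunctor mcat mcat mcat;
  one : mcat;
  assoc : forall X Y Z, iso (tensor (tensor X Y) Z) (tensor X (tensor Y Z));
  lunit : forall X, iso (tensor one X) X;
  runit : forall X, iso (tensor X one) X;
  assoc_nat : forall X X' Y Y' Z Z' (f : hom mcat X X') (g : hom mcat Y Y')
      (h : hom mcat Z Z'),
    assoc X' Y' Z' \c bmap tensor (bmap tensor f g) h
    = bmap tensor f (bmap tensor g h) \c assoc X Y Z;
  lunit_nat : forall X Y (f : hom mcat X Y),
    lunit Y \c bmap tensor (idm one) f = f \c lunit X;
  runit_nat : forall X Y (f : hom mcat X Y),
    runit Y \c bmap tensor f (idm one) = f \c runit X;
  pentagon : forall X Y Z W,
    assoc X Y (tensor Z W) \c assoc (tensor X Y) Z W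
    = bmap tensor (idm X) (assoc Y Z W) \c assoc X (tensor Y Z) W
        \c bmap tensor (assoc X Y Z) (idm W);
  triangle : forall X Y,
    bmap tensor (idm X) (lunit Y) \c assoc X one Y = bmap tensor (runit X) (idm Y)
}.

Arguments one {k m}.
Arguments tensor {k m}.
Arguments assoc {k m} X Y Z.
Arguments lunit {k m} X.
Arguments runit {k m} X.

Notation "X \ox Y" := (bob tensor X Y) (at level 40, left associativity) : cat_scope.
Notation "f \oxm g" := (bmap tensor f g) (at level 40, left associativity) : cat_scope.

Section TensorCategories.
Variable k : fieldType.

(* X' is a left dual of X, and X is a right dual of X'. *)
Definition dual_pair (C : moncat k) (X' X : C) : Prop :=
  exists (ev : hom C (X' \ox X) one) (coev : hom C one (X \ox X')),
    runit X \c (idm X \oxm ev) \c assoc X X' X \c (coev \oxm idm X) \c bwd (lunit X)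
      = idm X /\
    lunit X' \c (ev \oxm idm X') \c bwd (assoc X' X X') \c (idm X' \oxm coev)
      \c bwd (runit X') = idm X'.

Definition rigid (C : moncat k) : Prop :=
  forall X : C, (exists X', dual_pair X' X) /\ (exists X', dual_pair X X').

Record tensor_category (C : moncat k) : Prop := {
  tc_abelian : abelian C;
  tc_rigid : rigid C;
  tc_fin_dim : fin_dim_homs C;
  tc_length : forall X : C, finite_length X;
  tc_unit : simple (@one k C)
}.

Definition finite_tensor_category (C : moncat k) : Prop :=
  tensor_category C /\ finite_cat C.

Definition trivial (C : moncat k) (X : C) : Prop :=
  exists I : finType, is_direct_sum (fun _ : I => @one k C) X.

End TensorCategories.

Section CategoryLemmas.
Variables (k : fieldType) (A : lincat k).

Lemma comp_zerol (X Y Z : A) (f : hom A X Y) : (0 : hom A Y Z) \c f = 0.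
Proof.
have := comp_linl f (-1) (0 : hom A Y Z) 0.
by rewrite scaler0 addr0 scaleN1r addNr.
Qed.

End CategoryLemmas.

(** * Hopf monads and their modules *)

Record hopf_monad (k : fieldType) (C : moncat k) := HopfMonad {
  hmonad_fun :> functor C C;
  mu : forall X : C, hom C (hmonad_fun (hmonad_fun X)) (hmonad_fun X);
  eta : forall X : C, hom C X (hmonad_fun X);
  xi : forall X Y : C, hom C (hmonad_fun (X \ox Y)) (hmonad_fun X \ox hmonad_fun Y);
  phi : hom C (hmonad_fun one) one;
  mu_nat : forall (X Y : C) (f : hom C X Y),
    mu Y \c fmap hmonad_fun (fmap hmonad_fun f) = fmap hmonad_fun f \c mu X;
  eta_nat : forall (X Y : C) (f : hom C X Y), eta Y \c f = fmap hmonad_fun f \c eta X;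
  xi_nat : forall (X X' Y Y' : C) (f : hom C X X') (g : hom C Y Y'),
    xi X' Y' \c fmap hmonad_fun (f \oxm g) = (fmap hmonad_fun f \oxm fmap hmonad_fun g) \c xi X Y;
  mu_assoc : forall X, mu X \c fmap hmonad_fun (mu X) = mu X \c mu (hmonad_fun X);
  mu_etal : forall X, mu X \c eta (hmonad_fun X) = idm (hmonad_fun X);
  mu_etar : forall X, mu X \c fmap hmonad_fun (eta X) = idm (hmonad_fun X);
  xi_assoc : forall X Y Z : C,
    assoc (hmonad_fun X) (hmonad_fun Y) (hmonad_fun Z) \c (xi X Y \oxm idm (hmonad_fun Z)) \c xi (X \ox Y) Z
    = (idm (hmonad_fun X) \oxm xi Y Z) \c xi X (Y \ox Z) \c fmap hmonad_fun (assoc X Y Z);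
  xi_lunit : forall X : C,
    lunit (hmonad_fun X) \c (phi \oxm idm (hmonad_fun X)) \c xi one X = fmap hmonad_fun (lunit X);
  xi_runit : forall X : C,
    runit (hmonad_fun X) \c (idm (hmonad_fun X) \oxm phi) \c xi X one = fmap hmonad_fun (runit X);
  mu_xi : forall X Y : C,
    xi X Y \c mu (X \ox Y)
    = (mu X \oxm mu Y) \c xi (hmonad_fun X) (hmonad_fun Y) \c fmap hmonad_fun (xi X Y);
  mu_phi : phi \c mu one = phi \c fmap hmonad_fun phi;
  eta_xi : forall X Y : C, xi X Y \c eta (X \ox Y) = eta X \oxm eta Y;
  eta_phi : phi \c eta one = idm one;
  fusionl : forall X Y : C, is_iso ((idm (hmonad_fun X) \oxm mu Y) \c xi X (hmonad_fun Y));
  fusionr : forall X Y : C, is_iso ((mu X \oxm idm (hmonad_fun Y)) \c xi (hmonad_fun X) Y)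
}.

Arguments mu {k C} h X.
Arguments eta {k C} h X.
Arguments xi {k C} h X Y.
Arguments phi {k C} h.

Definition normal (k : fieldType) (C : moncat k) (T : hopf_monad C) : Prop :=
  trivial (T one).

Section TModules.
Variables (k : fieldType) (C : moncat k) (T : hopf_monad C).

Record tmod := TMod {
  tm_car :> C;
  tm_act : hom C (T tm_car) tm_car;
  tm_assoc : tm_act \c fmap T tm_act = tm_act \c mu T tm_car;
  tm_unit : tm_act \c eta T tm_car = idm tm_car
}.

Program Definition tmod_homs (M N : tmod) : submodule (hom C M N) :=
  @Submodule k (hom C M N)
    (fun f => f \c tm_act M = tm_act N \c fmap T f) _ _.
Next Obligation.
move=> M N /=; have -> : fmap T (0 : hom C M N) = 0.
  have := @fmap_lin _ _ _ T M N (-1) 0 0.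
  by rewrite scaler0 addr0 scaleN1r addNr.
rewrite comp_zerol.
have := comp_linr (tm_act N) (-1) (0 : hom C (T M) (T N)) 0.
by rewrite scaler0 addr0 scaleN1r addNr.
Qed.
Next Obligation.
by move=> M N a f g hf hg; rewrite /= comp_linl fmap_lin comp_linr hf hg.
Qed.

Definition tmod_hom (M N : tmod) : lmodType k := sublmod (tmod_homs M N).

Program Definition tmod_id (M : tmod) : tmod_hom M M :=
  @Sublmod _ _ (tmod_homs M M) (idm (tm_car M)) _.
Next Obligation. by move=> M /=; rewrite compIm fmap_id compmI. Qed.

Program Definition tmod_comp (M N P : tmod) (g : tmod_hom N P) (f : tmod_hom M N) :
    tmod_hom M P := @Sublmod _ _ (tmod_homs M P) (smval g \c smval f) _.
Next Obligation.
move=> M N P [g hg] [f hf] /=.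
by rewrite -compA hf compA hg -compA fmap_comp.
Qed.

Program Definition tmod_cat : lincat k :=
  @LinCat k tmod tmod_hom tmod_id tmod_comp _ _ _ _ _.
Next Obligation. by move=> X Y Z f a g g'; apply: smval_inj; rewrite /= comp_linl. Qed.
Next Obligation. by move=> X Y Z f a g g'; apply: smval_inj; rewrite /= comp_linr. Qed.
Next Obligation. by move=> X Y Z W h g f; apply: smval_inj; rewrite /= compA. Qed.
Next Obligation. by move=> X Y f; apply: smval_inj; rewrite /= compIm. Qed.
Next Obligation. by move=> X Y f; apply: smval_inj; rewrite /= compmI. Qed.

Program Definition forget : functor tmod_cat C :=
  @Functor k tmod_cat C tm_car (fun M N (f : tmod_hom M N) => smval f) _ _ _.
Next Obligation. by []. Qed.
Next Obligation. by []. Qed.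
Next Obligation. by []. Qed.

Program Definition tmod_tensor_ob (M N : tmod) : tmod :=
  @TMod (tm_car M \ox tm_car N) ((tm_act M \oxm tm_act N) \c xi T M N) _ _.
Next Obligation.
move=> M N /=.
rewrite fmap_comp compA -(compA (tm_act M \oxm tm_act N)) xi_nat compA -bmap_comp.
by rewrite !tm_assoc bmap_comp -!compA mu_xi -!compA.
Qed.
Next Obligation.
by move=> M N /=; rewrite -compA eta_xi -bmap_comp !tm_unit bmap_id.
Qed.

Program Definition tmod_tensor_hom (M M' N N' : tmod)
    (f : tmod_hom M M') (g : tmod_hom N N') :
    tmod_hom (tmod_tensor_ob M N) (tmod_tensor_ob M' N') :=
  @Sublmod _ _ (tmod_homs (tmod_tensor_ob M N) (tmod_tensor_ob M' N'))
    (smval f \oxm smval g) _.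
Next Obligation.
move=> M M' N N' [f hf] [g hg] /=.
by rewrite compA -bmap_comp hf hg -compA xi_nat compA bmap_comp.
Qed.

Program Definition tmod_tensor : bifunctor tmod_cat tmod_cat tmod_cat :=
  @Bifunctor k tmod_cat tmod_cat tmod_cat tmod_tensor_ob tmod_tensor_hom _ _ _ _.
Next Obligation. by move=> X X' Y Y' g a f f'; apply: smval_inj; rewrite /= bmap_linl. Qed.
Next Obligation. by move=> X X' Y Y' g a f f'; apply: smval_inj; rewrite /= bmap_linr. Qed.
Next Obligation. by move=> X Y; apply: smval_inj; rewrite /= bmap_id. Qed.
Next Obligation. by move=> *; apply: smval_inj; rewrite /= bmap_comp. Qed.

Program Definition tmod_one : tmod := @TMod one (phi T) _ _.
Next Obligation. by rewrite mu_phi. Qed.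
Next Obligation. exact: eta_phi. Qed.

Lemma tmod_bwd_lin (M N : tmod) (f : iso (tm_car M) (tm_car N)) :
  tmod_homs M N f -> tmod_homs N M (bwd f).
Proof.
rewrite /tmod_homs /= => h.
rewrite -[LHS]compmI -fmap_id -(bwdK f) fmap_comp compA -(compA (bwd f)) -h.
by rewrite !compA fwdK compIm.
Qed.

Program Definition tmod_iso (M N : tmod_cat) (f : iso (tm_car M) (tm_car N))
    (h : tmod_homs M N f) : iso M N :=
  @Iso k tmod_cat M N (@Sublmod _ _ (tmod_homs M N) (fwd f) h)
    (@Sublmod _ _ (tmod_homs N M) (bwd f) (tmod_bwd_lin h)) _ _.
Next Obligation. by move=> M N f h; apply: smval_inj; rewrite /= fwdK. Qed.
Next Obligation. by move=> M N f h; apply: smval_inj; rewrite /= bwdK. Qed.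

Lemma tmod_assoc_lin (M N P : tmod) :
  tmod_homs (tmod_tensor_ob (tmod_tensor_ob M N) P) (tmod_tensor_ob M (tmod_tensor_ob N P))
    (assoc (tm_car M) (tm_car N) (tm_car P)).
Proof.
rewrite /tmod_homs /=.
rewrite -[X in _ \c (_ \oxm X \c _)]compmI bmap_comp.
rewrite -[X in _ = X \oxm _ \c _ \c _]compmI bmap_comp.
rewrite !compA assoc_nat -!compA; congr (_ \c _).
by rewrite !compA xi_assoc.
Qed.

Lemma tmod_lunit_lin (M : tmod) :
  tmod_homs (tmod_tensor_ob tmod_one M) M (lunit (tm_car M)).
Proof.
rewrite /tmod_homs /= -xi_lunit -[X in phi T \oxm X]compmI -[X in X \oxm _]compIm.
by rewrite bmap_comp !compA lunit_nat.
Qed.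

Lemma tmod_runit_lin (M : tmod) :
  tmod_homs (tmod_tensor_ob M tmod_one) M (runit (tm_car M)).
Proof.
rewrite /tmod_homs /= -xi_runit -[X in X \oxm phi T]compmI -[X in _ \oxm X]compIm.
by rewrite bmap_comp !compA runit_nat.
Qed.

Program Definition tmod_moncat : moncat k :=
  @MonCat k tmod_cat tmod_tensor tmod_one
    (fun M N P => tmod_iso (@tmod_assoc_lin M N P))
    (fun M => tmod_iso (@tmod_lunit_lin M))
    (fun M => tmod_iso (@tmod_runit_lin M)) _ _ _ _ _.
Next Obligation. by move=> *; apply: smval_inj; rewrite /= assoc_nat. Qed.
Next Obligation. by move=> *; apply: smval_inj; rewrite /= lunit_nat. Qed.
Next Obligation. by move=> *; apply: smval_inj; rewrite /= runit_nat. Qed.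
Next Obligation. by move=> *; apply: smval_inj; rewrite /= pentagon. Qed.
Next Obligation. by move=> *; apply: smval_inj; rewrite /= triangle. Qed.

End TModules.

(** * Trivial objects and the kernel of the forgetful functor *)

Section Trivial.
Variable k : fieldType.

Lemma lin0 (V W : lmodType k) (f : V -> W) : linear f -> f 0 = 0.
Proof. by move=> h; have := h (-1) 0 0; rewrite scaler0 addr0 scaleN1r addNr. Qed.

Lemma lin_sum (V W : lmodType k) (f : V -> W) (I : finType) (F : I -> V) :
  linear f -> f (\sum_i F i) = \sum_i f (F i).
Proof.
move=> h; elim/big_rec2: _ => [|i x y _ <-]; first exact: lin0.
by have := h 1 (F i) y; rewrite !scale1r.
Qed.

Lemma trivial_one (C : moncat k) : trivial (@one k C).
Proof.
exists unit, (fun=> idm one), (fun=> idm one); split.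
- by move=> i; rewrite compIm.
- by case=> -[] [].
- by rewrite (big_pred1 tt) => [|[] //]; rewrite compIm.
Qed.

Lemma trivial_tensor (C : moncat k) (X Y : C) :
  trivial X -> trivial Y -> trivial (X \ox Y).
Proof.
move=> [I [e [p [pe1 pe0 ep]]]] [J [e' [p' [pe1' pe0' ep']]]].
exists (I * J)%type.
exists (fun ij => (e ij.1 \oxm e' ij.2) \c bwd (lunit one)).
exists (fun ij => lunit one \c (p ij.1 \oxm p' ij.2)); split.
- move=> [i j] /=; rewrite compA -(compA (lunit one)) -bmap_comp pe1 pe1' bmap_id.
  by rewrite compmI bwdK.
- move=> [i j] [i' j'] /= neq; rewrite compA -(compA (lunit one)) -bmap_comp.
  suff -> : (p i' \c e i) \oxm (p' j' \c e' j) = 0.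
    by rewrite (lin0 (comp_linr _)) (lin0 (comp_linl _)).
  have [ei|/eqP ni] := eqVneq i i'; last first.
    by rewrite pe0 //; exact: (lin0 (bmap_linl tensor _)).
  rewrite (pe0' j j'); first exact: (lin0 (bmap_linr tensor _)).
  by move=> ej; apply: neq; rewrite ei ej.
- rewrite -bmap_id -ep -ep' (lin_sum _ (bmap_linl tensor _)).
  under [RHS]eq_bigr => i _ do rewrite (lin_sum _ (bmap_linr tensor _)).
  rewrite pair_big /=; apply: eq_bigr => -[i j] _ /=.
  by rewrite compA -(compA _ (bwd _)) fwdK compmI bmap_comp.
Qed.

End Trivial.

Section FullSubcategory.
Variables (k : fieldType) (C : moncat k) (P : C -> Prop).
Hypotheses (P1 : P one) (PT : forall X Y : C, P X -> P Y -> P (X \ox Y)).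

Record full_ob := FullOb { fo_val :> C; fo_prop : P fo_val }.

Program Definition full_cat : lincat k :=
  @LinCat k full_ob (fun X Y => hom C X Y) (fun X => idm (fo_val X))
    (fun X Y Z g f => g \c f) _ _ _ _ _.
Next Obligation. by move=> X Y Z f; exact: comp_linl. Qed.
Next Obligation. by move=> X Y Z g; exact: comp_linr. Qed.
Next Obligation. by move=> X Y Z W h g f; exact: compA. Qed.
Next Obligation. by move=> X Y f; exact: compIm. Qed.
Next Obligation. by move=> X Y f; exact: compmI. Qed.

Program Definition full_tensor : bifunctor full_cat full_cat full_cat :=
  @Bifunctor k full_cat full_cat full_cat
    (fun X Y => FullOb (PT (fo_prop X) (fo_prop Y)))
    (fun X X' Y Y' f g => f \oxm g) _ _ _ _.
Next Obligation. by move=> X X' Y Y' g a f f'; exact: (bmap_linl tensor). Qed.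
Next Obligation. by move=> X X' Y Y' g a f f'; exact: (bmap_linr tensor). Qed.
Next Obligation. by move=> X Y; exact: bmap_id. Qed.
Next Obligation. by move=> *; exact: bmap_comp. Qed.

Definition full_iso (X Y : full_cat) (f : iso (fo_val X) (fo_val Y)) : iso X Y :=
  @Iso k full_cat X Y (fwd f) (bwd f) (fwdK f) (bwdK f).

Program Definition full_moncat : moncat k :=
  @MonCat k full_cat full_tensor (FullOb P1)
    (fun X Y Z => @full_iso (full_tensor (full_tensor X Y) Z) (full_tensor X (full_tensor Y Z))
       (assoc (fo_val X) (fo_val Y) (fo_val Z)))
    (fun X => @full_iso (full_tensor (FullOb P1) X) X (lunit (fo_val X)))
    (fun X => @full_iso (full_tensor X (FullOb P1)) X (runit (fo_val X))) _ _ _ _ _.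
Next Obligation. by move=> *; exact: (@assoc_nat k C). Qed.
Next Obligation. by move=> *; exact: (@lunit_nat k C). Qed.
Next Obligation. by move=> *; exact: (@runit_nat k C). Qed.
Next Obligation. by move=> *; exact: (@pentagon k C). Qed.
Next Obligation. by move=> *; exact: (@triangle k C). Qed.

End FullSubcategory.

Section Kernel.
Variables (k : fieldType) (C : moncat k) (T : hopf_monad C).

Definition ker_forget : moncat k :=
  @full_moncat k (tmod_moncat T) (fun M => trivial (forget T M))
    (trivial_one C) (fun _ _ => @trivial_tensor k C _ _).

Definition ker_car (X : ker_forget) : C := forget T (fo_val X).

Definition omega (X : ker_forget) : lmodType k := hom C one (ker_car X).

Definition omega_map (X Y : ker_forget) (f : hom ker_forget X Y) (v : omega X) : omega Y :=
  fmap (forget T) f \c v.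

Lemma omega_map_lin (X Y : ker_forget) (f : hom ker_forget X Y) :
  linear (omega_map f).
Proof. exact: comp_linr. Qed.

(* The monoidal structure omega X (x) omega Y -> omega (X (x) Y), as a bilinear map. *)
Definition omega_tensor (X Y : ker_forget) (v : omega X) (w : omega Y) : omega (X \ox Y) :=
  (v \oxm w) \c bwd (lunit one).

Definition omega_unit : omega one := idm one.

End Kernel.

(** * Hopf algebras *)

Record hopf_algebra (k : fieldType) := HopfAlgebra {
  ha :> falgType k;
  comul : ha -> tens ha ha;
  counit : ha -> k;
  antipode : ha -> ha;
  comul_lin : linear comul;
  counit_lin : linear (counit : ha -> k^o);
  antipode_lin : linear antipode;
  comulA : forall x,
    tlift (fun y z => tlift (fun y1 y2 => ptens y1 (ptens y2 z)) (comul y)) (comul x)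
    = tlift (fun y z => ptens y (comul z)) (comul x);
  counitl : forall x, tlift (fun y z => counit y *: z) (comul x) = x;
  counitr : forall x, tlift (fun y z => counit z *: y) (comul x) = x;
  comul1 : comul 1 = ptens 1 1;
  comulM : forall x y,
    comul (x * y)
    = tlift (fun x1 x2 => tlift (fun y1 y2 => ptens (x1 * y1) (x2 * y2)) (comul y)) (comul x);
  counit1 : counit 1 = 1;
  counitM : forall x y, counit (x * y) = counit x * counit y;
  antipodel : forall x, tlift (fun y z => antipode y * z) (comul x) = (counit x)%:A;
  antipoder : forall x, tlift (fun y z => y * antipode z) (comul x) = (counit x)%:A
}.

Section InducedHopfAlgebra.
Variables (k : fieldType) (C : moncat k) (T : hopf_monad C).
Local Notation K := (ker_forget T).

(* A dinatural family of maps omega(X)^* (x) omega(X) -> W, as bilinear maps. *)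
Record is_wedge (W : lmodType k) (i : forall X : K, dual (omega X) -> omega X -> W) : Prop := {
  wedge_linl : forall (X : K) (v : omega X), linear (fun a : dual (omega X) => i X a v);
  wedge_linr : forall (X : K) (a : dual (omega X)), linear (i X a);
  wedge_dinat : forall (X Y : K) (f : hom K X Y) (a : dual (omega Y)) (v : omega X),
    i X (dual_pullback (omega_map_lin f) a) v = i Y a (omega_map f v)
}.

Definition is_coend (H : lmodType k)
    (i : forall X : K, dual (omega X) -> omega X -> H) : Prop :=
  is_wedge i /\
  forall (W : lmodType k) (j : forall X : K, dual (omega X) -> omega X -> W),
    is_wedge j ->
    exists! u : H -> W, linear u /\ forall X a v, u (i X a v) = j X a v.

(* H is the coend, with the Hopf algebra structure for which the universal coaction
   v |-> \sum_j i(b_j, v) (x) e_j on omega(X), where v = \sum_j b_j(v) e_j, is counital,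
   coassociative and compatible with tensor products; it is a left coaction. *)
Definition induced_hopf_algebra (H : hopf_algebra k) : Prop :=
  exists i : forall X : K, dual (omega X) -> omega X -> H,
  is_coend i /\
  (forall (X : K) (a : dual (omega X)) (v : omega X),
     counit (i X a v) = dual_eval a v) /\
  (forall (X : K) (n : nat) (b : 'I_n -> dual (omega X)) (e : 'I_n -> omega X),
     (forall v, v = \sum_j dual_eval (b j) v *: e j) ->
     forall (a : dual (omega X)) (v : omega X),
     comul (i X a v) = \sum_j ptens (i X (b j) v) (i X a (e j))) /\
  (forall a : dual (omega one), dual_eval a (omega_unit T) = 1 ->
     i one a (omega_unit T) = 1) /\
  (forall (X Y : K) (a : dual (omega X)) (b : dual (omega Y)) (c : dual (omega (X \ox Y))),
     (forall v w, dual_eval c (omega_tensor v w) = dual_eval a v * dual_eval b w) ->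
     forall v w, i X a v * i Y b w = i (X \ox Y) c (omega_tensor v w)).

End InducedHopfAlgebra.

(** * The category of finite-dimensional left H-modules *)

Section HModules.
Variables (k : fieldType) (H : falgType k).

(* The underlying spaces are taken to be the spaces k^n: the type of all vector
   spaces lies in a larger universe than the objects of a lincat.  Every
   finite-dimensional H-module is isomorphic to one of these. *)
Record hmod := HMod {
  hm_dim : nat;
  hm_act : H -> 'cV[k]_hm_dim -> 'cV[k]_hm_dim;
  hm_linl : forall v, linear (hm_act^~ v);
  hm_linr : forall x, linear (hm_act x);
  hm_mul : forall x y v, hm_act (x * y) v = hm_act x (hm_act y v);
  hm_one : forall v, hm_act 1 v = v
}.

Definition hm_car (V : hmod) : vectType k := 'cV[k]_(hm_dim V).

Program Definition hmod_homs (V W : hmod) : submodule ('Hom(hm_car V, hm_car W)) :=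
  @Submodule k 'Hom(hm_car V, hm_car W)
    (fun f => forall x v, f (hm_act x v) = hm_act x (f v)) _ _.
Next Obligation.
by move=> V W x v; rewrite /= !lfunE /= (lin0 (hm_linr _)).
Qed.
Next Obligation.
move=> V W a f g hf hg x v /=.
by rewrite !lfunE /= !lfunE /= hf hg hm_linr.
Qed.

Definition hmod_hom (V W : hmod) : lmodType k := sublmod (hmod_homs V W).

Program Definition hmod_id (V : hmod) : hmod_hom V V :=
  @Sublmod _ _ (hmod_homs V V) \1%VF _.
Next Obligation. by move=> V x v; rewrite !lfunE. Qed.

Program Definition hmod_comp (V W Z : hmod) (g : hmod_hom W Z) (f : hmod_hom V W) :
    hmod_hom V Z := @Sublmod _ _ (hmod_homs V Z) (smval g \o smval f)%VF _.
Next Obligation.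
by move=> V W Z [g hg] [f hf] x v /=; rewrite !comp_lfunE hf hg.
Qed.

Program Definition hmod_cat : lincat k :=
  @LinCat k hmod hmod_hom hmod_id hmod_comp _ _ _ _ _.
Next Obligation.
by move=> X Y Z f a g g'; apply: smval_inj; rewrite /= comp_lfunDl comp_lfunZl.
Qed.
Next Obligation.
by move=> X Y Z f a g g'; apply: smval_inj; rewrite /= comp_lfunDr comp_lfunZr.
Qed.
Next Obligation. by move=> X Y Z W h g f; apply: smval_inj; rewrite /= comp_lfunA. Qed.
Next Obligation. by move=> X Y f; apply: smval_inj; rewrite /= comp_lfun1l. Qed.
Next Obligation. by move=> X Y f; apply: smval_inj; rewrite /= comp_lfun1r. Qed.

End HModules.

(** * Module categories and module functors *)

Record modcat (k : fieldType) (D : moncat k) := ModCat {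
  mc_cat :> lincat k;
  act : bifunctor D mc_cat mc_cat;
  massoc : forall X Y M, iso (act (X \ox Y) M) (act X (act Y M));
  munit : forall M, iso (act one M) M;
  massoc_nat : forall (X X' Y Y' : D) M M' (f : hom D X X') (g : hom D Y Y')
      (h : hom mc_cat M M'),
    massoc X' Y' M' \c bmap act (f \oxm g) h
    = bmap act f (bmap act g h) \c massoc X Y M;
  munit_nat : forall M M' (h : hom mc_cat M M'),
    munit M' \c bmap act (idm one) h = h \c munit M;
  mpentagon : forall (X Y Z : D) M,
    massoc X Y (act Z M) \c massoc (X \ox Y) Z M
    = bmap act (idm X) (massoc Y Z M) \c massoc X (Y \ox Z) M
        \c bmap act (assoc X Y Z) (idm M);
  mtriangle : forall (X : D) M,
    bmap act (idm X) (munit M) \c massoc X one M = bmap act (runit X) (idm M)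
}.

Arguments act {k D m}.
Arguments massoc {k D m} X Y M.
Arguments munit {k D m} M.

(* Module functors are k-linear, as every functor here, but not assumed exact. *)
Record modfunctor (k : fieldType) (D : moncat k) (M N : modcat D) := ModFunctor {
  mf_fun :> functor M N;
  mf_iso : forall (X : D) (A : M), iso (mf_fun (act X A)) (act X (mf_fun A));
  mf_nat : forall (X X' : D) (A A' : M) (f : hom D X X') (g : hom M A A'),
    mf_iso X' A' \c fmap mf_fun (bmap act f g)
    = bmap act f (fmap mf_fun g) \c mf_iso X A;
  mf_assoc : forall (X Y : D) (A : M),
    massoc X Y (mf_fun A) \c mf_iso (X \ox Y) A
    = bmap act (idm X) (mf_iso Y A) \c mf_iso X (act Y A) \c fmap mf_fun (massoc X Y A);
  mf_unit : forall A : M, munit (mf_fun A) \c mf_iso one A = fmap mf_fun (munit A)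
}.

Arguments mf_iso {k D M N} m X A.

Section ModuleFunctors.
Variables (k : fieldType) (D : moncat k) (M N : modcat D).

Definition is_modnat (F G : modfunctor M N) (a : dprod (fun A : M => hom N (F A) (G A))) :=
  natural a /\
  forall (X : D) (A : M), bmap act (idm X) (a A) \c mf_iso F X A = mf_iso G X A \c a (act X A).

Program Definition modnats (F G : modfunctor M N) :
    submodule (dprod (fun A : M => hom N (F A) (G A))) :=
  @Submodule k (dprod (fun A : M => hom N (F A) (G A))) (@is_modnat F G) _ _.
Next Obligation.
move=> F G; split=> [A B f | X A] /=.
- rewrite (_ : (0 : dprod _) A = 0) // (_ : (0 : dprod _) B = 0) //.
  by rewrite (lin0 (comp_linl _)) (lin0 (comp_linr _)).
- rewrite (_ : (0 : dprod _) A = 0) // (_ : (0 : dprod _) (act X A) = 0) //.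
  by rewrite (lin0 (bmap_linr act _)) (lin0 (comp_linl _)) (lin0 (comp_linr _)).
Qed.
Next Obligation.
move=> F G c a b [na ma] [nb mb]; split=> [A B f | X A] /=.
- rewrite (_ : (c *: a + b) A = c *: a A + b A) // (_ : (c *: a + b) B = c *: a B + b B) //.
  by rewrite comp_linl comp_linr na nb.
- rewrite (_ : (c *: a + b) A = c *: a A + b A) //.
  rewrite (_ : (c *: a + b) (act X A) = c *: a (act X A) + b (act X A)) //.
  by rewrite bmap_linr comp_linl comp_linr ma mb.
Qed.

Definition modnat (F G : modfunctor M N) : lmodType k := sublmod (modnats F G).

Lemma modnat_ext (F G : modfunctor M N) (a b : modnat F G) :
  (forall A, smval a A = smval b A) -> a = b.
Proof. by move=> h; apply: smval_inj; apply: functional_extensionality_dep. Qed.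

Program Definition modnat_id (F : modfunctor M N) : modnat F F :=
  @Sublmod _ _ (modnats F F) (fun A => idm (F A)) _.
Next Obligation.
move=> F; split=> [A B f | X A] /=; first by rewrite compIm compmI.
by rewrite bmap_id compIm compmI.
Qed.

Program Definition modnat_comp (F G L : modfunctor M N) (b : modnat G L) (a : modnat F G) :
    modnat F L :=
  @Sublmod _ _ (modnats F L) (fun A => smval b A \c smval a A) _.
Next Obligation.
move=> F G L [b [nb mb]] [a [na ma]]; split=> [A B f | X A] /=.
- by rewrite -compA na compA nb compA.
- by rewrite bmap_comp_idl -compA ma compA mb compA.
Qed.

Program Definition modfunctor_cat : lincat k :=
  @LinCat k (modfunctor M N) modnat modnat_id modnat_comp _ _ _ _ _.
Next Obligation. by move=> F G L f a g g'; apply: modnat_ext => A; exact: comp_linl. Qed.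
Next Obligation. by move=> F G L f a g g'; apply: modnat_ext => A; exact: comp_linr. Qed.
Next Obligation. by move=> *; apply: modnat_ext => A; exact: compA. Qed.
Next Obligation. by move=> *; apply: modnat_ext => A; exact: compIm. Qed.
Next Obligation. by move=> *; apply: modnat_ext => A; exact: compmI. Qed.

End ModuleFunctors.

Section EndCategory.
Variables (k : fieldType) (D : moncat k) (M : modcat D).
Local Notation E := (modfunctor_cat M M).

Program Definition modfunctor_id : modfunctor M M :=
  @ModFunctor k D M M (id_functor M)
    (fun X A => iso_refl (act X A)) _ _ _.
Next Obligation. by move=> *; rewrite /= compIm compmI. Qed.
Next Obligation. by move=> *; rewrite /= compmI bmap_id !compIm. Qed.
Next Obligation. by move=> *; rewrite /= compmI. Qed.

Program Definition modfunctor_comp (F G : modfunctor M M) : modfunctor M M :=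
  @ModFunctor k D M M (comp_functor F G)
    (fun X A => iso_comp (mf_iso F X (G A)) (iso_map F (mf_iso G X A))) _ _ _.
Next Obligation.
move=> F G X X' A A' f g /=.
by rewrite -compA -fmap_comp mf_nat fmap_comp compA mf_nat compA.
Qed.
Next Obligation.
move=> F G X Y A /=.
rewrite compA mf_assoc -compA -fmap_comp mf_assoc !fmap_comp.
rewrite bmap_comp_idl -!compA; congr (_ \c _).
by rewrite !compA mf_nat.
Qed.
Next Obligation. by move=> F G A /=; rewrite compA mf_unit -fmap_comp mf_unit. Qed.

Program Definition modnat_hcomp (F F' G G' : modfunctor M M)
    (a : modnat F F') (b : modnat G G') :
    modnat (modfunctor_comp F G) (modfunctor_comp F' G') :=
  @Sublmod _ _ (modnats (modfunctor_comp F G) (modfunctor_comp F' G'))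
    (fun A => smval a (G' A) \c fmap F (smval b A)) _.
Next Obligation.
move=> F F' G G' [a [na ma]] [b [nb mb]]; split=> [A B f | X A] /=.
- by rewrite -compA -fmap_comp nb fmap_comp compA na compA.
- have e1 := mf_nat F (idm X) (b A).
  have e2 := congr1 (fmap F) (mb X A); rewrite !fmap_comp in e2.
  have e3 := ma X (G' A).
  have e4 := na _ _ (fwd (mf_iso G' X A)).
  rewrite bmap_comp_idl -compA (compA _ (fwd (mf_iso F _ _))) -e1 -compA e2.
  by rewrite compA compA e3 -!compA; congr (_ \c _); rewrite !compA e4.
Qed.

Program Definition end_tensor : bifunctor E E E :=
  @Bifunctor k E E E modfunctor_comp modnat_hcomp _ _ _ _.
Next Obligation.
by move=> F F' G G' g a f f'; apply: modnat_ext => A; exact: comp_linl.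
Qed.
Next Obligation.
move=> F F' G G' g a f f'; apply: modnat_ext => A /=.
rewrite (_ : (a *: smval f + smval f') A = a *: smval f A + smval f' A) //.
by rewrite fmap_lin comp_linr.
Qed.
Next Obligation. by move=> F G; apply: modnat_ext => A /=; rewrite fmap_id compIm. Qed.
Next Obligation.
move=> F F' F'' G G' G'' [f' [nf' mf']] [f [nf mf]] [g' [ng' mg']] [g [ng mg]].
apply: modnat_ext => A /=.
by rewrite fmap_comp -!compA; congr (_ \c _); rewrite !compA nf.
Qed.

(* Composition of functors is strictly associative and unital, so the associator and
   the unitors have identity components. *)
Program Definition end_assoc (F G L : E) : iso (end_tensor (end_tensor F G) L)
    (end_tensor F (end_tensor G L)) :=
  @Iso k E (end_tensor (end_tensor F G) L) (end_tensor F (end_tensor G L))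
    (@Sublmod _ _ (modnats (modfunctor_comp (modfunctor_comp F G) L)
                     (modfunctor_comp F (modfunctor_comp G L)))
       (fun A => idm (F (G (L A)))) _)
    (@Sublmod _ _ (modnats (modfunctor_comp F (modfunctor_comp G L))
                     (modfunctor_comp (modfunctor_comp F G) L))
       (fun A => idm (F (G (L A)))) _) _ _.
Next Obligation.
move=> F G L; split=> [A B f | X A] /=; first by rewrite compIm compmI.
by rewrite bmap_id compIm compmI fmap_comp compA.
Qed.
Next Obligation.
move=> F G L; split=> [A B f | X A] /=; first by rewrite compIm compmI.
by rewrite bmap_id compIm compmI fmap_comp compA.
Qed.
Next Obligation. by move=> *; apply: modnat_ext => A /=; rewrite compIm. Qed.
Next Obligation. by move=> *; apply: modnat_ext => A /=; rewrite compIm. Qed.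

Program Definition end_lunit (F : E) : iso (end_tensor modfunctor_id F) F :=
  @Iso k E (end_tensor modfunctor_id F) F
    (@Sublmod _ _ (modnats (modfunctor_comp modfunctor_id F) F) (fun A => idm (F A)) _)
    (@Sublmod _ _ (modnats F (modfunctor_comp modfunctor_id F)) (fun A => idm (F A)) _) _ _.
Next Obligation.
move=> F; split=> [A B f | X A] /=; first by rewrite compIm compmI.
by rewrite bmap_id !compIm compmI.
Qed.
Next Obligation.
move=> F; split=> [A B f | X A] /=; first by rewrite compIm compmI.
by rewrite bmap_id !compIm compmI.
Qed.
Next Obligation. by move=> *; apply: modnat_ext => A /=; rewrite compIm. Qed.
Next Obligation. by move=> *; apply: modnat_ext => A /=; rewrite compIm. Qed.

Program Definition end_runit (F : E) : iso (end_tensor F modfunctor_id) F :=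
  @Iso k E (end_tensor F modfunctor_id) F
    (@Sublmod _ _ (modnats (modfunctor_comp F modfunctor_id) F) (fun A => idm (F A)) _)
    (@Sublmod _ _ (modnats F (modfunctor_comp F modfunctor_id)) (fun A => idm (F A)) _) _ _.
Next Obligation.
move=> F; split=> [A B f | X A] /=; first by rewrite compIm compmI.
by rewrite bmap_id fmap_id compIm !compmI.
Qed.
Next Obligation.
move=> F; split=> [A B f | X A] /=; first by rewrite compIm compmI.
by rewrite bmap_id fmap_id compIm !compmI.
Qed.
Next Obligation. by move=> *; apply: modnat_ext => A /=; rewrite compIm. Qed.
Next Obligation. by move=> *; apply: modnat_ext => A /=; rewrite compIm. Qed.

Program Definition end_moncat : moncat k :=
  @MonCat k E end_tensor modfunctor_id end_assoc end_lunit end_runit _ _ _ _ _.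
Next Obligation.
move=> F F' G G' L L' f g h; apply: modnat_ext => A /=.
by rewrite compIm compmI fmap_comp compA.
Qed.
Next Obligation.
by move=> F G f; apply: modnat_ext => A /=; rewrite !compIm compmI.
Qed.
Next Obligation.
by move=> F G f; apply: modnat_ext => A /=; rewrite fmap_id !compmI compIm.
Qed.
Next Obligation.
by move=> F G L N; apply: modnat_ext => A /=; rewrite !fmap_id !compIm.
Qed.
Next Obligation.
by move=> F G; apply: modnat_ext => A /=; rewrite !fmap_id !compIm.
Qed.

End EndCategory.

Section Reverse.
Variables (k : fieldType) (C : moncat k).

Program Definition rev_tensor : bifunctor C C C :=
  @Bifunctor k C C C (fun X Y => Y \ox X) (fun _ _ _ _ f g => g \oxm f) _ _ _ _.
Next Obligation. by move=> X X' Y Y' g a f f'; rewrite bmap_linr. Qed.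
Next Obligation. by move=> X X' Y Y' g a f f'; rewrite bmap_linl. Qed.
Next Obligation. by move=> X Y; exact: bmap_id. Qed.
Next Obligation. by move=> *; exact: bmap_comp. Qed.

Program Definition rev_moncat : moncat k :=
  @MonCat k C rev_tensor one (fun X Y Z => iso_sym (assoc Z Y X)) (@runit k C)
    (@lunit k C) _ _ _ _ _.
Next Obligation.
move=> X X' Y Y' Z Z' f g h /=.
rewrite -[LHS]compmI -(bwdK (assoc Z Y X)) !compA; congr (_ \c _).
by rewrite -(compA (bwd _)) -assoc_nat compA fwdK compIm.
Qed.
Next Obligation. by move=> X Y f /=; rewrite runit_nat. Qed.
Next Obligation. by move=> X Y f /=; rewrite lunit_nat. Qed.
Next Obligation.
move=> X Y Z W /=.
have := pentagon W Z Y X.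
move=> /(@bwd_inj _ _ _ _
  (iso_comp (assoc W Z (Y \ox X)) (assoc (W \ox Z) Y X))
  (iso_comp (iso_comp (iso_bmap tensor (iso_refl W) (assoc Z Y X)) (assoc W (Z \ox Y) X))
     (iso_bmap tensor (assoc W Z Y) (iso_refl X)))) /= ->.
by rewrite !compA.
Qed.
Next Obligation.
move=> X Y /=.
by rewrite -triangle -compA bwdK compmI.
Qed.

End Reverse.

(** * The crossed product *)

Section CrossedProduct.
Variables (k : fieldType) (C : moncat k) (T : hopf_monad C).
Local Notation CT := (tmod_moncat T).

Program Definition tmod_act : bifunctor CT C C :=
  @Bifunctor k CT C C (fun M Y => forget T M \ox Y)
    (fun _ _ _ _ f g => fmap (forget T) f \oxm g) _ _ _ _.
Next Obligation. by move=> X X' Y Y' g a f f'; exact: (bmap_linl tensor). Qed.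
Next Obligation. by move=> X X' Y Y' g a f f'; exact: (bmap_linr tensor). Qed.
Next Obligation. by move=> X Y; exact: (bmap_id tensor). Qed.
Next Obligation. by move=> *; exact: (bmap_comp tensor). Qed.

Program Definition tmod_modcat : modcat CT :=
  @ModCat k CT C tmod_act (fun X Y M => assoc (forget T X) (forget T Y) M)
    (fun M => lunit M) _ _ _ _.
Next Obligation. by move=> *; exact: (@assoc_nat k C). Qed.
Next Obligation. by move=> *; exact: (@lunit_nat k C). Qed.
Next Obligation. by move=> *; exact: (@pentagon k C). Qed.
Next Obligation. by move=> *; exact: (@triangle k C). Qed.

Definition crossed_product : moncat k := end_moncat tmod_modcat.

End CrossedProduct.

(* Main.v *)
From HB Require Import structures.
From mathcomp Require Import all_boot all_algebra.
From mathcomp Require Import falgebra boolp.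
Require Import Defs.

(** Write [T1] for [T 1].  Evaluation at [1] on the category of [C^T]-module endofunctors of
    [C] has the right adjoint [Y |-> (X |-> T X (x) Y)]; the unit of the adjunction at [G] is
    [G X -> G (T X (x) 1) ~ T X (x) G 1], given by the unit of [T] and the module structure of
    [G].  Since [T] is exact and faithful, [X] is the equalizer of [T X => T (T X)], and every
    module functor preserves it: tensoring with [T Q], [Q] a projective cover of [1], splits
    every exact sequence, and module functors commute with [T Q (x) -].  Hence evaluation at [1]
    is comonadic: module endofunctors are the comodules in [C] of the coalgebra [T1].  When [T1]
    is trivial its coalgebra structure is dual to the algebra [H], so that these comodules are
    the right [H]-modules in [C]; the antipode is bijective because the left fusion operator is,
    and turns them into left [H]-modules in [C], which form the Deligne product of [H-mod] and
    [C]. *)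

Set Implicit Arguments.
Unset Strict Implicit.
Unset Printing Implicit Defensive.

Import GRing.Theory.
Local Open Scope ring_scope.
Local Open Scope cat_scope.
Local Obligation Tactic := idtac.

(** * Linear categories *)

(** Module endofunctors are only assumed linear, so their left exactness has to be established
    before they can be reconstructed from their comodules. Projectivity of [Q] alone does not
    suffice: a module functor commutes with tensoring by [T]-modules, and [Q] carries no action. The
    free module [T Q] does. What passes from [Q] to [T Q] is the exactness of the functor of forms
    on [Q \ox -], which is why the argument is phrased with [hom_tensor_exact].

    The coend [H] is never computed. Normality puts the free module [T one] into the kernel of the
    forgetful functor, and evaluating the universal family there, at the unit of [T], identifies [H]
    with the space of forms on [T one].

    For the Deligne product, the point is that a module [M] in [C] is a finite colimit [H (x)_H M]
    of objects of the form [box V X], so that right exact functors are governed by their values on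
    these. *)

Section LinearMaps.
Variables (k : fieldType) (V W : lmodType k) (f : V -> W).
Hypothesis hf : linear f.

Lemma linD x y : f (x + y) = f x + f y.
Proof. by rewrite -{1}(scale1r x) hf scale1r. Qed.

Lemma linZ a x : f (a *: x) = a *: f x.
Proof. by rewrite -[a *: x]addr0 hf (lin0 hf) addr0. Qed.

Lemma linN x : f (- x) = - f x.
Proof. by rewrite -scaleN1r linZ scaleN1r. Qed.

Lemma linB x y : f (x - y) = f x - f y.
Proof. by rewrite linD linN. Qed.

End LinearMaps.

Section Category.
Variables (k : fieldType) (A : lincat k).
Implicit Types X Y Z W : A.

Lemma compDl X Y Z (g g' : hom A Y Z) (f : hom A X Y) :
  (g + g') \c f = g \c f + g' \c f.
Proof. exact: (linD (comp_linl f)). Qed.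

Lemma compDr X Y Z (g : hom A Y Z) (f f' : hom A X Y) :
  g \c (f + f') = g \c f + g \c f'.
Proof. exact: (linD (comp_linr g)). Qed.

Lemma compBl X Y Z (g g' : hom A Y Z) (f : hom A X Y) :
  (g - g') \c f = g \c f - g' \c f.
Proof. exact: (linB (comp_linl f)). Qed.

Lemma compBr X Y Z (g : hom A Y Z) (f f' : hom A X Y) :
  g \c (f - f') = g \c f - g \c f'.
Proof. exact: (linB (comp_linr g)). Qed.

Lemma compZl X Y Z a (g : hom A Y Z) (f : hom A X Y) :
  (a *: g) \c f = a *: (g \c f).
Proof. exact: (linZ (comp_linl f)). Qed.

Lemma compZr X Y Z a (g : hom A Y Z) (f : hom A X Y) :
  g \c (a *: f) = a *: (g \c f).
Proof. exact: (linZ (comp_linr g)). Qed.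

Lemma comp0l X Y Z (f : hom A X Y) : (0 : hom A Y Z) \c f = 0.
Proof. exact: (lin0 (comp_linl f)). Qed.

Lemma comp0r X Y Z (g : hom A Y Z) : g \c (0 : hom A X Y) = 0.
Proof. exact: (lin0 (comp_linr g)). Qed.

Lemma comp_suml X Y Z (I : finType) (g : I -> hom A Y Z) (f : hom A X Y) :
  (\sum_i g i) \c f = \sum_i (g i \c f).
Proof. exact: (lin_sum _ (comp_linl f)). Qed.

Lemma comp_sumr X Y Z (I : finType) (g : hom A Y Z) (f : I -> hom A X Y) :
  g \c (\sum_i f i) = \sum_i (g \c f i).
Proof. exact: (lin_sum _ (comp_linr g)). Qed.

Lemma mono0 X Y (f : hom A X Y) :
  (forall Z (g : hom A Z X), f \c g = 0 -> g = 0) -> mono f.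
Proof.
by move=> h Z g g' e; apply/eqP; rewrite -subr_eq0; apply/eqP/h; rewrite compBr e subrr.
Qed.

Lemma mono_eq0 X Y Z (f : hom A X Y) (g : hom A Z X) : mono f -> f \c g = 0 -> g = 0.
Proof. by move=> mf e; apply: mf; rewrite e comp0r. Qed.

Lemma epi0 X Y (f : hom A X Y) :
  (forall Z (g : hom A Y Z), g \c f = 0 -> g = 0) -> epi f.
Proof.
by move=> h Z g g' e; apply/eqP; rewrite -subr_eq0; apply/eqP/h; rewrite compBl e subrr.
Qed.

Lemma epi_eq0 X Y Z (f : hom A X Y) (g : hom A Y Z) : epi f -> g \c f = 0 -> g = 0.
Proof. by move=> mf e; apply: mf; rewrite e comp0l. Qed.

Lemma zero_dom X Y (f : hom A X Y) : is_zero X -> f = 0.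
Proof. by rewrite /is_zero -[f]compmI => ->; rewrite comp0r. Qed.

Lemma zero_cod X Y (f : hom A X Y) : is_zero Y -> f = 0.
Proof. by rewrite /is_zero -[f]compIm => ->; rewrite comp0l. Qed.

Lemma kernel_mono X Y Z (i : hom A X Y) (f : hom A Y Z) : is_kernel i f -> mono i.
Proof.
move=> [fi h]; apply: mono0 => W g ig.
have [|u [_ uu]] := h W 0; first exact: comp0r.
by rewrite -(uu g ig) (uu 0 (comp0r _ _)).
Qed.

Lemma kernel_lift X Y Z W (i : hom A X Y) (f : hom A Y Z) (g : hom A W Y) :
  is_kernel i f -> f \c g = 0 -> exists h, i \c h = g.
Proof. by move=> [fi h] /h[u [e _]]; exists u. Qed.

Lemma is_kernelI X Y Z (i : hom A X Y) (f : hom A Y Z) :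
  f \c i = 0 -> mono i ->
  (forall W (g : hom A W Y), f \c g = 0 -> exists h, i \c h = g) -> is_kernel i f.
Proof.
move=> fi mi h; split=> // W g /h[u e]; exists u; split=> // v ev.
by apply: mi; rewrite e ev.
Qed.

Lemma cokernel_epi X Y Z (p : hom A Y Z) (f : hom A X Y) : is_cokernel p f -> epi p.
Proof.
move=> [fi h]; apply: epi0 => W g ig.
have [|u [_ uu]] := h W 0; first exact: comp0l.
by rewrite -(uu g ig) (uu 0 (comp0l _ _)).
Qed.

Lemma cokernel_desc X Y Z W (p : hom A Y Z) (f : hom A X Y) (g : hom A Y W) :
  is_cokernel p f -> g \c f = 0 -> exists h, h \c p = g.
Proof. by move=> [fi h] /h[u [e _]]; exists u. Qed.

Lemma is_cokernelI X Y Z (p : hom A Y Z) (f : hom A X Y) :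
  p \c f = 0 -> epi p ->
  (forall W (g : hom A Y W), g \c f = 0 -> exists h, h \c p = g) -> is_cokernel p f.
Proof.
move=> fi mi h; split=> // W g /h[u e]; exists u; split=> // v ev.
by apply: mi; rewrite e ev.
Qed.

Lemma iso_is_iso X Y (f : iso X Y) : is_iso f.
Proof. by exists (bwd f); rewrite fwdK bwdK. Qed.

Lemma is_iso_iso X Y (f : hom A X Y) : is_iso f -> exists g : iso X Y, fwd g = f.
Proof. by move=> [g [e e']]; exists (Iso e e'). Qed.

Lemma is_iso_mono X Y (f : hom A X Y) : is_iso f -> mono f.
Proof. by move=> [g [e _]] Z u v /(congr1 (comp g)); rewrite !compA e !compIm. Qed.

Lemma is_iso_epi X Y (f : hom A X Y) : is_iso f -> epi f.
Proof. by move=> [g [_ e]] Z u v /(congr1 (fun h => comp h g)); rewrite -!compA e !compmI. Qed.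

Lemma mono_comp X Y Z (g : hom A Y Z) (f : hom A X Y) : mono g -> mono f -> mono (g \c f).
Proof. by move=> mg mf W u v; rewrite -!compA => /mg/mf. Qed.

Lemma epi_comp X Y Z (g : hom A Y Z) (f : hom A X Y) : epi g -> epi f -> epi (g \c f).
Proof. by move=> mg mf W u v; rewrite !compA => /mf/mg. Qed.

Lemma epi_compl X Y Z (g : hom A Y Z) (f : hom A X Y) : epi (g \c f) -> epi g.
Proof. by move=> e W u v /(congr1 (fun h => comp h f)); rewrite -!compA => /e. Qed.

Lemma kernel_unique X X' Y Z (i : hom A X Y) (i' : hom A X' Y) (f : hom A Y Z) :
  is_kernel i f -> is_kernel i' f -> exists2 u : hom A X X', is_iso u & i' \c u = i.
Proof.
move=> ki ki'.
have [u e] := kernel_lift ki' (proj1 ki); have [v e'] := kernel_lift ki (proj1 ki').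
exists u => //; exists v; split.
- by apply: (kernel_mono ki); rewrite compA e' e compmI.
- by apply: (kernel_mono ki'); rewrite compA e e' compmI.
Qed.

Hypothesis ab : abelian A.

Lemma mono_epi_is_iso X Y (f : hom A X Y) : mono f -> epi f -> is_iso f.
Proof.
move=> mf ef; have [Z [g kg]] := ab_mono ab mf.
have g0 : g = 0 by apply: (epi_eq0 ef); exact: (proj1 kg).
have [|h e] := kernel_lift (g := idm Y) kg; first by rewrite g0 comp0l.
by exists h; split=> //; apply: mf; rewrite compA e compIm compmI.
Qed.

(** Take [e] to be the cokernel of [i]. If the induced [m] kills [g], it factors through the
    cokernel [c] of [g]. The epi [c \c e] is the cokernel of some [h], which [f] kills, so [h] lifts
    to [i] and [e] kills it. Then [e] factors through [c \c e], so [c] has a left inverse and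
    [g = 0]. *)
Lemma image_factorization X Y Z (i : hom A X Y) (f : hom A Y Z) : is_kernel i f ->
  exists (I : A) (e : hom A Y I) (m : hom A I Z), [/\ is_cokernel e i, mono m & m \c e = f].
Proof.
move=> ki; have [I [e ce]] := ab_coker ab i.
have [m me] := cokernel_desc ce (proj1 ki).
exists I, e, m; split=> //; apply: mono0 => W g mg.
have [J [c cc]] := ab_coker ab g.
have [m' m'c] := cokernel_desc cc mg.
have ece : epi (c \c e) by apply: epi_comp; [exact: cokernel_epi cc | exact: cokernel_epi ce].
have [V [h ch]] := ab_epi ab ece.
have [|h' ih'] := kernel_lift (g := h) ki.
  by rewrite -me -m'c -compA -compA (compA c) (proj1 ch) comp0r.
have eh : e \c h = 0 by rewrite -ih' compA (proj1 ce) comp0l.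
have [l le] := cokernel_desc ch eh.
have lc : l \c c = idm I by apply: (cokernel_epi ce); rewrite -compA le compIm.
by rewrite -[g]compIm -lc -compA (proj1 cc) comp0r.
Qed.

Lemma mono_kernel_coker X Y Q (f : hom A X Y) (p : hom A Y Q) :
  mono f -> is_cokernel p f -> is_kernel f p.
Proof.
move=> mf cp; apply: is_kernelI => // [|W g pg]; first exact: (proj1 cp).
have [Z [h kh]] := ab_mono ab mf.
have [u e] := cokernel_desc cp (proj1 kh).
by apply: (kernel_lift kh); rewrite -e -compA pg comp0r.
Qed.

Lemma epi_coker_kernel X Y K (f : hom A X Y) (i : hom A K X) :
  epi f -> is_kernel i f -> is_cokernel f i.
Proof.
move=> mf cp; apply: is_cokernelI => // [|W g pg]; first exact: (proj1 cp).
have [Z [h kh]] := ab_epi ab mf.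
have [u e] := kernel_lift cp (proj1 kh).
by apply: (cokernel_desc kh); rewrite -e compA pg comp0l.
Qed.

End Category.

Section Biproducts.
Variables (k : fieldType) (A : lincat k).

Hypothesis A_zero : exists X : A, is_zero X.
Hypothesis A_sum : forall X Y : A,
  exists S, is_direct_sum (fun b : bool => if b then X else Y) S.

Lemma direct_sum_ord n (X : A) : exists S, is_direct_sum (fun _ : 'I_n => X) S.
Proof.
elim: n => [|n [S [e [p [pe1 pe0 ep]]]]].
  have [S zS] := A_zero; exists S.
  by exists (fun i => 0), (fun i => 0); split=> [[]|[]|] //; rewrite big_ord0.
have [R [e' [p' [pe1' pe0' ep']]]] := A_sum X S.
have ntf : true <> false by [].
have nft : false <> true by [].
(* Index [ord0] is the new copy of [X]; the other indices are shifted down and go through [S]. *)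
exists R, (fun i => if unlift ord0 i is Some j then e' false \c e j else e' true).
exists (fun i => if unlift ord0 i is Some j then p j \c p' false else p' true); split.
- move=> i; case: (unliftP ord0 i) => [j _|_]; last exact: (pe1' true).
  by rewrite compA -(compA (p j)) (pe1' false) compmI pe1.
- move=> i j; case: (unliftP ord0 i) => [i' ->|->]; case: (unliftP ord0 j) => [j' ->|->] // neq.
  + rewrite compA -(compA (p j')) (pe1' false) compmI pe0 // => eij.
    by apply: neq; rewrite eij.
  + by rewrite compA (pe0' _ _ nft) comp0l.
  + by rewrite -compA (pe0' _ _ ntf) comp0r.
- rewrite big_ord_recl unlift_none.
  under eq_bigr => i _ do rewrite liftK compA -(compA (e' false)).
  rewrite -ep' -comp_suml -comp_sumr ep compmI.
  by rewrite (bigD1 true) //=; congr (_ + _); rewrite (big_pred1 false) // => -[].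
Qed.

End Biproducts.

(** * Functors, coherence and duality *)

Section Functors.
Variables (k : fieldType) (A B : lincat k).

Lemma fmapD (F : functor A B) X Y (f g : hom A X Y) : fmap F (f + g) = fmap F f + fmap F g.
Proof. exact: (linD (@fmap_lin k A B F X Y)). Qed.

Lemma fmapB (F : functor A B) X Y (f g : hom A X Y) : fmap F (f - g) = fmap F f - fmap F g.
Proof. exact: (linB (@fmap_lin k A B F X Y)). Qed.

Lemma fmapZ (F : functor A B) X Y a (f : hom A X Y) : fmap F (a *: f) = a *: fmap F f.
Proof. exact: (linZ (@fmap_lin k A B F X Y)). Qed.

Lemma fmap0 (F : functor A B) X Y : fmap F (0 : hom A X Y) = 0.
Proof. exact: (lin0 (@fmap_lin k A B F X Y)). Qed.

Lemma fmap_sum (F : functor A B) X Y (I : finType) (f : I -> hom A X Y) :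
  fmap F (\sum_i f i) = \sum_i fmap F (f i).
Proof. exact: (lin_sum _ (@fmap_lin k A B F X Y)). Qed.

(** The quasi-inverse is made by choice of preimages. The form [exists i : iso _ _, True] turns the
    type of isomorphisms into a proposition. *)
Lemma fully_faithful_equivalent (F : functor A B) :
  faithful F ->
  (forall X Y (g : hom B (F X) (F Y)), exists f : hom A X Y, fmap F f = g) ->
  (forall Y : B, exists X : A, exists i : iso (F X) Y, True) ->
  equivalent A B.
Proof.
move=> ff full /choice[G0 he].
pose e Y : iso (F (G0 Y)) Y := projT1 (cid (he Y)).
have pull X Y (g : hom B (F X) (F Y)) : {f : hom A X Y & fmap F f = g} by exact: cid.
pose G1 X Y (f : hom B X Y) : hom A (G0 X) (G0 Y) := projT1 (pull _ _ (bwd (e Y) \c f \c e X)).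
have FG1 X Y (f : hom B X Y) : fmap F (G1 X Y f) = bwd (e Y) \c f \c e X.
  by rewrite /G1; case: (pull _ _ _).
have G1_lin X Y : linear (G1 X Y).
  by move=> a f g; apply: ff; rewrite fmapD fmapZ !FG1 compDr compDl compZr compZl.
have G1_id X : G1 X X (idm X) = idm (G0 X).
  by apply: ff; rewrite FG1 fmap_id compmI fwdK.
have G1_comp X Y Z (g : hom B Y Z) (f : hom B X Y) : G1 X Z (g \c f) = G1 Y Z g \c G1 X Y f.
  apply: ff; rewrite fmap_comp !FG1 -!compA; congr (_ \c _); congr (_ \c _).
  by rewrite (compA (e Y)) bwdK compIm.
exists F, (Functor G1_lin G1_id G1_comp); split.
- pose a X : hom A (G0 (F X)) X := projT1 (pull _ _ (fwd (e (F X)))).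
  have Fa X : fmap F (a X) = e (F X) by rewrite /a; case: (pull _ _ _).
  exists a; split=> [X Y f|X].
    by apply: ff; rewrite /= !fmap_comp !Fa FG1 !compA bwdK compIm.
  exists (projT1 (pull X (G0 (F X)) (bwd (e (F X))))); case: (pull _ _ _) => b /= Fb.
  by split; apply: ff; rewrite fmap_comp Fa Fb ?fwdK ?bwdK fmap_id.
- exists (fun Y => fwd (e Y)); split=> [X Y f|X]; last exact: iso_is_iso.
  by rewrite /= FG1 !compA bwdK compIm.
Qed.

End Functors.

Section Bifunctors.
Variables (k : fieldType) (A B D : lincat k) (F : bifunctor A B D).

Lemma bmap_compl X X' X'' Y (f' : hom A X' X'') (f : hom A X X') :
  bmap F (f' \c f) (idm Y) = bmap F f' (idm Y) \c bmap F f (idm Y).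
Proof. by rewrite -bmap_comp compIm. Qed.

Lemma bmap_compr X Y Y' Y'' (f' : hom B Y' Y'') (f : hom B Y Y') :
  bmap F (idm X) (f' \c f) = bmap F (idm X) f' \c bmap F (idm X) f.
Proof. by rewrite -bmap_comp compIm. Qed.

Lemma bmap_lr X X' Y Y' (f : hom A X X') (g : hom B Y Y') :
  bmap F f (idm Y') \c bmap F (idm X) g = bmap F f g.
Proof. by rewrite -bmap_comp compIm compmI. Qed.

Lemma bmap_rl X X' Y Y' (f : hom A X X') (g : hom B Y Y') :
  bmap F (idm X') g \c bmap F f (idm Y) = bmap F f g.
Proof. by rewrite -bmap_comp compIm compmI. Qed.

Lemma bmap_swap X X' Y Y' (f : hom A X X') (g : hom B Y Y') :
  bmap F (idm X') g \c bmap F f (idm Y) = bmap F f (idm Y') \c bmap F (idm X) g.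
Proof. by rewrite bmap_rl bmap_lr. Qed.

Lemma bmap0l X X' Y Y' (g : hom B Y Y') : bmap F (0 : hom A X X') g = 0.
Proof. exact: (lin0 (bmap_linl F g)). Qed.

Lemma bmap0r X X' Y Y' (f : hom A X X') : bmap F f (0 : hom B Y Y') = 0.
Proof. exact: (lin0 (bmap_linr F f)). Qed.

Lemma bmap_suml X X' Y Y' (I : finType) (f : I -> hom A X X') (g : hom B Y Y') :
  bmap F (\sum_i f i) g = \sum_i bmap F (f i) g.
Proof. exact: (lin_sum _ (bmap_linl F g)). Qed.

Lemma bmap_sumr X X' Y Y' (I : finType) (f : hom A X X') (g : I -> hom B Y Y') :
  bmap F f (\sum_i g i) = \sum_i bmap F f (g i).
Proof. exact: (lin_sum _ (bmap_linr F f)). Qed.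

Program Definition bfix_r (Y : B) : functor A D :=
  @Functor k A D (fun X => F X Y) (fun X X' f => bmap F f (idm Y)) _ _ _.
Next Obligation. by move=> Y X X'; exact: bmap_linl. Qed.
Next Obligation. by move=> Y X; exact: bmap_id. Qed.
Next Obligation. by move=> Y X X' X'' g f; exact: bmap_compl. Qed.

End Bifunctors.

(** * Coherence of the unit constraints *)

Section Coherence.
Variables (k : fieldType) (C : moncat k).
Implicit Types X Y Z : C.

Lemma runit_faithful X Y (f g : hom C X Y) : f \oxm idm one = g \oxm idm one -> f = g.
Proof.
move=> e; have := runit_nat f; rewrite e runit_nat => /(congr1 (fun h => h \c bwd (runit X))).
by rewrite -!compA bwdK !compmI.
Qed.

Lemma lunit_faithful X Y (f g : hom C X Y) : idm one \oxm f = idm one \oxm g -> f = g.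
Proof.
move=> e; have := lunit_nat f; rewrite e lunit_nat => /(congr1 (fun h => h \c bwd (lunit X))).
by rewrite -!compA bwdK !compmI.
Qed.

Lemma iso_cancell X Y Z (f : iso Y Z) (g h : hom C X Y) : f \c g = f \c h -> g = h.
Proof. by apply: is_iso_mono; exact: iso_is_iso. Qed.

Lemma iso_cancelr X Y Z (f : iso X Y) (g h : hom C Y Z) : g \c f = h \c f -> g = h.
Proof. by apply: is_iso_epi; exact: iso_is_iso. Qed.

(** Kelly's argument: [- \ox one] is faithful, and after applying it both sides are instances of the
    pentagon and the triangle. *)
Lemma runit_tensor X Y : (idm X \oxm runit Y) \c assoc X Y one = runit (X \ox Y).
Proof.
apply: runit_faithful; apply: (iso_cancell (f := assoc X Y one)).
rewrite -triangle -(bmap_id tensor) compA assoc_nat bmap_compl compA assoc_nat.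
have -> : idm X \oxm (runit Y \oxm idm one)
        = (idm X \oxm (idm Y \oxm lunit one)) \c (idm X \oxm assoc Y one one).
  by rewrite -bmap_compr triangle.
by rewrite -!compA; congr (_ \c _); rewrite pentagon compA.
Qed.

Lemma assoc_bwd_nat X X' Y Y' Z Z' (f : hom C X X') (g : hom C Y Y') (h : hom C Z Z') :
  bwd (assoc X' Y' Z') \c (f \oxm (g \oxm h)) = ((f \oxm g) \oxm h) \c bwd (assoc X Y Z).
Proof.
apply: (iso_cancelr (f := assoc X Y Z)); rewrite -!compA fwdK compmI -assoc_nat compA.
by rewrite fwdK compIm.
Qed.

Lemma lunit_bwd_nat X Y (f : hom C X Y) :
  bwd (lunit Y) \c f = (idm one \oxm f) \c bwd (lunit X).
Proof.
apply: (iso_cancelr (f := lunit X)); rewrite -!compA fwdK compmI -lunit_nat compA.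
by rewrite fwdK compIm.
Qed.

Lemma runit_bwd_nat X Y (f : hom C X Y) :
  bwd (runit Y) \c f = (f \oxm idm one) \c bwd (runit X).
Proof.
apply: (iso_cancelr (f := runit X)); rewrite -!compA fwdK compmI -runit_nat compA.
by rewrite fwdK compIm.
Qed.

Lemma runit_tensor_bwd X Y : assoc X Y one \c bwd (runit (X \ox Y)) = idm X \oxm bwd (runit Y).
Proof.
apply: (iso_cancell (f := iso_bmap tensor (iso_refl X) (runit Y))) => /=.
by rewrite compA runit_tensor bwdK -bmap_compr bwdK bmap_id.
Qed.

End Coherence.

Section CoherenceLeft.
Variables (k : fieldType) (C : moncat k).
Implicit Types X Y Z : C.

Lemma lunit_tensor X Y : lunit (X \ox Y) \c assoc one X Y = lunit X \oxm idm Y.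
Proof.
have /= := @runit_tensor k (rev_moncat C) Y X => <-.
by rewrite -compA fwdK compmI.
Qed.

Lemma lunit_tensor_bwd X Y :
  bwd (assoc one X Y) \c bwd (lunit (X \ox Y)) = bwd (lunit X) \oxm idm Y.
Proof. exact: (@runit_tensor_bwd k (rev_moncat C) Y X). Qed.

(** After [one \ox -] and the associator, the triangle turns the left side into
    [runit one \oxm idm one] and [runit_tensor] turns the right one into [runit (one \ox one)];
    these agree by naturality of [runit] at [runit one]. *)
Lemma lunit_one : lunit one = runit (one : C) :> hom C _ _.
Proof.
apply: lunit_faithful; apply: (iso_cancelr (f := assoc one one one)).
rewrite triangle runit_tensor; apply: (iso_cancell (f := runit one)).
by rewrite runit_nat.
Qed.

End CoherenceLeft.

(* [X' (x) -] is left adjoint to [X (x) -] whenever [X'] is a left dual of [X]. *)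
Section Adjunction.
Variables (k : fieldType) (C : moncat k) (X' X : C).
Variables (ev : hom C (X' \ox X) one) (coev : hom C one (X \ox X')).
Hypothesis zig : runit X \c (idm X \oxm ev) \c assoc X X' X \c (coev \oxm idm X)
  \c bwd (lunit X) = idm X.
Hypothesis zag : lunit X' \c (ev \oxm idm X') \c bwd (assoc X' X X') \c (idm X' \oxm coev)
  \c bwd (runit X') = idm X'.

Definition ladj Z Y (g : hom C Z (X \ox Y)) : hom C (X' \ox Z) Y :=
  lunit Y \c (ev \oxm idm Y) \c bwd (assoc X' X Y) \c (idm X' \oxm g).

Definition radj Z Y (h : hom C (X' \ox Z) Y) : hom C Z (X \ox Y) :=
  (idm X \oxm h) \c assoc X X' Z \c (coev \oxm idm Z) \c bwd (lunit Z).

Lemma ladj_nat_l Z Z' Y (g : hom C Z (X \ox Y)) (f : hom C Z' Z) :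
  ladj (g \c f) = ladj g \c (idm X' \oxm f).
Proof. by rewrite /ladj bmap_compr !compA. Qed.

Lemma ladj_nat_r Z Y Y' (g : hom C Z (X \ox Y)) (f : hom C Y Y') :
  ladj ((idm X \oxm f) \c g) = f \c ladj g.
Proof.
rewrite /ladj !compA -lunit_nat -!compA; congr (_ \c _).
rewrite bmap_compr !compA bmap_swap -!compA; congr (_ \c _).
by rewrite !compA assoc_bwd_nat bmap_id.
Qed.

Lemma radj_nat_r Z Y Y' (h : hom C (X' \ox Z) Y) (f : hom C Y Y') :
  radj (f \c h) = (idm X \oxm f) \c radj h.
Proof. by rewrite /radj bmap_compr !compA. Qed.

Lemma radj_nat_l Z Z' Y (h : hom C (X' \ox Z) Y) (f : hom C Z' Z) :
  radj (h \c (idm X' \oxm f)) = radj h \c f.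
Proof.
rewrite /radj -!compA lunit_bwd_nat bmap_compr -!compA; congr (_ \c _).
by rewrite (compA (coev \oxm _)) -bmap_swap !compA -assoc_nat bmap_id.
Qed.

(** Naturality in [Z] reduces the claim to the identity of [X \ox Y], where it is the first zigzag
    identity tensored with [Y]; the pentagon collects the associators. *)
Lemma ladjK Z Y (g : hom C Z (X \ox Y)) : radj (ladj g) = g.
Proof.
have -> : ladj g = ladj (idm (X \ox Y)) \c (idm X' \oxm g) by rewrite -ladj_nat_l compIm.
rewrite radj_nat_l -[RHS]compIm; congr (_ \c _).
rewrite /radj /ladj bmap_id compmI !bmap_compr.
have pent : (idm X \oxm bwd (assoc X' X Y)) \c assoc X X' (X \ox Y)
  = assoc X (X' \ox X) Y \c (assoc X X' X \oxm idm Y) \c bwd (assoc (X \ox X') X Y).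
  apply: (iso_cancelr (f := assoc (X \ox X') X Y)).
  rewrite -!compA fwdK compmI pentagon !compA -bmap_compr fwdK bmap_id compIm //.
rewrite -!compA (compA _ (assoc X X' (X \ox Y))) pent -!compA.
rewrite (compA (bwd (assoc _ _ _))) -(bmap_id tensor) assoc_bwd_nat -!compA lunit_tensor_bwd.
rewrite (compA _ (assoc X (X' \ox X) Y)) -assoc_nat -!compA (compA _ (assoc X one Y)) triangle.
by rewrite -!bmap_compl !compA zig bmap_id.
Qed.

Lemma radjK Z Y (h : hom C (X' \ox Z) Y) : ladj (radj h) = h.
Proof.
have -> : radj h = (idm X \oxm h) \c radj (idm (X' \ox Z)) by rewrite -radj_nat_r compmI.
rewrite ladj_nat_r -[RHS]compmI; congr (_ \c _).
rewrite /radj /ladj bmap_id compIm !bmap_compr.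
have pent : bwd (assoc X' X (X' \ox Z)) \c (idm X' \oxm assoc X X' Z)
  = assoc (X' \ox X) X' Z \c (bwd (assoc X' X X') \oxm idm Z) \c bwd (assoc X' (X \ox X') Z).
  apply: (iso_cancell (f := assoc X' X (X' \ox Z))).
  rewrite !compA bwdK compIm pentagon -!compA.
  by rewrite (compA (assoc X' X X' \oxm _)) -bmap_compl bwdK bmap_id compIm bwdK compmI.
rewrite -!compA (compA _ (idm X' \oxm assoc X X' Z)) pent -!compA.
rewrite (compA (bwd (assoc _ _ _))) assoc_bwd_nat -!compA.
have -> : bwd (assoc X' one Z) \c (idm X' \oxm bwd (lunit Z)) = bwd (runit X') \oxm idm Z.
  apply: (@bwd_inj _ _ _ _ (iso_comp (iso_bmap tensor (iso_refl X') (lunit Z)) (assoc X' one Z))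
    (iso_bmap tensor (runit X') (iso_refl Z))).
  exact: triangle.
rewrite -(bmap_id tensor) (compA (ev \oxm _)) -assoc_nat -!compA (compA (lunit _)) lunit_tensor.
by rewrite -!bmap_compl !compA zag bmap_id.
Qed.

Lemma tensor_left_kernel A B D (i : hom C A B) (f : hom C B D) :
  is_kernel i f -> is_kernel (idm X \oxm i) (idm X \oxm f).
Proof.
move=> ki; apply: is_kernelI.
- by rewrite -bmap_compr (proj1 ki) bmap0r.
- apply: mono0 => W g e; rewrite -[g]ladjK.
  have /(mono_eq0 (kernel_mono ki)) -> : i \c ladj g = 0.
    by rewrite -ladj_nat_r e /ladj bmap0r comp0r.
  by rewrite /radj bmap0r !comp0l.
- move=> W g e; have [|h eh] := kernel_lift (g := ladj g) ki.
    by rewrite -ladj_nat_r e /ladj bmap0r comp0r.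
  by exists (radj h); rewrite -radj_nat_r eh ladjK.
Qed.

Lemma tensor_dual_desc A B D N (e : hom C B D) (i : hom C A B) (f : hom C (X' \ox B) N) :
  is_cokernel e i -> f \c (idm X' \oxm i) = 0 -> exists g, g \c (idm X' \oxm e) = f.
Proof.
move=> ce fi; have [|h eh] := cokernel_desc (g := radj f) ce.
  by rewrite -radj_nat_l fi /radj bmap0r !comp0l.
by exists (ladj h); rewrite -ladj_nat_l eh radjK.
Qed.

End Adjunction.

(** Schur's lemma. Composition with [f] is a linear map of the finite-dimensional space of
    endomorphisms; over a closed field it has an eigenvector, a nonzero map killed by [f - c]. The
    kernel of [f - c] is then nonzero, hence all of [S]. *)
Lemma end_simple_scalar (k : closedFieldType) (A : lincat k) (S : A) :
  abelian A -> simple S -> fin_dim (hom A S S) ->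
  forall f : hom A S S, exists c : k, f = c *: idm S.
Proof.
move=> ab [nzS sS] [n [[r r_lin [r' rK r'K]]]] f.
have n0 : (0 < n)%N.
  case: n r r' r_lin rK r'K => // r r' _ rK _; case: nzS; rewrite /is_zero.
  by rewrite -[LHS]rK -[RHS]rK; congr r'; apply/rowP => -[].
have r'_lin : linear r'.
  by move=> a u v; rewrite -[u in LHS]r'K -[v in LHS]r'K -r_lin rK.
pose M := lin1_mx (fun u => r (f \c r' u)).
have mul_lin : linear (fun u => r (f \c r' u)).
  by move=> a u v; rewrite r'_lin comp_linr r_lin.
have ME u : u *m M = r (f \c r' u).
  pose L := GRing.isLinear.Build _ _ _ _ (fun u => r (f \c r' u)) mul_lin.
  pose F : {linear 'rV[k]_n -> 'rV[k]_n} := HB.pack (fun u => r (f \c r' u)) L.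
  exact: (mul_rV_lin1 F).
have [c hc] : exists c, root (char_poly M) c.
  by apply/closed_rootP; rewrite size_char_poly; case: n n0 {r r' r_lin rK r'K r'_lin M mul_lin ME}.
move: hc; rewrite -eigenvalue_root_char => /eigenvalueP[v vM v0].
have fv : (f - c *: idm S) \c r' v = 0.
  have e : f \c r' v = c *: r' v.
    by rewrite -[f \c r' v]rK -ME vM (linZ r'_lin).
  by rewrite compBl compZl compIm e subrr.
have rv0 : r' v <> 0.
  by move=> e; move: v0; rewrite -[v]r'K e (lin0 r_lin) eqxx.
exists c; apply/eqP; rewrite -subr_eq0; apply/eqP.
have [K [i ki]] := ab_ker ab (f - c *: idm S).
have [g gi] := kernel_lift ki fv.
case: (sS _ _ (kernel_mono ki)) => [zK|isi].
  by case: rv0; rewrite -gi (zero_dom i) // comp0l.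
by apply: (epi_eq0 (is_iso_epi isi)); exact: (proj1 ki).
Qed.

(** * Exactness of the tensor product and extension of forms *)

Section TensorCategory.
Variables (k : fieldType) (C : moncat k).
Hypothesis tc : tensor_category C.
Let ab : abelian C := tc_abelian tc.

Lemma tensor_kernel (X A B D : C) (i : hom C A B) (f : hom C B D) :
  is_kernel i f -> is_kernel (idm X \oxm i) (idm X \oxm f).
Proof.
have [[X' [ev [coev [zig zag]]]] _] := tc_rigid tc X.
exact: (tensor_left_kernel zig).
Qed.

Lemma kernel_tensor (X A B D : C) (i : hom C A B) (f : hom C B D) :
  is_kernel i f -> is_kernel (i \oxm idm X) (f \oxm idm X).
Proof.
have [_ [X' [ev [coev [zig zag]]]]] := tc_rigid tc X.
exact: (@tensor_left_kernel k (rev_moncat C) X' X ev coev zag A B D i f).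
Qed.

Lemma tensor_mono (X A B : C) (f : hom C A B) : mono f -> mono (idm X \oxm f).
Proof. by move=> /(ab_mono ab)[D [g kg]]; exact: (kernel_mono (tensor_kernel X kg)). Qed.

Lemma mono_tensor (X A B : C) (f : hom C A B) : mono f -> mono (f \oxm idm X).
Proof. by move=> /(ab_mono ab)[D [g kg]]; exact: (kernel_mono (kernel_tensor X kg)). Qed.

Lemma from_one_mono (X : C) (f : hom C one X) : f <> 0 -> mono f.
Proof.
move=> f0; have [K [i ki]] := ab_ker ab f.
have [_ s1] := tc_unit tc; case: (s1 _ _ (kernel_mono ki)) => [zK|isi].
  apply: mono0 => Z g /(kernel_lift ki)[h <-].
  by rewrite (zero_dom i) // comp0l.
by case: f0; apply: (epi_eq0 (is_iso_epi isi)); exact: (proj1 ki).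
Qed.

(** The coevaluation of [V] is a nonzero map out of the simple unit, hence monic, and stays monic
    after [- \ox idm B]. It embeds [idm one \oxm g] into [idm W \oxm (idm V \oxm g)]. *)
Lemma tensor_faithful (V A B : C) (g : hom C A B) :
  ~ is_zero V -> idm V \oxm g = 0 -> g = 0.
Proof.
move=> nzV Vg; have [_ [W [ev [coev [zig zag]]]]] := tc_rigid tc V.
have coev0 : coev <> 0.
  by move=> e; apply: nzV; rewrite /is_zero -zag e bmap0r comp0r comp0l.
have mc : mono (coev \oxm idm B) by apply: mono_tensor; exact: from_one_mono.
have g1 : idm one \oxm g = 0.
  apply: (mono_eq0 mc); rewrite -bmap_swap -(bmap_id tensor).
  apply: (iso_cancell (f := assoc W V B)).
  by rewrite compA assoc_nat Vg bmap0r !comp0l comp0r.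
by apply: lunit_faithful; rewrite g1 bmap0r.
Qed.

(* Exactness in the middle of the contravariant functor [Hom(Q (x) -, N)]. *)
Definition hom_tensor_exact (Q N : C) : Prop :=
  forall (A B D : C) (i : hom C A B) (d : hom C B D) (f : hom C (Q \ox B) N),
    is_kernel i d -> f \c (idm Q \oxm i) = 0 -> exists g, g \c (idm Q \oxm d) = f.

(** Factor [d] as an epi followed by a mono. Descent along the epi holds because [Q \ox -] is a left
    adjoint. Extension along the mono [m] becomes, on passing to duals, a lifting problem for maps
    from [Q] against the transpose of [m], which is an epi. *)
Lemma projective_hom_tensor_exact (Q : C) : projective Q -> hom_tensor_exact Q one.
Proof.
move=> pQ A B D i d f ki fi.
have [I [e [m [ce mm <-]]]] := image_factorization ab ki.
have [f' <-] : exists f' : hom C (Q \ox I) one, f' \c (idm Q \oxm e) = f.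
  have [_ [X [ev [coev [zig zag]]]]] := tc_rigid tc Q.
  exact: (tensor_dual_desc zag ce fi).
suff [g <-] : exists g : hom C (Q \ox D) one, g \c (idm Q \oxm m) = f'.
  by exists g; rewrite bmap_compr compA.
have [[I' [evI [coevI [zigI zagI]]]] _] := tc_rigid tc I.
have [[D' [evD [coevD [zigD zagD]]]] _] := tc_rigid tc D.
pose g0 : hom C one (D \ox I') := (m \oxm idm I') \c coevI.
(* The transpose of [m], characterized by [Dm']. *)
pose m' : hom C D' I' := ladj evD g0 \c bwd (runit D').
have Dm' : (idm D \oxm m') \c coevD = g0.
  rewrite -[RHS](ladjK zigD) /radj.
  have -> : ladj evD g0 = m' \c runit D' by rewrite /m' -compA fwdK compmI.
  rewrite bmap_compr -!compA; congr (_ \c _).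
  rewrite (compA _ (assoc _ _ _)) runit_tensor compA runit_nat -compA.
  by rewrite -lunit_one bwdK compmI.
have em' : epi m'.
  (* Bending the strands, [h \c m' = 0] says that [m \oxm idm W] kills [(idm I \oxm h) \c coevI]; as
     [m] is monic this vanishes, and the zigzag identity recovers [h]. *)
  apply: epi0 => W h hm'; have : (m \oxm idm W) \c ((idm I \oxm h) \c coevI) = 0.
    rewrite compA -bmap_swap -compA -/g0 -Dm' compA -bmap_compr hm'.
    by rewrite bmap0r comp0l.
  move/(mono_eq0 (mono_tensor (X := W) mm)) => e0.
  have := zagI; move/(congr1 (comp h)); rewrite compmI => <-.
  rewrite !compA -lunit_nat -(compA _ (idm one \oxm h)) bmap_swap.
  rewrite -(bmap_id tensor) -!compA (compA _ (bwd (assoc _ _ _))) -assoc_bwd_nat.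
  rewrite -!compA (compA _ (idm I' \oxm coevI)).
  by rewrite -bmap_compr e0 bmap0r comp0l !comp0r.
(* The reversed category supplies the adjunction between [- \ox I] and [- \ox I'], under which [f']
   becomes a map from [Q] to [one \ox I']. *)
pose R := rev_moncat C.
pose radjR W (h : hom C (W \ox I) one) : hom C W (one \ox I') := @radj k R I I' coevI W one h.
pose ladjR W (h : hom C W (one \ox I')) : hom C (W \ox I) one := @ladj k R I I' evI W one h.
have R2 W (h : hom C (W \ox I) one) : ladjR W (radjR W h) = h.
  exact: (@radjK k R I I' evI coevI zigI W one h).
have natl W W' (g : hom C W (one \ox I')) (h : hom C W' W) :
  ladjR W' (g \c h) = ladjR W g \c (h \oxm idm I) by exact: (@ladj_nat_l k R I I' evI).
have mE : radjR D' (evD \c (idm D' \oxm m)) = bwd (lunit I') \c m'.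
  rewrite /radjR /radj /= /m' /ladj /g0 !compA fwdK compIm.
  rewrite bmap_compr !compA; congr (_ \c _); congr (_ \c _).
  by rewrite bmap_compl -!compA; congr (_ \c _); rewrite assoc_bwd_nat.
have [|l hl] := pQ _ _ (bwd (lunit I') \c m') (radjR Q f').
  by apply: epi_comp => //; apply: is_iso_epi; exact: (iso_is_iso (iso_sym (lunit I'))).
exists (evD \c (l \oxm idm D)); rewrite -compA bmap_lr -[RHS]R2 -hl natl.
by rewrite -mE R2 -compA bmap_rl.
Qed.

(** Moving [N] to the other side by duality turns maps [Q \ox B -> N] into forms on
    [Q \ox (B \ox X)], and [- \ox X] preserves the kernel. *)
Lemma hom_tensor_exact_all (Q N : C) : hom_tensor_exact Q one -> hom_tensor_exact Q N.
Proof.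
move=> hQ A B D i d f ki fi.
have [_ [X [ev [coev [zig zag]]]]] := tc_rigid tc N.
pose R := rev_moncat C.
pose ladjR W (h : hom C W (one \ox N)) : hom C (W \ox X) one := @ladj k R X N ev W one h.
pose radjR W (h : hom C (W \ox X) one) : hom C W (one \ox N) := @radj k R X N coev W one h.
have natl W W' (g : hom C W (one \ox N)) (h : hom C W' W) :
  ladjR W' (g \c h) = ladjR W g \c (h \oxm idm X) by exact: (@ladj_nat_l k R X N ev).
have natr W W' (g : hom C (W \ox X) one) (h : hom C W' W) :
  radjR W' (g \c (h \oxm idm X)) = radjR W g \c h by exact: (@radj_nat_l k R X N coev).
have R1 W (g : hom C W (one \ox N)) : radjR W (ladjR W g) = g.
  exact: (@ladjK k R X N ev coev zag).
pose f1 := ladjR _ (bwd (lunit N) \c f) \c bwd (assoc Q B X).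
have [|g hg] := hQ _ _ _ _ _ f1 (kernel_tensor X ki).
  rewrite /f1 -compA assoc_bwd_nat compA -natl -compA fi comp0r.
  by rewrite /ladjR /ladj bmap0r comp0r comp0l.
exists (lunit N \c radjR _ (g \c assoc Q D X)).
rewrite -compA -natr -compA assoc_nat compA hg /f1 -compA fwdK compmI R1 compA.
by rewrite bwdK compIm.
Qed.

End TensorCategory.

(** * Hopf monads and their cofree module functors *)

Section FreeModules.
Variables (k : fieldType) (C : moncat k) (T : hopf_monad C).
Implicit Types X Y Z : C.

Definition free_tmod (X : C) : tmod T := TMod (mu_assoc T X) (mu_etal T X).

(* [T] is a module functor over its own modules through the following transformation,
   which at a free module is the right fusion operator. *)
Definition strength (M : tmod T) (X : C) : hom C (T (M \ox X)) (M \ox T X) :=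
  (tm_act M \oxm idm (T X)) \c xi T M X.

Lemma strength_nat (M N : tmod T) X Y (f : tmod_hom M N) (g : hom C X Y) :
  strength N Y \c fmap T (smval f \oxm g) = (smval f \oxm fmap T g) \c strength M X.
Proof.
rewrite /strength -compA xi_nat !compA -!bmap_comp compIm compmI.
by case: f => f /= ->.
Qed.

Lemma strength_mu (M : tmod T) X :
  strength M X \c mu T (M \ox X)
  = (tm_act M \oxm mu T X) \c xi T M (T X) \c fmap T (strength M X).
Proof.
rewrite /strength fmap_comp -compA mu_xi !compA -bmap_comp compIm -tm_assoc.
rewrite -[_ \c xi T M (T X) \c _]compA xi_nat fmap_id compA -bmap_comp compmI.
by [].
Qed.

Lemma strength_eta (M : tmod T) X : strength M X \c eta T (M \ox X) = idm M \oxm eta T X.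
Proof. by rewrite /strength -compA eta_xi -bmap_comp tm_unit compIm. Qed.

Program Definition free_map X Y (f : hom C X Y) : tmod_hom (free_tmod X) (free_tmod Y) :=
  @Sublmod _ _ (tmod_homs (free_tmod X) (free_tmod Y)) (fmap T f) _.
Next Obligation. by move=> X Y f /=; rewrite mu_nat. Qed.

Program Definition action_map (M : tmod T) : tmod_hom (free_tmod M) M :=
  @Sublmod _ _ (tmod_homs (free_tmod M) M) (tm_act M) _.
Next Obligation. by move=> M /=; rewrite tm_assoc. Qed.

Program Definition strength_map (M : tmod T) X :
    tmod_hom (free_tmod (M \ox X)) (tmod_tensor_ob M (free_tmod X)) :=
  @Sublmod _ _ (tmod_homs (free_tmod (M \ox X)) (tmod_tensor_ob M (free_tmod X)))
    (strength M X) _.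
Next Obligation. by move=> M X; rewrite /= strength_mu. Qed.

Program Definition counit_map : tmod_hom (free_tmod one) (tmod_one T) :=
  @Sublmod _ _ (tmod_homs (free_tmod one) (tmod_one T)) (phi T) _.
Next Obligation. by rewrite /= mu_phi. Qed.

(* An arbitrary module is a split quotient, in [C], of a free one. *)
Lemma strength_is_iso (M : tmod T) X : is_iso (strength M X).
Proof.
have [r0 [r0K Kr0]] : is_iso (strength (free_tmod M) X) := fusionr T M X.
have [r1 [r1K Kr1]] : is_iso (strength (free_tmod (T M)) X) := fusionr T (T M) X.
pose s := tm_act M.
(* The inverse at the free module [T M], conjugated by the splitting [eta] of the action [s]. This
   splitting lives only in [C], so naturality of [strength] does not apply to it and the left
   inverse law needs a separate argument. *)
exists (fmap T (s \oxm idm X) \c r0 \c (eta T M \oxm idm (T X))).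
have nat_s := strength_nat (action_map M) (idm X); rewrite fmap_id /= in nat_s.
split; last first.
  rewrite !compA nat_s -(compA _ _ r0) Kr0 compmI.
  by rewrite -bmap_compl tm_unit bmap_id.
have nat_free (g : tmod_hom (free_tmod (T M)) (free_tmod M)) :
    r0 \c (smval g \oxm idm (T X)) = fmap T (smval g \oxm idm X) \c r1.
  have := strength_nat g (idm X); rewrite fmap_id /= => e.
  by rewrite -[LHS]compmI -Kr1 compA -(compA r0) -e
       (compA r0 (strength (free_tmod M) X)) r0K compIm.
have es : epi (fmap T (s \oxm idm X)).
  apply: (epi_compl (f := fmap T (eta T M \oxm idm X))).
  by rewrite -fmap_comp -bmap_compl tm_unit bmap_id fmap_id => W u v; rewrite !compmI.
apply: es; rewrite compIm -compA nat_s.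
(* The two module maps [T (T M) -> T M], namely [fmap T s] and [mu], are coequalized by [s].
   Exchanging one for the other brings the unit next to [mu], where it cancels. *)
have e1 := nat_free (free_map s); have e2 := nat_free (action_map (free_tmod M)).
rewrite /= in e1 e2.
have -> : fmap T (s \oxm idm X) \c r0 \c (eta T M \oxm idm (T X))
      \c ((s \oxm idm (T X)) \c strength (free_tmod M) X)
   = fmap T (s \oxm idm X) \c (r0 \c (fmap T s \oxm idm (T X)))
      \c (eta T (T M) \oxm idm (T X)) \c strength (free_tmod M) X.
  rewrite -!compA; congr (_ \c _); congr (_ \c _).
  by rewrite !compA -!bmap_compl eta_nat.
rewrite e1 compA -fmap_comp -bmap_compl tm_assoc.
rewrite bmap_compl fmap_comp -(compA _ _ r1) -e2.
rewrite -!compA (compA (mu T M \oxm _)) -bmap_compl mu_etal bmap_id compIm.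
by rewrite r0K compmI.
Qed.

Definition strength_iso (M : tmod T) X : iso (T (M \ox X)) (M \ox T X) :=
  let h := cid (strength_is_iso M X) in Iso (proj1 (projT2 h)) (proj2 (projT2 h)).

Local Notation CM := (tmod_modcat T).

Program Definition monad_modfunctor : modfunctor CM CM :=
  @ModFunctor k (tmod_moncat T) CM CM (hmonad_fun T) strength_iso _ _ _.
Next Obligation. by move=> M N X Y f g; exact: strength_nat. Qed.
Next Obligation.
move=> M N X; rewrite /= /strength /=.
rewrite bmap_compl !compA assoc_nat -!compA (compA (assoc _ _ _)) xi_assoc !compA.
by rewrite bmap_rl -bmap_comp compmI.
Qed.
Next Obligation. by move=> X; rewrite /= /strength /= !compA xi_lunit. Qed.

Program Definition tensor_modfunctor (Y : C) : modfunctor CM CM :=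
  @ModFunctor k (tmod_moncat T) CM CM (bfix_r tensor Y)
    (fun (M : tmod T) X => assoc (tm_car M) X Y) _ _ _.
Next Obligation. by move=> Y M N A B f g; exact: (@assoc_nat k C). Qed.
Next Obligation. by move=> Y M N A; exact: (@pentagon k C). Qed.
Next Obligation. by move=> Y A; exact: (@lunit_tensor k C). Qed.

Definition cofree (Y : C) : modfunctor CM CM :=
  modfunctor_comp (tensor_modfunctor Y) monad_modfunctor.

Program Definition cofree_map Y Z (f : hom C Y Z) : modnat (cofree Y) (cofree Z) :=
  @Sublmod _ _ (modnats (cofree Y) (cofree Z)) (fun X => idm (T X) \oxm f) _.
Next Obligation.
move=> Y Z f; split=> [A B g|M A] /=; first by rewrite bmap_swap.
by rewrite compA -assoc_nat -!compA bmap_id bmap_swap.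
Qed.

(** * Unit and counit of the adjunction with evaluation at [one] *)

Section Coaction.
Variable F : modfunctor CM CM.

Definition coact (X : C) : hom C (F X) (T X \ox F one) :=
  (mf_iso F (free_tmod X : tmod_moncat T) one : hom C (F (T X \ox one)) (T X \ox F one))
    \c fmap F (bwd (runit (T X)) \c eta T X).

Lemma coactE (X : C) : coact X
  = (mf_iso F (free_tmod X : tmod_moncat T) one : hom C (F (T X \ox one)) (T X \ox F one))
    \c fmap F (bwd (runit (T X)) \c eta T X).
Proof. by []. Qed.

Lemma mf_iso_nat_l (M N : tmod T) (f : tmod_hom M N) X :
  mf_iso F (N : tmod_moncat T) X \c fmap F (smval f \oxm idm X)
  = (smval f \oxm idm (F X)) \c mf_iso F (M : tmod_moncat T) X.
Proof.
by have := @mf_nat _ _ _ _ F (M : tmod_moncat T) N X X f (idm X); rewrite fmap_id.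
Qed.

Lemma mf_iso_nat_r (M : tmod T) X Y (f : hom C X Y) :
  mf_iso F (M : tmod_moncat T) Y \c fmap F (idm (tm_car M) \oxm f)
  = (idm (tm_car M) \oxm fmap F f) \c mf_iso F (M : tmod_moncat T) X.
Proof. exact: (@mf_nat _ _ _ _ F (M : tmod_moncat T) M X Y (idm _) f). Qed.

Lemma coact_natural : natural (F := F) (G := cofree (F one)) coact.
Proof.
move=> X Y f; rewrite /coact /= -compA -fmap_comp -compA eta_nat (compA (bwd _)).
rewrite runit_bwd_nat -compA fmap_comp !compA.
by rewrite [_ \c fmap F (fmap T f \oxm _)](mf_iso_nat_l (free_map f) one).
Qed.

(** Both sides use the module structure of [F] at [M] tensored with a free module: [mf_assoc] splits
    it, and naturality along the [T]-linear map [strength_map] compares it with the free module on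
    [M \ox X]. *)
Lemma coact_mod (M : tmod T) X :
  (idm M \oxm coact X) \c mf_iso F (M : tmod_moncat T) X
  = assoc (tm_car M) (T X) (F one) \c (strength M X \oxm idm (F one)) \c coact (M \ox X).
Proof.
rewrite /coact bmap_compr -compA -mf_iso_nat_r.
have := @mf_assoc _ _ _ _ F (M : tmod_moncat T) (free_tmod X) one => /= e.
have e1 : (idm (tm_car M) \oxm mf_iso F (free_tmod X : tmod_moncat T) one)
       \c mf_iso F (M : tmod_moncat T) (T X \ox one)
     = assoc (tm_car M) (T X) (F one)
       \c mf_iso F (tmod_tensor_ob M (free_tmod X) : tmod_moncat T) one
       \c fmap F (bwd (assoc (tm_car M) (T X) one)).
  by rewrite e -!compA -fmap_comp bwdK fmap_id compmI.
rewrite [LHS]compA; apply: etrans (congr1 (fun h => h \c _) e1) _; rewrite -!compA; congr (_ \c _).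
have := mf_iso_nat_l (strength_map M X) one => /= e2.
rewrite [RHS]compA; apply: etrans _ (congr1 (fun h => h \c _) e2).
rewrite -!compA; congr (_ \c _).
rewrite -!fmap_comp; congr (fmap F _).
rewrite compA -runit_bwd_nat -compA strength_eta bmap_compr compA; congr (_ \c _).
by rewrite -runit_tensor_bwd compA fwdK compIm.
Qed.

Program Definition coact_map : modnat F (cofree (F one)) :=
  @Sublmod _ _ (modnats F (cofree (F one))) coact _.
Next Obligation.
by split=> [|M X]; [exact: coact_natural | exact: coact_mod].
Qed.

Definition counit_at (Y : C) : hom C (T one \ox Y) Y := lunit Y \c (phi T \oxm idm Y).

Lemma counit_at_nat Y Z (f : hom C Y Z) :
  counit_at Z \c (idm (T one) \oxm f) = f \c counit_at Y.
Proof. by rewrite /counit_at -compA -bmap_swap !compA lunit_nat. Qed.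

(** One triangle identity of the adjunction; [phi] is [T]-linear from the free module [T one] to the
    unit module, so it passes through [mf_iso]. *)
Lemma counit_coact : counit_at (F one) \c coact one = idm (F one).
Proof.
rewrite /counit_at /coact -compA (compA (phi T \oxm _)).
have := mf_iso_nat_l counit_map one => /= <-.
have e := @mf_unit _ _ _ _ F one; rewrite /= in e.
rewrite -compA compA [X in X \c _]e -!fmap_comp -fmap_id; congr (fmap F _).
by rewrite lunit_one !compA runit_nat -(compA (phi T)) bwdK compmI eta_phi.
Qed.

End Coaction.

(** Naturality of the unit of the adjunction in the functor; at [X = one] it says that [smval a one]
    is a map of comodules. *)
Lemma coact_modnat (F G : modfunctor CM CM) (a : modnat F G) X :
  (idm (T X) \oxm smval a one) \c coact F X = coact G X \c smval a X.
Proof.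
have [na ma] := smvalP a.
rewrite /coact compA; have := ma (free_tmod X) one => /= ->.
by rewrite -!compA na.
Qed.

(** The other triangle identity. *)
Lemma counit_cofree (X Y : C) :
  (idm (T X) \oxm counit_at Y) \c coact (cofree Y) X = idm (T X \ox Y).
Proof.
rewrite /coact /counit_at /= bmap_compr !compA -(compA _ (idm _ \oxm (phi T \oxm _))).
rewrite -assoc_nat !compA triangle -!bmap_compl -bmap_id; congr (_ \oxm _).
rewrite /strength /= !compA -(compA _ (idm _ \oxm _)) bmap_swap compA runit_nat.
rewrite -!compA fmap_comp (compA (idm _ \oxm _)) (compA (runit _)) (compA (runit _)).
rewrite (xi_runit T (T X)) (compA (fmap T (runit _))) -fmap_comp bwdK fmap_id compIm.
by rewrite mu_etar.
Qed.

End FreeModules.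

(** * Comonadicity of evaluation at [one] *)

Section Comonadicity.
Variables (k : fieldType) (C : moncat k) (T : hopf_monad C).
Hypotheses (tc : tensor_category C) (T_faithful : faithful T) (T_lex : left_exact T).
Let ab : abelian C := tc_abelian tc.

(* A form on [T Q (x) B] extends to a [T]-linear form on [T Q (x) T B], which by the right
   and the left fusion operators is the same thing as a form on [Q (x) T B]. *)
Lemma monad_hom_tensor_exact (Q : C) : hom_tensor_exact Q one -> hom_tensor_exact (T Q) one.
Proof.
move=> hQ A B D i d f ki fi.
have [fr frE] : exists fr : forall W, iso (T (T Q \ox W)) (T Q \ox T W),
    forall W, fwd (fr W) = strength (free_tmod T Q) W.
  by exists (strength_iso (free_tmod T Q)).
have fr_nat W W' (g : hom C W W') :
    bwd (fr W') \c (idm (T Q) \oxm fmap T g) = fmap T (idm (T Q) \oxm g) \c bwd (fr W).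
  apply: (iso_cancelr (f := fr W)); rewrite -!compA fwdK compmI frE.
  have := strength_nat (tmod_id (free_tmod T Q)) g => /= <-.
  by rewrite -frE compA fwdK compIm.
have [fl flE] : exists fl : forall W, iso (T (Q \ox T W)) (T Q \ox T W),
    forall W, fwd (fl W) = (idm (T Q) \oxm mu T W) \c xi T Q (T W).
  have h W := cid (is_iso_iso (fusionl T Q W)).
  by exists (fun W => projT1 (h W)) => W; exact: projT2 (h W).
have fl_nat W W' (g : hom C W W') :
    bwd (fl W') \c (idm (T Q) \oxm fmap T g) = fmap T (idm Q \oxm fmap T g) \c bwd (fl W).
  apply: (iso_cancelr (f := fl W)); rewrite -!compA fwdK compmI.
  rewrite flE (compA (_ \oxm fmap T g)) -bmap_compr -mu_nat bmap_compr -compA.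
  by rewrite -[X in X \oxm fmap T (fmap T g)]fmap_id -xi_nat (compA _ (xi T Q _)) -flE
       compA fwdK compIm.
(* The right fusion operator makes [T Q \ox T B] the free module on [T Q \ox B], and [f1] is the
   [T]-linear extension of [f]. *)
have [f1 f1E] : exists f1, f1 = phi T \c fmap T f \c bwd (fr B) by eexists.
have f1K : f1 \c fr B = phi T \c fmap T f by rewrite f1E -compA fwdK compmI.
(* The left fusion operator makes the same object free on [Q \ox T B]; [f2] is the corresponding
   restriction, to which the hypothesis on [Q] applies since [T] preserves the kernel. *)
pose f2 := f1 \c (eta T Q \oxm idm (T B)).
have [|g2 hg2] := hQ _ _ _ _ _ f2 (T_lex ki).
  rewrite /f2 -compA -bmap_swap compA f1E -[X in X \c _]compA fr_nat.
  by rewrite !compA -(compA (phi T)) -fmap_comp fi fmap0 comp0r !comp0l.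
exists (phi T \c fmap T g2 \c bwd (fl D) \c (idm (T Q) \oxm eta T D)).
rewrite -compA -bmap_compr eta_nat bmap_compr compA -(compA _ (bwd _)) fl_nat.
rewrite -!compA (compA (fmap T g2)) -fmap_comp hg2 compA.
have f1_lin : f1 \c ((mu T Q \oxm mu T B) \c xi T (T Q) (T B)) = phi T \c fmap T f1.
  apply: (iso_cancelr (f := iso_map T (fr B))) => /=.
  have e := strength_mu (free_tmod T Q) B; rewrite /= -frE in e.
  rewrite -[LHS]compA -e compA f1K -[RHS]compA -fmap_comp f1K fmap_comp.
  by rewrite -compA -mu_nat !compA mu_phi.
(* Being [T]-linear, [f1] is the extension of its own restriction [f2] along the left fusion
   operator. *)
have -> : phi T \c fmap T f2 = f1 \c fl B.
  rewrite /f2 fmap_comp compA -f1_lin -!compA flE; congr (_ \c _).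
  by rewrite xi_nat compA -bmap_comp mu_etar fmap_id compmI.
rewrite -compA (compA (fl B)) bwdK compIm.
have <- : fr B \c eta T (T Q \ox B) = idm (T Q) \oxm eta T B.
  by rewrite frE; exact: (strength_eta (free_tmod T Q) B).
by rewrite compA f1K -compA -eta_nat compA eta_phi compIm.
Qed.

(** After [T] the fork is split by [mu], so the comparison [l] of [X] with the true kernel becomes
    invertible. A faithful functor reflects monos and epis, and in an abelian category these two
    properties make [l] invertible. *)
Lemma unit_kernel (X : C) : is_kernel (eta T X) (fmap T (eta T X) - eta T (T X)).
Proof.
set d := fmap T (eta T X) - _.
have d_eta : d \c eta T X = 0 by rewrite compBl eta_nat subrr.
have [K [i ki]] := ab_ker ab d.
have [l il] := kernel_lift ki d_eta.
suff isl : is_iso l.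
  have [l' [l'l ll']] := isl; apply: is_kernelI => //.
    by rewrite -il; apply: mono_comp; [exact: kernel_mono ki | exact: is_iso_mono].
  move=> W g /(kernel_lift ki)[h <-]; exists (l' \c h).
  by rewrite -il -compA (compA l) ll' compIm.
have kT : is_kernel (fmap T (eta T X)) (fmap T d).
  apply: is_kernelI; first by rewrite -fmap_comp d_eta fmap0.
    move=> W g h e; rewrite -[g]compIm -[h]compIm -!(mu_etar T X) -!compA.
    by rewrite e.
  move=> W g dg; exists (mu T X \c g).
  have : mu T (T X) \c (fmap T d \c g) = 0 by rewrite dg comp0r.
  rewrite compA fmapB compBr mu_nat mu_etar compBl compIm => /eqP.
  by rewrite subr_eq0 compA => /eqP.
have [u [u' [u'u uu']] ue] := kernel_unique kT (T_lex ki).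
have uE : u = fmap T l.
  by apply: (kernel_mono (T_lex ki)); rewrite ue -fmap_comp il.
apply: (mono_epi_is_iso ab).
  apply: mono0 => W g lg; apply: T_faithful; rewrite fmap0.
  by rewrite -[LHS]compIm -u'u uE -compA -fmap_comp lg fmap0 comp0r.
apply: epi0 => W g gl; apply: T_faithful; rewrite fmap0.
by rewrite -[LHS]compmI -uu' uE compA -fmap_comp gl fmap0 comp0l.
Qed.

Variable Q : C.
Hypotheses (Q_nonzero : ~ is_zero Q) (Q_exact : hom_tensor_exact Q one).

Local Notation CM := (tmod_modcat T).

(* Tensoring with [T Q] makes every exact sequence split, and a module functor commutes
   with this operation. *)
Lemma modfunctor_left_exact (F : modfunctor CM CM) : left_exact F.
Proof.
move=> A B D i d ki.
have hTQ N : hom_tensor_exact (T Q) N.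
  by apply: (hom_tensor_exact_all tc); exact: monad_hom_tensor_exact.
have TQ0 : ~ is_zero (T Q).
  by move=> z; apply: Q_nonzero; apply: T_faithful; rewrite fmap_id fmap0.
have [O zO] := ab_zero ab.
(* With zero on the left, exactness yields a retraction [r] of [idm (T Q) \oxm i]; exactness at [B]
   then yields [s], through which the complementary idempotent factors. *)
have k0 : is_kernel (0 : hom C O A) i.
  apply: is_kernelI => [||W g ig]; first exact: comp0r.
    by move=> W g h _; rewrite (zero_cod g zO) (zero_cod h zO).
  by exists 0; rewrite comp0l (mono_eq0 (kernel_mono ki) ig).
have [|r hr] := hTQ _ _ _ _ _ _ (idm (T Q \ox A)) k0; first by rewrite bmap0r comp0r.
have [|s hs] := hTQ _ _ _ _ _ _ (idm (T Q \ox B) - (idm (T Q) \oxm i) \c r) ki.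
  by rewrite compBl compIm -compA hr compmI subrr.
pose M := free_tmod T Q.
pose sF X : iso (F (T Q \ox X)) (T Q \ox F X) := mf_iso F (M : tmod_moncat T) X.
have sF_nat X Y (f : hom C X Y) :
    sF Y \c fmap F (idm (T Q) \oxm f) = (idm (T Q) \oxm fmap F f) \c sF X.
  exact: (mf_iso_nat_r F M f).
have mFi : mono (fmap F i).
  apply: mono0 => W g ig; apply: (tensor_faithful tc TQ0).
  have ret : fmap F r \c bwd (sF B) \c (idm (T Q) \oxm fmap F i) = bwd (sF A).
    apply: (iso_cancelr (f := sF A)); rewrite -!compA -sF_nat (compA (bwd (sF B))).
    by rewrite fwdK compIm -fmap_comp hr fmap_id fwdK.
  apply: (iso_cancell (f := iso_sym (sF A))); rewrite /= -ret comp0r -!compA.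
  by rewrite -bmap_compr ig bmap0r !comp0r.
apply: is_kernelI => //; first by rewrite -fmap_comp (proj1 ki) fmap0.
(* A mono is the kernel of its cokernel [p], so it remains to see [p \c g = 0], which may be tested
   after tensoring with [T Q]. There the splitting, transported by [F], writes [g] through the image
   of [i]. *)
move=> W g dg; have [P [p cp]] := ab_coker ab (fmap F i).
apply: (kernel_lift (mono_kernel_coker ab mFi cp)).
apply: (tensor_faithful tc TQ0); rewrite bmap_compr.
pose g' := bwd (sF B) \c (idm (T Q) \oxm g).
have dg' : fmap F (idm (T Q) \oxm d) \c g' = 0.
  apply: (iso_cancell (f := sF D)); rewrite compA sF_nat comp0r -compA.
  by rewrite (compA (sF B)) bwdK compIm -bmap_compr dg bmap0r.
have : fmap F (idm (T Q \ox B) - (idm (T Q) \oxm i) \c r) \c g' = 0.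
  by rewrite -hs fmap_comp -compA dg' comp0r.
rewrite fmapB fmap_id compBl compIm => /eqP; rewrite subr_eq0 => /eqP g'E.
have -> : idm (T Q) \oxm g = sF B \c g' by rewrite compA bwdK compIm.
rewrite g'E fmap_comp !compA -(compA _ (sF B)) sF_nat !compA -bmap_compr (proj1 cp).
by rewrite bmap0r !comp0l.
Qed.

Lemma coact_mono (F : modfunctor CM CM) X : mono (coact F X).
Proof.
rewrite coactE fmap_comp; apply: mono_comp; first exact: is_iso_mono (iso_is_iso _).
apply: mono_comp; last exact: kernel_mono (modfunctor_left_exact F (unit_kernel X)).
by apply: is_iso_mono; exact: (iso_is_iso (iso_map F (iso_sym (runit (T X))))).
Qed.

(** [F] preserves the kernel of [unit_kernel], and [T X \ox F one] is [F (T X)] up to the module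
    structure; the equation on [y] is the equalizer condition read through this identification. *)
Lemma coact_lift (F : modfunctor CM CM) X Z (y : hom C Z (T X \ox F one)) :
  coact (cofree T (F one)) X \c y = (idm (T X) \oxm coact F one) \c y ->
  exists x, coact F X \c x = y.
Proof.
move=> hy; pose L := free_tmod T X.
pose sF : iso (F (T X \ox one)) (T X \ox F one) := mf_iso F (L : tmod_moncat T) one.
pose kap := iso_comp sF (iso_map F (iso_sym (runit (T X)))).
have kapE : coact F X = kap \c fmap F (eta T X) by rewrite coactE fmap_comp compA.
pose z := bwd kap \c y.
have kz : kap \c z = y by rewrite /z compA bwdK compIm.
have ze : coact F (T X) \c z = (fmap T (eta T X) \oxm idm (F one)) \c y.
  pose sC := iso_comp (assoc (T X) (T one) (F one))
    (iso_bmap tensor (strength_iso L one) (iso_refl (F one))).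
  pose tr := iso_map (bfix_r tensor (F one)) (iso_map T (runit (T X))).
  apply: (iso_cancell (f := iso_comp sC (iso_sym tr))) => /=.
  transitivity (coact (cofree T (F one)) X \c y); last first.
    by rewrite coactE /= fmap_comp bmap_compl !compA.
  rewrite hy.
  transitivity ((idm (T X) \oxm coact F one) \c sF \c (fmap F (bwd (runit (T X))) \c z));
    last by rewrite -kz /= -!compA.
  have := coact_mod F L one => /= e; rewrite -/sF in e.
  rewrite e -[LHS]compA -[RHS]compA; congr (_ \c _).
  rewrite [LHS]compA [RHS]compA; congr (_ \c z).
  by have := @coact_natural _ _ _ F _ _ (bwd (runit (T X))) => /= ->.
(* Tested against the mono [coact], whose naturality turns the difference into [T] of
   [fmap T (eta T X) - eta T (T X)] after [T] of [eta T X], and this vanishes by naturality of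
   [eta]. *)
have dz : fmap F (fmap T (eta T X) - eta T (T X)) \c z = 0.
  apply: (mono_eq0 (@coact_mono F (T (T X)))); rewrite compA.
  have := @coact_natural _ _ _ F _ _ (fmap T (eta T X) - eta T (T X)) => /= ->.
  rewrite -compA ze compA -bmap_compl -fmap_comp compBl eta_nat subrr fmap0 bmap0l.
  by rewrite comp0l.
have [x ex] := kernel_lift (modfunctor_left_exact F (unit_kernel X)) dz.
by exists x; rewrite kapE -compA ex.
Qed.

(** Both naturality and compatibility with the action can be checked after composing with the mono
    [m], tensored with the acting object where necessary. *)
Lemma modnat_factor (F G K : modfunctor CM CM) (m : modnat G K) (b : modnat F K)
    (a : forall X : C, hom C (F X) (G X)) :
  (forall X, mono (smval m X)) -> (forall X, smval m X \c a X = smval b X) ->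
  is_modnat (F := F) (G := G) a.
Proof.
move=> mm ma; have [nm modm] := smvalP m; have [nb modb] := smvalP b.
split=> [X Y f|M X].
  by apply: (mm Y); rewrite compA ma nb compA nm -compA ma.
apply: (@tensor_mono _ _ tc (forget T M) _ _ (smval m X) (mm X)).
rewrite !compA -bmap_compr ma.
have := modb M X => /= ->; rewrite -ma compA.
by have := modm M X => /= ->.
Qed.

(** The composite of [coact] with [cofree_map T f] lands, at every [X], in the subobject [coact G X]
    by [coact_lift]. The resulting family has value [f] at [one] by the counit. *)
Lemma coact_full (F G : modfunctor CM CM) (f : hom C (F one) (G one)) :
  (idm (T one) \oxm f) \c coact F one = coact G one \c f ->
  exists a : modnat F G, smval a one = f.
Proof.
move=> hf; pose b := modnat_comp (cofree_map T f) (coact_map F).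
have h X : exists x, coact G X \c x = smval b X.
  apply: coact_lift => /=.
  have := coact_modnat (cofree_map T f) X => /= e1.
  rewrite compA -e1 -compA.
  have := coact_modnat (coact_map F) X => /= <-.
  by rewrite !compA -!bmap_compr hf.
pose a X := projT1 (cid (h X)).
have aE X : coact G X \c a X = smval b X := projT2 (cid (h X)).
have ha : is_modnat (F := F) (G := G) a.
  by apply: (modnat_factor (m := coact_map G) (b := b)) => //; exact: coact_mono.
exists (@Sublmod _ _ (modnats F G) a ha) => /=.
transitivity (counit_at T (G one) \c (coact G one \c a one)).
  by rewrite compA counit_coact compIm.
by rewrite aE /= compA counit_at_nat -compA counit_coact compmI.
Qed.

Lemma modnat_unit_inj (F G : modfunctor CM CM) (a b : modnat F G) :
  smval a one = smval b one -> a = b.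
Proof.
move=> e; apply: modnat_ext => X; apply: (@coact_mono G X).
by rewrite -!coact_modnat e.
Qed.

(** Kernels are taken objectwise. Since [M \ox -] preserves kernels, [M \ox K0 X] is again a kernel
    and the structure isomorphisms of [G] restrict; every axiom is checked after the inclusion. *)
Lemma modfunctor_kernel (G G' : modfunctor CM CM) (d : modnat G G') :
  exists (K : modfunctor CM CM) (i : modnat K G), forall X, is_kernel (smval i X) (smval d X).
Proof.
have [nd modd] := smvalP d.
pose K0 X := projT1 (cid (ab_ker ab (smval d X))).
pose i0 X : hom C (K0 X) (G X) := projT1 (cid (projT2 (cid (ab_ker ab (smval d X))))).
have ki X : is_kernel (i0 X) (smval d X) := projT2 (cid (projT2 (cid (ab_ker ab (smval d X))))).
have mi X : mono (i0 X) := kernel_mono (ki X).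
have hmap X Y (f : hom C X Y) : exists u : hom C (K0 X) (K0 Y), i0 Y \c u = fmap G f \c i0 X.
  by apply: (kernel_lift (ki Y)); rewrite compA nd -compA (proj1 (ki X)) comp0r.
pose Kmap X Y f := projT1 (cid (hmap X Y f)).
have KmapE X Y f : i0 Y \c Kmap X Y f = fmap G f \c i0 X := projT2 (cid (hmap X Y f)).
have Klin X Y : linear (Kmap X Y).
  move=> a f g; apply: mi.
  by rewrite KmapE comp_linr !KmapE fmap_lin comp_linl.
have Kid X : Kmap X X (idm X) = idm (K0 X).
  by apply: mi; rewrite KmapE fmap_id compIm compmI.
have Kcomp X Y Z (g : hom C Y Z) (f : hom C X Y) : Kmap X Z (g \c f) = Kmap Y Z g \c Kmap X Y f.
  by apply: mi; rewrite KmapE compA KmapE -compA KmapE fmap_comp compA.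
pose KF : functor C C := Functor Klin Kid Kcomp.
pose s (M : tmod T) X : iso (G (M \ox X)) (M \ox G X) := mf_iso G (M : tmod_moncat T) X.
pose s' (M : tmod T) X : iso (G' (M \ox X)) (M \ox G' X) := mf_iso G' (M : tmod_moncat T) X.
have sd (M : tmod T) X :
    (idm (tm_car M) \oxm smval d X) \c s M X = s' M X \c smval d (M \ox X) := modd M X.
have kM (M : tmod T) X := tensor_kernel tc (tm_car M) (ki X).
have hf (M : tmod T) X : exists u : hom C (K0 (M \ox X)) (M \ox K0 X),
    (idm (tm_car M) \oxm i0 X) \c u = s M X \c i0 (M \ox X).
  by apply: (kernel_lift (kM M X)); rewrite compA sd -compA (proj1 (ki _)) comp0r.
have hb (M : tmod T) X : exists u : hom C (M \ox K0 X) (K0 (M \ox X)),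
    i0 (M \ox X) \c u = bwd (s M X) \c (idm (tm_car M) \oxm i0 X).
  apply: (kernel_lift (ki _)); apply: (iso_cancell (f := s' M X)).
  rewrite compA -sd comp0r -compA (compA (s M X)) bwdK compIm.
  exact: (proj1 (kM M X)).
have fb (M : tmod T) X : projT1 (cid (hb M X)) \c projT1 (cid (hf M X)) = idm _.
  apply: mi; case: (cid (hb M X)) (cid (hf M X)) => u /= eu [v /= ev].
  by rewrite compA eu -compA ev compA fwdK compIm compmI.
have bf (M : tmod T) X : projT1 (cid (hf M X)) \c projT1 (cid (hb M X)) = idm _.
  apply: (kernel_mono (kM M X)); case: (cid (hb M X)) (cid (hf M X)) => u /= eu [v /= ev].
  by rewrite compA ev -compA eu compA bwdK compIm compmI.
have [Ks KsE] : exists Ks : forall (M : tmod T) X, iso (KF (M \ox X)) (M \ox KF X),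
    forall M X, (idm (tm_car M) \oxm i0 X) \c Ks M X = s M X \c i0 (M \ox X).
  exists (fun M X => Iso (fb M X) (bf M X)) => M X; exact: projT2 (cid (hf M X)).
have snat (M N : tmod T) X Y (f : tmod_hom M N) (g : hom C X Y) :
    s N Y \c fmap G (smval f \oxm g) = (smval f \oxm fmap G g) \c s M X.
  exact: (@mf_nat _ _ _ _ G (M : tmod_moncat T) N X Y f g).
have Knat (M N : tmod_moncat T) X Y (f : hom (tmod_moncat T) M N) (g : hom C X Y) :
    Ks N Y \c fmap KF (bmap (@act _ _ CM) f g) = bmap (@act _ _ CM) f (fmap KF g) \c Ks M X.
  apply: (@tensor_mono _ _ tc (tm_car N) _ _ (i0 Y) (mi Y)) => /=.
  rewrite [LHS]compA KsE -[LHS]compA KmapE [LHS]compA snat -compA -KsE !compA -!bmap_comp.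
  by rewrite compIm compmI KmapE.
have Kassoc (M N : tmod_moncat T) (X : C) : @massoc _ _ CM M N (KF X) \c Ks (tmod_tensor_ob M N) X
    = bmap (@act _ _ CM) (idm M) (Ks N X) \c Ks M (tm_car N \ox X) \c fmap KF (@massoc _ _ CM M N X).
  have mm := tensor_mono tc (X := tm_car M) (tensor_mono tc (X := tm_car N) (mi X)).
  apply: mm => /=.
  pose m := tm_car M; pose n := tm_car N.
  have eR : (idm m \oxm (idm n \oxm i0 X)) \c ((idm m \oxm Ks N X) \c Ks M (n \ox X))
      = (idm m \oxm s N X) \c s M (n \ox X) \c i0 (m \ox (n \ox X)).
    by rewrite compA -bmap_compr KsE bmap_compr -compA KsE compA.
  rewrite [LHS]compA -assoc_nat bmap_id [RHS]compA eR -[RHS]compA KmapE [RHS]compA.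
  rewrite -[LHS]compA; transitivity (assoc m n (G X) \c (s (tmod_tensor_ob M N) X
      \c i0 ((m \ox n) \ox X))).
    by congr (_ \c _); exact: (KsE (tmod_tensor_ob M N) X).
  rewrite [LHS]compA; congr (_ \c i0 _).
  exact: (@mf_assoc _ _ _ _ G M N X).
have Kunit (X : C) : @munit _ _ CM (KF X) \c Ks (tmod_one T) X = fmap KF (@munit _ _ CM X).
  apply: mi => /=; rewrite compA -lunit_nat -compA KmapE.
  transitivity (lunit (G X) \c (s (tmod_one T) X \c i0 (one \ox X))).
    by congr (_ \c _); exact: (KsE (tmod_one T) X).
  rewrite compA; congr (_ \c i0 _).
  exact: (@mf_unit _ _ _ _ G X).
pose K : modfunctor CM CM := @ModFunctor k (tmod_moncat T) CM CM KF Ks Knat Kassoc Kunit.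
have hi : is_modnat (F := K) (G := G) i0.
  by split=> [X Y f|M X]; [exact: KmapE | exact: KsE].
by exists K, (@Sublmod _ _ (modnats K G) i0 hi).
Qed.

(** A comodule is the equalizer of the cofree ones on [Y] and on [T one \ox Y]. Taking this
    equalizer among module functors gives [F]; at [one] it is [delta] again, by the contraction with
    [counit_at]. *)
Lemma coact_ess_surj (Y : C) (delta : hom C Y (T one \ox Y)) :
  counit_at T Y \c delta = idm Y ->
  coact (cofree T Y) one \c delta = (idm (T one) \oxm delta) \c delta ->
  exists (F : modfunctor CM CM) (f : iso (F one) Y),
    delta \c f = (idm (T one) \oxm f) \c coact F one.
Proof.
move=> hcounit hcoassoc.
pose d : modnat (cofree T Y) (cofree T (T one \ox Y)) :=
  coact_map (cofree T Y) - cofree_map T delta.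
have [F [i ki]] := modfunctor_kernel d.
have dE : smval d one = coact (cofree T Y) one - (idm (T one) \oxm delta) by [].
have kd : is_kernel delta (smval d one).
  rewrite dE; apply: is_kernelI.
  - by rewrite compBl hcoassoc subrr.
  - by move=> W u v /(congr1 (comp (counit_at T Y))); rewrite !compA hcounit !compIm.
  - move=> W g /eqP; rewrite compBl subr_eq0 => /eqP e; exists (counit_at T Y \c g).
    have ee : counit_at T (T one \ox Y) \c coact (cofree T Y) one = idm (T one \ox Y).
      exact: (counit_coact (cofree T Y)).
    by rewrite -[RHS]compIm -ee -[RHS]compA e [RHS]compA counit_at_nat compA.
have [f0 isf fE] := kernel_unique (ki one) kd.
have [f ff] := is_iso_iso isf.
exists F, f; rewrite ff fE.
have e : (idm (T one) \oxm counit_at T Y) \c (coact (cofree T Y) one \c smval i one) = smval i one.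
  by rewrite compA; apply: etrans (congr1 (fun h => h \c _) (counit_cofree T one Y)) (compIm _).
apply: etrans (esym e) _; apply: etrans (congr1 (comp _) (esym (coact_modnat i one))) _.
by rewrite [LHS]compA -bmap_compr -fE (compA (counit_at T Y)) hcounit compIm.
Qed.

End Comonadicity.

(** * Modules over a finite-dimensional algebra *)

Section JointCokernels.
Variables (k : fieldType) (E : lincat k).

(** Packs a finite family of maps into a single map out of a power, so that a joint cokernel becomes
    an ordinary one. *)
Lemma comp_sum_eq0 n (X Y S W : E) (f : 'I_n -> hom E X Y) (F : hom E S Y)
    (e : 'I_n -> hom E X S) (p : 'I_n -> hom E S X) (g : hom E Y W) :
  F = \sum_i f i \c p i -> (forall i, F \c e i = f i) ->
  g \c F = 0 <-> forall i, g \c f i = 0.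
Proof.
move=> FE eE; split=> [gF i|gf]; first by rewrite -eE compA gF comp0l.
by rewrite FE comp_sumr big1 // => i _; rewrite compA gf comp0l.
Qed.

Lemma biproduct_sum n (X Y S : E) (f : 'I_n -> hom E X Y)
    (e : 'I_n -> hom E X S) (p : 'I_n -> hom E S X) :
  is_biproduct (X := fun _ => X) e p -> forall i, (\sum_j f j \c p j) \c e i = f i.
Proof.
move=> [pe pe0 _] i; rewrite comp_suml (bigD1 i) //= -compA pe compmI big1 ?addr0 // => j ji.
by rewrite -compA pe0 ?comp0r // => /esym/eqP; rewrite (negbTE ji).
Qed.

Hypothesis ab : abelian E.

Lemma joint_cokernel n (X Y : E) (f : 'I_n -> hom E X Y) :
  exists (Q : E) (q : hom E Y Q), [/\ forall i, q \c f i = 0, epi q &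
    forall W (g : hom E Y W), (forall i, g \c f i = 0) -> exists h, h \c q = g].
Proof.
have [S [e [p bp]]] := direct_sum_ord (ab_zero ab) (ab_sum ab) n X.
pose F := \sum_i f i \c p i.
have Fe i : F \c e i = f i := biproduct_sum f bp i.
have [Q [q cq]] := ab_coker ab F; exists Q, q; split.
- by apply/(comp_sum_eq0 q (erefl F) Fe); exact: (proj1 cq).
- exact: cokernel_epi cq.
- by move=> W g /(comp_sum_eq0 g (erefl F) Fe); exact: cokernel_desc.
Qed.

End JointCokernels.

(** * The regular module and presentations by it *)

Section RegularModule.
Variables (k : fieldType) (H : falgType k).

Local Notation d := (\dim (@fullv k H)).
Local Notation hbasis := (vbasis (@fullv k H)).

Definition alg_col (x : H) : 'cV[k]_d := \col_i coord hbasis i x.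
Definition col_alg (c : 'cV[k]_d) : H := \sum_i c i 0 *: hbasis`_i.

Lemma alg_col_lin : linear alg_col.
Proof. by move=> a x y; apply/colP => i; rewrite !mxE linearP. Qed.

Lemma col_alg_lin : linear col_alg.
Proof.
move=> a c c'; rewrite /col_alg scaler_sumr -big_split /=; apply: eq_bigr => i _.
by rewrite !mxE scalerDl scalerA.
Qed.

Lemma alg_colK x : col_alg (alg_col x) = x.
Proof.
rewrite /col_alg [RHS](coord_vbasis (memvf x)).
by apply: eq_bigr => i _; rewrite mxE.
Qed.

Lemma col_algK c : alg_col (col_alg c) = c.
Proof.
apply/colP => i; rewrite mxE /col_alg linear_sum (bigD1 i) //= linearZ /=.
rewrite coord_free ?(basis_free (vbasisP _)) // eqxx mulr1 big1 ?addr0 // => j ji.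
rewrite linearZ /= coord_free ?(basis_free (vbasisP _)) //.
by rewrite (negbTE (_ : j != i)) ?mulr0.
Qed.

Lemma linear_basis_eq0 (V : lmodType k) (f : H -> V) :
  linear f -> (forall i : 'I_d, f hbasis`_i = 0) -> forall x, f x = 0.
Proof.
move=> f_lin f0 x; rewrite (coord_vbasis (memvf x)) (lin_sum _ f_lin) big1 // => i _.
by rewrite (linZ f_lin) f0 scaler0.
Qed.

Program Definition reg_hmod : hmod H :=
  @HMod k H d (fun x c => alg_col (x * col_alg c)) _ _ _ _.
Next Obligation. by move=> v a x y /=; rewrite mulrDl -scalerAl alg_col_lin. Qed.
Next Obligation. by move=> x a v w /=; rewrite col_alg_lin mulrDr -scalerAr alg_col_lin. Qed.
Next Obligation. by move=> x y v /=; rewrite alg_colK mulrA. Qed.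
Next Obligation. by move=> v /=; rewrite mul1r col_algK. Qed.

Implicit Types V W : hmod H.

Lemma hmod_ext V W (f g : hmod_hom V W) : (forall v, smval f v = smval g v) -> f = g.
Proof. by move=> e; apply: smval_inj; apply/lfunP. Qed.

Lemma hmod_hom_lin V W (f : hmod_hom V W) : linear (smval f : hm_car V -> hm_car W).
Proof. by move=> a u v; rewrite linearP. Qed.

Lemma hmod_homP V W (f : hmod_hom V W) x v : smval f (hm_act x v) = hm_act x (smval f v).
Proof. by case: f. Qed.

Lemma hmod_hom_of V W (f : 'cV[k]_(hm_dim V) -> 'cV[k]_(hm_dim W)) :
  linear f -> (forall x v, f (hm_act x v) = hm_act x (f v)) ->
  exists g : hmod_hom V W, forall v, smval g v = f v.
Proof.
move=> f_lin hf.
pose L := GRing.isLinear.Build _ _ _ _ (f : hm_car V -> hm_car W) f_lin.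
pose F : {linear hm_car V -> hm_car W} := HB.pack (f : hm_car V -> hm_car W) L.
have FE v : linfun F v = f v by rewrite lfunE.
have hF : hmod_homs V W (linfun F) by move=> x v; rewrite !FE hf.
by exists (@Sublmod _ _ (hmod_homs V W) (linfun F) hF).
Qed.

Definition hmod_eval V (v : 'cV[k]_(hm_dim V)) : hmod_hom reg_hmod V :=
  projT1 (cid (@hmod_hom_of reg_hmod V (fun c => hm_act (col_alg c) v)
    (fun a c c' => etrans (congr1 (fun x => hm_act x v) (col_alg_lin a c c')) (hm_linl v a _ _))
    (fun x c => etrans (congr1 (fun y => hm_act y v) (alg_colK _)) (hm_mul _ _ _)))).

Lemma hmod_evalE V (v : 'cV[k]_(hm_dim V)) c : smval (hmod_eval v) c = hm_act (col_alg c) v.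
Proof. by rewrite /hmod_eval; case: (cid _) => g /= ->. Qed.

Lemma hmod_eval_lin V : linear (@hmod_eval V).
Proof.
move=> a u v; apply: hmod_ext => c.
by rewrite /= !lfunE /= !lfunE /= !hmod_evalE hm_linr.
Qed.

Lemma comp_hmod_eval V W (f : hom (hmod_cat H) V W) v :
  f \c (hmod_eval v : hom (hmod_cat H) _ _) = hmod_eval (smval f v).
Proof. by apply: hmod_ext => c; rewrite /= comp_lfunE !hmod_evalE hmod_homP. Qed.

(** Right multiplication by [x], the general endomorphism of the regular left module. *)
Definition rmul (x : H) : hom (hmod_cat H) reg_hmod reg_hmod := @hmod_eval reg_hmod (alg_col x).

Lemma rmul_lin : linear rmul.
Proof. by move=> a x y; rewrite /rmul alg_col_lin; exact: hmod_eval_lin. Qed.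

Lemma hmod_eval_rmul V (v : 'cV[k]_(hm_dim V)) x :
  (hmod_eval v : hom (hmod_cat H) _ _) \c rmul x = hmod_eval (hm_act x v).
Proof. by rewrite comp_hmod_eval hmod_evalE alg_colK. Qed.

Lemma hom_reg_eval V (f : hmod_hom reg_hmod V) : f = hmod_eval (smval f (alg_col 1)).
Proof.
apply: hmod_ext => c; rewrite hmod_evalE -hmod_homP /=.
by rewrite alg_colK mulr1 col_algK.
Qed.

Lemma hmod_zero : exists V : hmod_cat H, is_zero V.
Proof.
pose V : hmod H := @HMod k H 0 (fun _ v => v) 
  (fun v a x y => etrans (flatmx0 _) (esym (flatmx0 _)))
  (fun x a u v => etrans (flatmx0 _) (esym (flatmx0 _)))
  (fun x y v => erefl) (fun v => erefl).
exists V; apply: hmod_ext => v.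
by rewrite [LHS]flatmx0 [RHS]flatmx0.
Qed.

Lemma hmod_sum (V W : hmod_cat H) :
  exists S, is_direct_sum (fun b : bool => if b then V else W) S.
Proof.
pose n := hm_dim V; pose m := hm_dim W.
pose act x (u : 'cV[k]_(n + m)) := col_mx (hm_act x (usubmx u)) (hm_act x (dsubmx u)).
have h1 v : linear (act^~ v).
  by move=> a x y; rewrite /act !hm_linl scale_col_mx add_col_mx.
have h2 x : linear (act x).
  by move=> a u v; rewrite /act !linearP /= !hm_linr scale_col_mx add_col_mx.
have h3 x y v : act (x * y) v = act x (act y v).
  by rewrite /act !hm_mul col_mxKu col_mxKd.
have h4 v : act 1 v = v by rewrite /act !hm_one vsubmxK.
pose S : hmod H := HMod h1 h2 h3 h4.
have [eV eVE] : exists e : hmod_hom V S, forall v, smval e v = col_mx v 0.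
  apply: (@hmod_hom_of V S (fun v => col_mx v 0)) => [a u v|x v].
    by rewrite scale_col_mx add_col_mx scaler0 addr0.
  by rewrite /= /act col_mxKu col_mxKd (lin0 (hm_linr _)).
have [eW eWE] : exists e : hmod_hom W S, forall v, smval e v = col_mx 0 v.
  apply: (@hmod_hom_of W S (fun v => col_mx 0 v)) => [a u v|x v].
    by rewrite scale_col_mx add_col_mx scaler0 addr0.
  by rewrite /= /act col_mxKu col_mxKd (lin0 (hm_linr _)).
have [pV pVE] : exists p : hmod_hom S V, forall v, smval p v = usubmx v.
  apply: (@hmod_hom_of S V (fun v => usubmx v)) => [a u v|x v]; first by rewrite linearP.
  by rewrite /= /act col_mxKu.
have [pW pWE] : exists p : hmod_hom S W, forall v, smval p v = dsubmx v.
  apply: (@hmod_hom_of S W (fun v => dsubmx v)) => [a u v|x v]; first by rewrite linearP.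
  by rewrite /= /act col_mxKd.
pose e b : hom (hmod_cat H) (if b then V else W) S :=
  if b as b return hom (hmod_cat H) (if b then V else W) S then eV else eW.
pose p b : hom (hmod_cat H) S (if b then V else W) :=
  if b as b return hom (hmod_cat H) S (if b then V else W) then pV else pW.
exists S, e, p; split.
- by case; apply: hmod_ext => v; rewrite /= comp_lfunE lfunE /=
    ?eVE ?eWE ?pVE ?pWE ?col_mxKu ?col_mxKd.
- by case; case=> // _; apply: hmod_ext => v; rewrite /= comp_lfunE lfunE /=
    ?eVE ?eWE ?pVE ?pWE ?col_mxKu ?col_mxKd.
- rewrite (bigD1 true) //= (big_pred1 false) => [|[] //].
  apply: hmod_ext => v; rewrite /= !lfunE /= !lfunE /= eVE eWE pVE pWE.
  by rewrite add_col_mx addr0 add0r vsubmxK.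
Qed.

(* Every module has a finite presentation by copies of the regular one. *)
Lemma right_exact_hmod_desc (E : lincat k) (F : functor (hmod_cat H) E) (V : hmod H) :
  right_exact F ->
  (forall (Z : E) (g g' : hom E (F V) Z),
     (forall v : 'cV_(hm_dim V), g \c fmap F (hmod_eval v : hom (hmod_cat H) _ _)
        = g' \c fmap F (hmod_eval v : hom (hmod_cat H) _ _)) -> g = g') /\
  (forall (Z : E) (g : 'cV[k]_(hm_dim V) -> hom E (F reg_hmod) Z), linear g ->
     (forall x v, g v \c fmap F (rmul x) = g (hm_act x v)) ->
     exists g', forall v : 'cV_(hm_dim V),
       g' \c fmap F (hmod_eval v : hom (hmod_cat H) _ _) = g v).
Proof.
move=> F_rex; set n := hm_dim V.
have [R [e [p bp]]] := direct_sum_ord hmod_zero hmod_sum n reg_hmod.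
have [R2 [e2 [p2 bp2]]] := direct_sum_ord hmod_zero hmod_sum d R.
pose bv (i : 'I_n) : 'cV[k]_n := delta_mx i 0.
have bvE (v : 'cV[k]_n) : v = \sum_i v i 0 *: bv i.
  by rewrite {1}[v]matrix_sum_delta; apply: eq_bigr => i _; rewrite big_ord1.
pose ev i : hom (hmod_cat H) reg_hmod V := @hmod_eval V (bv i).
pose q : hom (hmod_cat H) R V := \sum_i ev i \c p i.
have qe i : q \c e i = ev i := biproduct_sum ev bp i.
(* The relation for a basis element of [H] and a generator: their product equals the expansion, in
   the generators, of the action on the basis vector. By linearity these finitely many relations
   force compatibility with all of [H]. *)
pose fa (a : 'I_d) i : hom (hmod_cat H) reg_hmod R :=
  e i \c rmul hbasis`_a - \sum_j hm_act hbasis`_a (bv i) j 0 *: e j.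
pose f1 a : hom (hmod_cat H) R R := \sum_i fa a i \c p i.
have f1e a i : f1 a \c e i = fa a i := biproduct_sum (fa a) bp i.
pose f : hom (hmod_cat H) R2 R := \sum_a f1 a \c p2 a.
have fe a : f \c e2 a = f1 a := biproduct_sum f1 bp2 a.
have cq : is_cokernel q f.
  apply: is_cokernelI.
  - apply/(comp_sum_eq0 q (erefl f) fe) => a; apply/(comp_sum_eq0 q (erefl (f1 a)) (f1e a)) => i.
    rewrite compBr compA qe hmod_eval_rmul comp_sumr.
    under eq_bigr => j _ do rewrite compZr qe.
    rewrite {1}[hm_act _ _]bvE (lin_sum _ (@hmod_eval_lin V)).
    apply/eqP; rewrite subr_eq0; apply/eqP; apply: eq_bigr => j _.
    exact: (linZ (@hmod_eval_lin V)).
  - move=> W g g' gg'; apply: hmod_ext => v.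
    rewrite [v]bvE !(lin_sum _ (hmod_hom_lin _)); apply: eq_bigr => i _.
    rewrite !(linZ (hmod_hom_lin _)); congr (_ *: _).
    have := congr1 (fun h => h \c e i) gg'; rewrite -!compA qe !comp_hmod_eval.
    move/(congr1 (fun h : hmod_hom reg_hmod W => smval h (alg_col 1))).
    by rewrite !hmod_evalE alg_colK !hm_one.
  - move=> W g /(comp_sum_eq0 g (erefl f) fe) gf.
    pose w i := smval (g \c e i) (alg_col 1).
    pose h (v : 'cV[k]_n) : 'cV[k]_(hm_dim W) := \sum_i v i 0 *: w i.
    have h_lin : linear h.
      move=> a u v; rewrite /h scaler_sumr -big_split /=; apply: eq_bigr => i _.
      by rewrite !mxE scalerDl scalerA.
    have hbv i : h (bv i) = w i.
      rewrite /h (bigD1 i) //= mxE !eqxx scale1r big1 ?addr0 // => j ji.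
      by rewrite mxE (negbTE ji) scale0r.
    have h_act_basis (a : 'I_d) i : h (hm_act hbasis`_a (bv i)) = hm_act hbasis`_a (w i).
      have ge j : g \c e j = hmod_eval (w j) := hom_reg_eval _.
      have := gf a => /(comp_sum_eq0 g (erefl (f1 a)) (f1e a))/(_ i).
      rewrite compBr comp_sumr compA ge hmod_eval_rmul => /eqP; rewrite subr_eq0 => /eqP.
      have -> : \sum_j g \c (hm_act hbasis`_a (bv i) j 0 *: e j)
          = hmod_eval (h (hm_act hbasis`_a (bv i))).
        rewrite (lin_sum _ (@hmod_eval_lin W)); apply: eq_bigr => j _.
        by rewrite compZr ge (linZ (@hmod_eval_lin W)).
      move/(congr1 (fun h : hmod_hom reg_hmod W => smval h (alg_col 1))).
      by rewrite !hmod_evalE alg_colK !hm_one.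
    have h_act x v : h (hm_act x v) = hm_act x (h v).
      rewrite [v]bvE (lin_sum _ (hm_linr _)) !(lin_sum _ h_lin) (lin_sum _ (hm_linr _)).
      apply: eq_bigr => i _; rewrite (linZ (hm_linr _)) !(linZ h_lin) (linZ (hm_linr _)).
      congr (_ *: _); rewrite hbv; apply/eqP; rewrite -subr_eq0; apply/eqP.
      pose D x := h (hm_act x (bv i)) - hm_act x (w i).
      apply: (@linear_basis_eq0 _ D) => [a y z|a]; last first.
        by rewrite /D h_act_basis subrr.
      by rewrite /D !hm_linl h_lin scalerBr opprD addrACA.
    have [h' h'E] := @hmod_hom_of V W h h_lin h_act.
    exists h'; rewrite comp_sumr -[RHS]compmI; have [_ _ <-] := bp; rewrite comp_sumr.
    apply: eq_bigr => i _; rewrite !compA; congr (_ \c _).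
    by rewrite comp_hmod_eval h'E hbv; exact: esym (hom_reg_eval _).
have cFq := F_rex _ _ _ _ _ cq.
have Fq : fmap F q = \sum_i fmap F (ev i) \c fmap F (p i).
  by rewrite fmap_sum; apply: eq_bigr => i _; rewrite fmap_comp.
split=> [Z g g' gg'|Z g g_lin g_rmul].
  apply: (cokernel_epi cFq); rewrite Fq !comp_sumr; apply: eq_bigr => i _.
  by rewrite !compA gg'.
pose G : hom E (F R) Z := \sum_i g (bv i) \c fmap F (p i).
have Ge i : G \c fmap F (e i) = g (bv i).
  rewrite comp_suml (bigD1 i) //= -compA -fmap_comp; have [pe pe0 _] := bp.
  rewrite pe fmap_id compmI big1 ?addr0 // => j ji.
  by rewrite -compA -fmap_comp pe0 ?fmap0 ?comp0r // => /esym/eqP; rewrite (negbTE ji).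
have Gf : G \c fmap F f = 0.
  rewrite fmap_sum comp_sumr big1 // => a _; rewrite fmap_comp compA.
  suff -> : G \c fmap F (f1 a) = 0 by rewrite comp0l.
  rewrite fmap_sum comp_sumr big1 // => i _; rewrite fmap_comp compA.
  suff -> : G \c fmap F (fa a i) = 0 by rewrite comp0l.
  rewrite fmapB fmap_comp fmap_sum compBr compA Ge g_rmul comp_sumr.
  under eq_bigr => j _ do rewrite fmapZ compZr Ge -(linZ g_lin).
  by rewrite -(lin_sum _ g_lin) -bvE subrr.
have [g' g'E] := cokernel_desc cFq Gf; exists g' => v.
have ev_v i : g' \c fmap F (ev i) = g (bv i).
  by rewrite -qe fmap_comp compA g'E Ge.
rewrite [v]bvE (lin_sum _ (@hmod_eval_lin V)) fmap_sum comp_sumr (lin_sum _ g_lin).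
apply: eq_bigr => i _; rewrite (linZ g_lin) -ev_v -compZr -fmapZ.
by rewrite -(linZ (@hmod_eval_lin V)).
Qed.

End RegularModule.

(** * Modules in a linear category *)

Section Powers.
Variables (k : fieldType) (C : lincat k).
Hypothesis ab : abelian C.

Let powS n X := cid (direct_sum_ord (ab_zero ab) (ab_sum ab) n X).
Definition pow n (X : C) : C := projT1 (powS n X).
Definition pow_in n (X : C) : 'I_n -> hom C X (pow n X) := projT1 (cid (projT2 (powS n X))).
Definition pow_out n (X : C) : 'I_n -> hom C (pow n X) X :=
  projT1 (cid (projT2 (cid (projT2 (powS n X))))).

Lemma pow_biproduct n X : is_biproduct (X := fun _ => X) (@pow_in n X) (@pow_out n X).
Proof. exact: projT2 (cid (projT2 (cid (projT2 (powS n X))))). Qed.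

(** Reading [pow n X] as [k^n (x) X], this is the insertion of the vector [v]. It lets maps out of
    the power be handled as linear families, with no basis in sight. *)
Definition pow_elt n (X : C) (v : 'cV[k]_n) : hom C X (pow n X) :=
  \sum_i v i 0 *: pow_in X i.

Lemma pow_elt_lin n X : linear (@pow_elt n X).
Proof.
move=> a u v; rewrite /pow_elt scaler_sumr -big_split /=; apply: eq_bigr => i _.
by rewrite !mxE scalerDl scalerA.
Qed.

Lemma pow_elt_delta n X i : pow_elt X (delta_mx i 0) = @pow_in n X i.
Proof.
rewrite /pow_elt (bigD1 i) //= mxE !eqxx scale1r big1 ?addr0 // => j ji.
by rewrite mxE (negbTE ji) scale0r.
Qed.

Lemma pow_out_elt n X i v : @pow_out n X i \c pow_elt X v = v i 0 *: idm X.
Proof.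
have [pe pe0 _] := pow_biproduct n X.
rewrite comp_sumr (bigD1 i) //= compZr pe big1 ?addr0 // => j /eqP ji.
by rewrite compZr pe0 // scaler0.
Qed.

Lemma col_delta_sum n (v : 'cV[k]_n) : v = \sum_i v i 0 *: delta_mx i 0.
Proof. by rewrite {1}[v]matrix_sum_delta; apply: eq_bigr => i _; rewrite big_ord1. Qed.

Lemma pow_in_ext n X Y (f g : hom C (pow n X) Y) :
  (forall i, f \c pow_in X i = g \c pow_in X i) -> f = g.
Proof.
move=> e; have [_ _ ep] := pow_biproduct n X.
rewrite -[f]compmI -[g]compmI -ep !comp_sumr; apply: eq_bigr => i _.
by rewrite !compA e.
Qed.

Lemma pow_elt_ext n X Y (f g : hom C (pow n X) Y) :
  (forall v, f \c pow_elt X v = g \c pow_elt X v) -> f = g.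
Proof. by move=> e; apply: pow_in_ext => i; rewrite -pow_elt_delta. Qed.

Lemma pow_desc n X Y (u : 'cV[k]_n -> hom C X Y) : linear u ->
  exists f : hom C (pow n X) Y, forall v, f \c pow_elt X v = u v.
Proof.
move=> u_lin; exists (\sum_i u (delta_mx i 0) \c pow_out X i) => v.
rewrite comp_suml [in RHS](col_delta_sum v) (lin_sum _ u_lin); apply: eq_bigr => i _.
by rewrite -compA pow_out_elt compZr compmI (linZ u_lin).
Qed.

Definition pow_map n m (L : 'cV[k]_n -> 'cV[k]_m) X X' (g : hom C X X') :
    hom C (pow n X) (pow m X') :=
  \sum_i (pow_elt X' (L (delta_mx i 0)) \c g) \c pow_out X i.

Lemma pow_map_elt n m (L : 'cV[k]_n -> 'cV[k]_m) X X' (g : hom C X X') v :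
  linear L -> pow_map L g \c pow_elt X v = pow_elt X' (L v) \c g.
Proof.
move=> L_lin; rewrite /pow_map comp_suml [in RHS](col_delta_sum v) (lin_sum _ L_lin).
rewrite (lin_sum _ (@pow_elt_lin m X')) comp_suml; apply: eq_bigr => i _.
by rewrite -compA pow_out_elt compZr compmI (linZ L_lin) (linZ (@pow_elt_lin m X')) compZl.
Qed.

End Powers.

(** * The abelian category of [H]-modules in [C] *)

Section AlgebraModules.
Variables (k : fieldType) (H : falgType k) (C : lincat k).
Hypothesis ab : abelian C.

Record alg_mod := AlgMod {
  am_car :> C;
  am_act : H -> hom C am_car am_car;
  am_lin : linear am_act;
  am_mul : forall x y, am_act (x * y) = am_act x \c am_act y;
  am_one : am_act 1 = idm am_car
}.

Program Definition alg_mod_homs (M N : alg_mod) : submodule (hom C M N) :=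
  @Submodule k (hom C M N) (fun f => forall x, f \c am_act M x = am_act N x \c f) _ _.
Next Obligation. by move=> M N x /=; rewrite comp0l comp0r. Qed.
Next Obligation.
by move=> M N a f g hf hg x; rewrite comp_linl comp_linr hf hg.
Qed.

Definition alg_mod_hom (M N : alg_mod) : lmodType k := sublmod (alg_mod_homs M N).

Program Definition alg_mod_id (M : alg_mod) : alg_mod_hom M M :=
  @Sublmod _ _ (alg_mod_homs M M) (idm (am_car M)) _.
Next Obligation. by move=> M x; rewrite compIm compmI. Qed.

Program Definition alg_mod_comp (M N P : alg_mod) (g : alg_mod_hom N P)
    (f : alg_mod_hom M N) : alg_mod_hom M P :=
  @Sublmod _ _ (alg_mod_homs M P) (smval g \c smval f) _.
Next Obligation.
by move=> M N P [g hg] [f hf] x /=; rewrite -compA hf compA hg compA.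
Qed.

Program Definition alg_mod_cat : lincat k :=
  @LinCat k alg_mod alg_mod_hom alg_mod_id alg_mod_comp _ _ _ _ _.
Next Obligation. by move=> X Y Z f a g g'; apply: smval_inj; rewrite /= comp_linl. Qed.
Next Obligation. by move=> X Y Z f a g g'; apply: smval_inj; rewrite /= comp_linr. Qed.
Next Obligation. by move=> *; apply: smval_inj; rewrite /= compA. Qed.
Next Obligation. by move=> *; apply: smval_inj; rewrite /= compIm. Qed.
Next Obligation. by move=> *; apply: smval_inj; rewrite /= compmI. Qed.

Lemma alg_mod_homP (M N : alg_mod) (f : alg_mod_hom M N) x :
  smval f \c am_act M x = am_act N x \c smval f.
Proof. by case: f. Qed.

Lemma smval_comp (M N P : alg_mod_cat) (g : hom alg_mod_cat N P) (f : hom alg_mod_cat M N) :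
  smval (g \c f : alg_mod_hom M P) = smval g \c smval f.
Proof. by []. Qed.

Lemma smval_lin_comb (M N : alg_mod_cat) a (f g : hom alg_mod_cat M N) :
  smval (a *: f + g : alg_mod_hom M N) = a *: smval f + smval g.
Proof. by []. Qed.

Lemma smval_zero (M N : alg_mod_cat) : smval (0 : alg_mod_hom M N) = 0.
Proof. by []. Qed.

Lemma alg_mod_homI (M N : alg_mod) (f : hom C M N) :
  (forall x, f \c am_act M x = am_act N x \c f) -> exists g : hom alg_mod_cat M N, smval g = f.
Proof. by move=> h; exists (@Sublmod _ _ (alg_mod_homs M N) f h). Qed.

Lemma alg_mod_kernel (M N : alg_mod_cat) (f : hom alg_mod_cat M N) :
  exists (K : alg_mod_cat) (i : hom alg_mod_cat K M), is_kernel (smval i) (smval f).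
Proof.
have [K [i ki]] := ab_ker ab (smval f).
have hact x : exists u : hom C K K, i \c u = am_act M x \c i.
  by apply: (kernel_lift ki); rewrite compA alg_mod_homP -compA (proj1 ki) comp0r.
pose a x := projT1 (cid (hact x)).
have aE x : i \c a x = am_act M x \c i := projT2 (cid (hact x)).
have mi := kernel_mono ki.
have a_lin : linear a.
  by move=> c x y; apply: mi; rewrite compDr compZr !aE am_lin comp_linl.
have a_mul x y : a (x * y) = a x \c a y.
  by apply: mi; rewrite aE compA aE -compA aE compA am_mul.
have a_one : a 1 = idm K by apply: mi; rewrite aE am_one compIm compmI.
pose KM : alg_mod := AlgMod a_lin a_mul a_one.
have [i' i'E] : exists i' : hom alg_mod_cat KM M, smval i' = i.
  by apply: alg_mod_homI => x; exact: aE.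
by exists KM, i'; rewrite i'E.
Qed.

Lemma alg_mod_cokernel (M N : alg_mod_cat) (f : hom alg_mod_cat M N) :
  exists (K : alg_mod_cat) (p : hom alg_mod_cat N K), is_cokernel (smval p) (smval f).
Proof.
have [K [i ki]] := ab_coker ab (smval f).
have hact x : exists u : hom C K K, u \c i = i \c am_act N x.
  by apply: (cokernel_desc ki); rewrite -compA -alg_mod_homP compA (proj1 ki) comp0l.
pose a x := projT1 (cid (hact x)).
have aE x : a x \c i = i \c am_act N x := projT2 (cid (hact x)).
have mi := cokernel_epi ki.
have a_lin : linear a.
  by move=> c x y; apply: mi; rewrite compDl compZl !aE am_lin comp_linr.
have a_mul x y : a (x * y) = a x \c a y.
  by apply: mi; rewrite aE -compA aE compA aE -compA am_mul.
have a_one : a 1 = idm K by apply: mi; rewrite aE am_one compIm compmI.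
pose KM : alg_mod := AlgMod a_lin a_mul a_one.
have [i' i'E] : exists i' : hom alg_mod_cat N KM, smval i' = i.
  by apply: alg_mod_homI => x; rewrite -aE.
by exists KM, i'; rewrite i'E.
Qed.

Lemma is_kernel_alg_mod (K M N : alg_mod_cat) (i : hom alg_mod_cat K M)
    (f : hom alg_mod_cat M N) : is_kernel (smval i) (smval f) -> is_kernel i f.
Proof.
move=> ki; apply: is_kernelI.
- by apply: smval_inj; exact: (proj1 ki).
- by move=> W u v /(congr1 (@smval _ _ _)) /(kernel_mono ki) e; apply: smval_inj.
- move=> W g /(congr1 (@smval _ _ _)) /(kernel_lift ki)[h ih].
  have [h' h'E] : exists h' : hom alg_mod_cat W K, smval h' = h.
    apply: alg_mod_homI => x; apply: (kernel_mono ki).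
    by rewrite [LHS]compA ih alg_mod_homP [RHS]compA alg_mod_homP -[RHS]compA ih.
  by exists h'; apply: smval_inj; rewrite /= h'E.
Qed.

Lemma is_cokernel_alg_mod (K M N : alg_mod_cat) (p : hom alg_mod_cat N K)
    (f : hom alg_mod_cat M N) : is_cokernel (smval p) (smval f) -> is_cokernel p f.
Proof.
move=> kp; apply: is_cokernelI.
- by apply: smval_inj; exact: (proj1 kp).
- by move=> W u v /(congr1 (@smval _ _ _)) /(cokernel_epi kp) e; apply: smval_inj.
- move=> W g /(congr1 (@smval _ _ _)) /(cokernel_desc kp)[h hp].
  have [h' h'E] : exists h' : hom alg_mod_cat K W, smval h' = h.
    apply: alg_mod_homI => x; apply: (cokernel_epi kp).
    by rewrite -[LHS]compA -alg_mod_homP [LHS]compA hp -[RHS]compA hp alg_mod_homP.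
  by exists h'; apply: smval_inj; rewrite /= h'E.
Qed.

(** Any cokernel of modules is isomorphic to the one carried by a cokernel in [C], so forgetting the
    action preserves cokernels. *)
Lemma cokernel_smval (K M N : alg_mod_cat) (p : hom alg_mod_cat N K)
    (f : hom alg_mod_cat M N) : is_cokernel p f -> is_cokernel (smval p) (smval f).
Proof.
move=> cp; have [Q [q cq]] := alg_mod_cokernel f.
have cq' := is_cokernel_alg_mod cq.
have [u uq] := cokernel_desc cp (proj1 cq'); have [v vp] := cokernel_desc cq' (proj1 cp).
have uv : u \c v = idm Q by apply: (cokernel_epi cq'); rewrite -compA vp uq compIm.
have vu : v \c u = idm K by apply: (cokernel_epi cp); rewrite -compA uq vp compIm.
have vE : smval v \c smval q = smval p by rewrite -vp.
have uE : smval u \c smval p = smval q by rewrite -uq.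
apply: is_cokernelI.
- by rewrite -vE -compA (proj1 cq) comp0r.
- rewrite -vE; apply: epi_comp; last exact: cokernel_epi cq.
  apply: is_iso_epi; exists (smval u).
  by split; [move/(congr1 (@smval _ _ _)): uv | move/(congr1 (@smval _ _ _)): vu].
- move=> W g /(cokernel_desc cq)[h hq]; exists (h \c smval u).
  by rewrite -compA uE.
Qed.

Lemma alg_mod_abelian : abelian alg_mod_cat.
Proof.
have mono_smval (M N : alg_mod_cat) (f : hom alg_mod_cat M N) : mono f -> mono (smval f).
  move=> mf; have [K [i ki]] := alg_mod_kernel f.
  have i0 : i = 0.
    by apply: (mono_eq0 mf); apply: smval_inj; exact: (proj1 ki).
  apply: mono0 => Z g /(kernel_lift ki)[h <-].
  by rewrite i0 smval_zero comp0l.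
have epi_smval (M N : alg_mod_cat) (f : hom alg_mod_cat M N) : epi f -> epi (smval f).
  move=> mf; have [K [i ki]] := alg_mod_cokernel f.
  have i0 : i = 0.
    by apply: (epi_eq0 mf); apply: smval_inj; exact: (proj1 ki).
  apply: epi0 => Z g /(cokernel_desc ki)[h <-].
  by rewrite i0 smval_zero comp0r.
split.
- have [Z zZ] := ab_zero ab.
  have h1 : linear (fun x : H => 0 : hom C Z Z) by move=> a x y; rewrite scaler0 addr0.
  have h2 (x y : H) : (0 : hom C Z Z) = (0 : hom C Z Z) \c (0 : hom C Z Z) by rewrite comp0l.
  exists (@AlgMod Z (fun _ => 0) h1 h2 (esym zZ)).
  by apply: smval_inj; exact: zZ.
- move=> X Y; have [S [e [p [pe pe0 ep]]]] := ab_sum ab (am_car X) (am_car Y).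
  have pett : p true \c e true = idm (am_car X) := pe true.
  have peff : p false \c e false = idm (am_car Y) := pe false.
  have petf : p true \c e false = 0 := pe0 false true (ltac:(by [])).
  have peft : p false \c e true = 0 := pe0 true false (ltac:(by [])).
  have epE : e true \c p true + e false \c p false = idm S.
    by rewrite -ep (bigD1 true) //=; congr (_ + _); rewrite (big_pred1 false) // => -[].
  pose a x : hom C S S := e true \c am_act X x \c p true + e false \c am_act Y x \c p false.
  have a_lin : linear a.
    move=> c x y; rewrite /a !am_lin !comp_linr !comp_linl scalerDr.
    by rewrite addrACA.
  have ae1 x : a x \c e true = e true \c am_act X x.
    by rewrite /a compDl -!compA pett peft !comp0r addr0 compmI.
  have ae2 x : a x \c e false = e false \c am_act Y x.
    by rewrite /a compDl -!compA peff petf !comp0r add0r compmI.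
  have pa1 x : p true \c a x = am_act X x \c p true.
    by rewrite /a compDr !compA pett petf !comp0l addr0 compIm.
  have pa2 x : p false \c a x = am_act Y x \c p false.
    by rewrite /a compDr !compA peff peft !comp0l add0r compIm.
  have a_mul x y : a (x * y) = a x \c a y.
    by rewrite [a y]/a compDr !compA ae1 ae2 /a !am_mul -!compA.
  have a_one : a 1 = idm S by rewrite /a !am_one !compmI epE.
  pose SM : alg_mod := AlgMod a_lin a_mul a_one.
  have [e1 e1E] : exists e' : hom alg_mod_cat X SM, smval e' = e true.
    by apply: alg_mod_homI => x; rewrite -ae1.
  have [e2 e2E] : exists e' : hom alg_mod_cat Y SM, smval e' = e false.
    by apply: alg_mod_homI => x; rewrite -ae2.
  have [p1 p1E] : exists e' : hom alg_mod_cat SM X, smval e' = p true.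
    by apply: alg_mod_homI => x; rewrite -pa1.
  have [p2 p2E] : exists e' : hom alg_mod_cat SM Y, smval e' = p false.
    by apply: alg_mod_homI => x; rewrite -pa2.
  exists SM.
  exists (fun b => if b as b return hom alg_mod_cat (if b then X else Y) SM then e1 else e2).
  exists (fun b => if b as b return hom alg_mod_cat SM (if b then X else Y) then p1 else p2).
  split.
  + by case; apply: smval_inj; rewrite /= ?e1E ?e2E ?p1E ?p2E.
  + by case; case=> // _; apply: smval_inj; rewrite /= ?e1E ?e2E ?p1E ?p2E.
  + rewrite (bigD1 true) //= (big_pred1 false) => [|[] //].
    by apply: smval_inj; rewrite /= e1E e2E p1E p2E.
- move=> X Y f; have [K [i ki]] := alg_mod_kernel f.
  by exists K, i; exact: is_kernel_alg_mod.
- move=> X Y f; have [K [i ki]] := alg_mod_cokernel f.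
  by exists K, i; exact: is_cokernel_alg_mod.
- move=> X Y f /mono_smval mf; have [K [p kp]] := alg_mod_cokernel f.
  by exists K, p; apply: is_kernel_alg_mod; exact: mono_kernel_coker.
- move=> X Y f /epi_smval mf; have [K [i ki]] := alg_mod_kernel f.
  by exists K, i; apply: is_cokernel_alg_mod; exact: epi_coker_kernel.
Qed.

End AlgebraModules.

(** * The Deligne product *)

Section DeligneProduct.
Variables (k : fieldType) (H : falgType k) (C : lincat k).
Hypothesis ab : abelian C.

Local Notation elt := (pow_elt ab).
Local Notation D := (alg_mod_cat H C).
Local Notation Hreg := (reg_hmod H : hmod_cat H).
Local Notation hbasis := (vbasis (@fullv k H)).
Local Notation eval v := (hmod_eval v : hom (hmod_cat H) (reg_hmod H) _).

Definition box_act (V : hmod H) (X : C) (x : H) : hom C (pow ab (hm_dim V) X) (pow ab (hm_dim V) X) :=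
  pow_map ab (hm_act x) (idm X).

Lemma box_act_elt (V : hmod H) X x (v : 'cV_(hm_dim V)) :
  box_act V X x \c elt X v = elt X (hm_act x v).
Proof. by rewrite pow_map_elt ?compmI //; exact: hm_linr. Qed.

Program Definition box_ob (V : hmod H) (X : C) : alg_mod H C :=
  @AlgMod k H C (pow ab (hm_dim V) X) (box_act V X) _ _ _.
Next Obligation.
move=> V X a x y; apply: pow_elt_ext => v.
by rewrite comp_linl !box_act_elt hm_linl pow_elt_lin.
Qed.
Next Obligation.
by move=> V X x y; apply: pow_elt_ext => v; rewrite -compA !box_act_elt hm_mul.
Qed.
Next Obligation.
by move=> V X; apply: pow_elt_ext => v; rewrite box_act_elt hm_one compIm.
Qed.

Program Definition box_map (V V' : hmod_cat H) (X X' : C) (f : hom (hmod_cat H) V V')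
    (g : hom C X X') : hom D (box_ob V X) (box_ob V' X') :=
  @Sublmod _ _ (alg_mod_homs (box_ob V X) (box_ob V' X')) (pow_map ab (smval f) g) _.
Next Obligation.
move=> V V' X X' f g x; apply: pow_elt_ext => v /=.
rewrite -[LHS]compA box_act_elt -[RHS]compA !(pow_map_elt _ _ _ (hmod_hom_lin f)).
by rewrite hmod_homP [RHS]compA box_act_elt.
Qed.

Lemma box_map_elt (V V' : hmod_cat H) (X X' : C) (f : hom (hmod_cat H) V V')
    (g : hom C X X') (v : 'cV_(hm_dim V)) :
  smval (box_map f g) \c elt X v = elt X' (smval f v) \c g.
Proof. by rewrite pow_map_elt //; exact: hmod_hom_lin. Qed.

Lemma box_ext (V : hmod_cat H) (X : C) (M : D) (f g : hom D (box_ob V X) M) :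
  (forall v, smval f \c elt X v = smval g \c elt X v) -> f = g.
Proof. by move=> e; apply: smval_inj; exact: pow_elt_ext. Qed.

Program Definition box : bifunctor (hmod_cat H) C D :=
  @Bifunctor k (hmod_cat H) C D box_ob box_map _ _ _ _.
Next Obligation.
move=> V V' X X' g a f f'; apply: box_ext => v.
rewrite smval_lin_comb.
rewrite comp_linl !box_map_elt -compZl -(linZ (@pow_elt_lin _ _ ab _ _)) -compDl.
rewrite -(linD (@pow_elt_lin _ _ ab _ _)); congr (elt _ _ \c _).
by rewrite /= lfunE /= lfunE.
Qed.
Next Obligation.
move=> V V' X X' f a g g'; apply: box_ext => v.
rewrite smval_lin_comb.
by rewrite comp_linl !box_map_elt comp_linr.
Qed.
Next Obligation.
move=> V X; apply: box_ext => v; rewrite box_map_elt /= lfunE /= compIm compmI.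
by [].
Qed.
Next Obligation.
move=> V V' V'' X X' X'' f' f g' g; apply: box_ext => v.
rewrite box_map_elt smval_comp.
by rewrite -[RHS]compA box_map_elt [RHS]compA box_map_elt /= comp_lfunE compA.
Qed.

(** [H] acts on maps into [M] by composition; coordinates are needed because the objects of
    [hmod_cat] live on column spaces. *)
Lemma hom_hmod (X : C) (M : D) : fin_dim (hom C X M) ->
  exists (W : hmod H) (r : hom C X M -> 'cV[k]_(hm_dim W)) (r' : 'cV[k]_(hm_dim W) -> hom C X M),
    [/\ linear r', cancel r r', cancel r' r &
      forall x w, r' (hm_act x w) = am_act M x \c r' w].
Proof.
move=> [n [[r0 r0_lin [r0' r0K r0'K]]]].
pose r (u : hom C X M) : 'cV[k]_n := (r0 u)^T.
pose r' (w : 'cV[k]_n) : hom C X M := r0' w^T.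
have rK : cancel r r' by move=> u; rewrite /r' /r trmxK r0K.
have r'K : cancel r' r by move=> u; rewrite /r' /r r0'K trmxK.
have r_lin : linear r by move=> a u v; rewrite /r r0_lin linearP.
have r'_lin : linear r'.
  by move=> a u v; apply: (can_inj rK); rewrite r_lin !r'K.
pose act x w := r (am_act M x \c r' w).
have h1 w : linear (act^~ w) by move=> a x y; rewrite /act am_lin comp_linl r_lin.
have h2 x : linear (act x) by move=> a u v; rewrite /act r'_lin comp_linr r_lin.
have h3 x y v : act (x * y) v = act x (act y v).
  by rewrite /act rK am_mul compA.
have h4 v : act 1 v = v by rewrite /act am_one compIm r'K.
by exists (HMod h1 h2 h3 h4), r, r'; split=> // x w; rewrite /= /act rK.
Qed.

(** In the first variable, maps from [box V X] to [M] are the [H]-linear maps from [V] to the module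
    of maps [X -> M], so [box - X] behaves as a left adjoint. In the second variable, a power of a
    cokernel is a cokernel. *)
Lemma box_right_exact : fin_dim_homs C -> right_exact2 box.
Proof.
move=> fd; split=> [X V1 V2 V3 q f cq|V X1 X2 X3 q f cq].
- have curry (V : hmod_cat H) (M : D) (g : hom D (box_ob V X) M) :
      forall x v, smval g \c elt X (hm_act x v) = am_act M x \c (smval g \c elt X v).
    move=> x v; rewrite -box_act_elt [LHS]compA [RHS]compA; congr (_ \c _).
    exact: (alg_mod_homP g).
  apply: is_cokernelI.
  + by rewrite -bmap_compl (proj1 cq) bmap0l.
  + move=> M g g' gg'; have [W [r [r' [r'_lin rK r'K r'act]]]] := hom_hmod (fd X (am_car M)).
    have r_lin : linear r by move=> a u v; apply: (can_inj r'K); rewrite r'_lin !rK.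
    have toH (g0 : hom D (box_ob V3 X) M) : exists h : hmod_hom V3 W,
        forall v, smval h v = r (smval g0 \c elt X v).
      apply: hmod_hom_of => [a u v|x v]; first by rewrite pow_elt_lin comp_linr r_lin.
      by apply: (can_inj r'K); rewrite rK curry r'act rK.
    have [h hE] := toH g; have [h' h'E] := toH g'.
    have hh' : h = h'.
      apply: (cokernel_epi cq); apply: hmod_ext => v; rewrite /= !comp_lfunE /= hE h'E.
      congr r; move/(congr1 (fun u => smval u \c elt X v)): gg'.
      by rewrite !smval_comp -!compA box_map_elt compmI.
    apply: box_ext => v; apply: (can_inj rK); by rewrite -hE hh' h'E.
  + move=> M g gf; have [W [r [r' [r'_lin rK r'K r'act]]]] := hom_hmod (fd X (am_car M)).
    have r_lin : linear r by move=> a u v; apply: (can_inj r'K); rewrite r'_lin !rK.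
    have [h hE] : exists h : hmod_hom V2 W, forall v, smval h v = r (smval g \c elt X v).
      apply: hmod_hom_of => [a u v|x v]; first by rewrite pow_elt_lin comp_linr r_lin.
      by apply: (can_inj r'K); rewrite rK curry r'act rK.
    have hf : (h : hom (hmod_cat H) _ _) \c f = 0.
      apply: hmod_ext => v; rewrite /= comp_lfunE hE lfunE /= -[RHS](lin0 r_lin).
      congr r; move/(congr1 (fun u => smval u \c elt X v)): gf.
      by rewrite smval_comp -compA box_map_elt compmI smval_zero comp0l.
    have [h' h'q] := cokernel_desc cq hf.
    have h'E v : smval h' (smval q v) = smval h v by rewrite -h'q /= comp_lfunE.
    have [g' g'E] : exists g' : hom C (pow ab (hm_dim V3) X) M, forall v, g' \c elt X v = r' (smval h' v).
      by apply: pow_desc => a u v; rewrite (hmod_hom_lin h') r'_lin.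
    have [g2 g2E] : exists g2 : hom D (box_ob V3 X) M, smval g2 = g'.
      apply: alg_mod_homI => x; apply: pow_elt_ext => v.
      by rewrite -[LHS]compA box_act_elt -[RHS]compA !g'E hmod_homP r'act.
    exists g2; apply: box_ext => v; rewrite -[LHS]compA box_map_elt compmI g2E g'E.
    by rewrite h'E hE rK.
- have ef : epi (smval (bmap box (idm V) q)).
    move=> W u v uv; apply: pow_elt_ext => w; apply: (cokernel_epi cq).
    have := congr1 (fun h => h \c elt X2 w) uv.
    by rewrite -!compA box_map_elt /= lfunE.
  apply: is_cokernel_alg_mod; apply: is_cokernelI => //.
  + apply: pow_elt_ext => w; rewrite -compA !box_map_elt comp0l compA box_map_elt.
    by rewrite -compA (proj1 cq) comp0r.
  + move=> W g gf.
    have h i : exists u, u \c q = g \c pow_in ab X2 i.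
      apply: (cokernel_desc cq); have := congr1 (fun h => h \c elt X1 (delta_mx i 0)) gf.
      by rewrite -!compA box_map_elt /= lfunE /= comp0l pow_elt_delta.
    have [u uE] := choice h.
    exists (\sum_i u i \c pow_out ab X3 i); apply: pow_in_ext => i.
    have sumE : (\sum_j u j \c pow_out ab X3 j) \c pow_in ab X3 i = u i.
      exact: (biproduct_sum u (pow_biproduct ab _ X3) i).
    by rewrite -compA -pow_elt_delta box_map_elt /= lfunE /= pow_elt_delta compA sumE uE
      pow_elt_delta.
Qed.

(* The joint cokernel of the maps [b (r_h) 1 - b 1 (tau_h)] is [H (x)_H M], computed in the
   target of [b]; by linearity it suffices to let [h] run through a basis. *)
Section Balanced.
Variables (E : lincat k) (b : bifunctor (hmod_cat H) C E).

Definition balanced_rel (M : D) (x : H) : hom E (b Hreg M) (b Hreg M) :=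
  bmap b (rmul x) (idm (am_car M)) - bmap b (idm Hreg) (am_act M x).

Lemma balanced_rel_lin (M : D) : linear (balanced_rel M).
Proof.
move=> a x y; rewrite /balanced_rel rmul_lin am_lin bmap_linl bmap_linr.
by rewrite scalerBr opprD addrACA.
Qed.

Lemma balanced_basis (M : D) W (g : hom E (b Hreg M) W) :
  (forall i : 'I_(\dim (@fullv k H)), g \c balanced_rel M hbasis`_i = 0) ->
  forall x, g \c balanced_rel M x = 0.
Proof.
move=> h; apply: linear_basis_eq0 => // a x y.
by rewrite balanced_rel_lin comp_linr.
Qed.

Lemma balancedP (M : D) W (g : hom E (b Hreg M) W) x : g \c balanced_rel M x = 0 ->
  g \c bmap b (rmul x) (idm (am_car M)) = g \c bmap b (idm Hreg) (am_act M x).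
Proof. by rewrite compBr => /eqP; rewrite subr_eq0 => /eqP. Qed.

(** The action map from [H (x) V (x) X] to [V (x) X], spelled out in a basis of [V] so that it makes
    sense for any bifunctor [b]; [box_proj_elt] characterizes it without the basis. *)
Definition box_proj (V : hmod_cat H) (X : C) : hom E (b Hreg (box_ob V X : C)) (b V X) :=
  \sum_i bmap b (eval (delta_mx i 0 : 'cV_(hm_dim V))) (pow_out ab X i).

Lemma box_proj_elt V X v :
  box_proj V X \c bmap b (idm Hreg) (elt X v) = bmap b (eval v) (idm X).
Proof.
rewrite comp_suml [in RHS](col_delta_sum v) (lin_sum _ (@hmod_eval_lin _ _ V)) bmap_suml.
apply: eq_bigr => i _; rewrite -bmap_comp compmI pow_out_elt.
by rewrite (linZ (@hmod_eval_lin _ _ V)) (linZ (bmap_linl b _)) (linZ (bmap_linr b _)).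
Qed.

Lemma b_elt_ext V X Y Z (g g' : hom E (b Z (box_ob V X : C)) Y) :
  (forall v, g \c bmap b (idm Z) (elt X v) = g' \c bmap b (idm Z) (elt X v)) -> g = g'.
Proof.
move=> gg'; have [_ _ ep] := pow_biproduct ab (hm_dim V) X.
rewrite -[g]compmI -[g']compmI -(bmap_id b) -ep bmap_sumr !comp_sumr.
by apply: eq_bigr => i _; rewrite bmap_compr !compA -pow_elt_delta gg'.
Qed.

Lemma box_proj_nat V V' X X' (f : hom (hmod_cat H) V V') (g : hom C X X') :
  box_proj V' X' \c bmap b (idm Hreg) (smval (box_map f g)) = bmap b f g \c box_proj V X.
Proof.
apply: b_elt_ext => v; rewrite -!compA box_proj_elt -bmap_compr box_map_elt bmap_compr compA.
by rewrite box_proj_elt -!bmap_comp compIm !compmI comp_hmod_eval.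
Qed.

End Balanced.

Lemma box_ess_surj (E : lincat k) (abE : abelian E) (b : bifunctor (hmod_cat H) C E) :
  right_exact2 b ->
  exists G : functor D E, right_exact G /\ binat_isomorphic (comp_bifunctor G box) b.
Proof.
move=> [b_rexl b_rexr].
have ex_coker (M : D) : exists (Q : E) (q : hom E (b Hreg M) Q),
    [/\ forall x, q \c balanced_rel b M x = 0, epi q &
      forall W (g : hom E (b Hreg M) W), (forall x, g \c balanced_rel b M x = 0) ->
        exists h, h \c q = g].
  have [Q [q [q0 eq_ dq]]] := joint_cokernel abE (fun i : 'I_(\dim (@fullv k H)) => balanced_rel b M hbasis`_i).
  exists Q, q; split=> //; first exact: balanced_basis.
  by move=> W g hg; apply: dq => i; exact: hg.
have [G0 hG0] := choice ex_coker.
have [q q0 [qepi qdesc]] : exists2 q : forall M : D, hom E (b Hreg M) (G0 M),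
    forall (M : D) x, q M \c balanced_rel b M x = 0 & (forall M, epi (q M)) /\
      forall (M : D) W (g : hom E (b Hreg M) W), (forall x, g \c balanced_rel b M x = 0) ->
        exists h, h \c q M = g.
  exists (fun M => projT1 (cid (hG0 M))).
    by move=> M; have [h _ _] := projT2 (cid (hG0 M)).
  by split=> M; have [_ h h'] := projT2 (cid (hG0 M)).
have rel_nat (M N : D) (f : hom D M N) x : balanced_rel b N x \c bmap b (idm Hreg) (smval f)
    = bmap b (idm Hreg) (smval f) \c balanced_rel b M x.
  rewrite /balanced_rel compBl compBr -!bmap_comp !compIm !compmI.
  by rewrite (alg_mod_homP f).
have exG (M N : D) (f : hom D M N) : exists u : hom E (G0 M) (G0 N),
    u \c q M = q N \c bmap b (idm Hreg) (smval f).
  by apply: qdesc => x; rewrite -compA -rel_nat compA q0 comp0l.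
pose G1 M N f := projT1 (cid (exG M N f)).
have G1E M N f : G1 M N f \c q M = q N \c bmap b (idm Hreg) (smval f).
  exact: projT2 (cid (exG M N f)).
have G1_lin M N : linear (G1 M N).
  move=> a f g; apply: qepi.
  by rewrite G1E smval_lin_comb bmap_linr comp_linr comp_linl !G1E.
have G1_id M : G1 M M (idm M) = idm (G0 M).
  by apply: qepi; rewrite G1E compIm /= bmap_id compmI.
have G1_comp M N P (g : hom D N P) (f : hom D M N) : G1 M P (g \c f) = G1 N P g \c G1 M N f.
  by apply: qepi; rewrite G1E smval_comp bmap_compr compA -G1E -[LHS]compA -G1E compA.
pose G : functor D E := Functor G1_lin G1_id G1_comp.
exists G; split.
  move=> M1 M2 M3 p f cp; have cbp := b_rexr Hreg _ _ _ _ _ (cokernel_smval ab cp).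
  apply: is_cokernelI.
  - by rewrite -fmap_comp (proj1 cp) fmap0.
  - apply: (epi_compl (f := q M2)); rewrite G1E.
    by apply: epi_comp => //; exact: cokernel_epi cbp.
  - move=> W g gf.
    (* Descend [g] first to [b Hreg M3]; the result is balanced because this can be tested on the
       epi from [b Hreg M2]. *)
    have [|u uE] := cokernel_desc (g := g \c q M2) cbp.
      by rewrite -compA -G1E compA [g \c _]gf comp0l.
    have [x|g' g'E] := qdesc M3 W u.
      apply: (cokernel_epi cbp); rewrite comp0l -compA rel_nat compA uE -compA q0.
      by rewrite comp0r.
    by exists g'; apply: qepi; rewrite -compA G1E compA g'E.
have ex_c V X : exists c : hom E (G0 (box_ob V X)) (b V X), c \c q (box_ob V X) = box_proj b V X.
  apply: qdesc => x; rewrite compBr; apply/eqP; rewrite subr_eq0; apply/eqP.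
  apply: b_elt_ext => v; rewrite -!compA bmap_lr -bmap_compr box_act_elt box_proj_elt.
  by rewrite -bmap_rl compA box_proj_elt -bmap_compl hmod_eval_rmul.
pose c V X := projT1 (cid (ex_c V X)).
have cE V X : c V X \c q (box_ob V X) = box_proj b V X := projT2 (cid (ex_c V X)).
exists c; split=> [V V' X X' f g|V X].
  apply: qepi; rewrite /= -[LHS]compA.
  apply: etrans (congr1 (comp (c V' X')) (G1E _ _ (box_map f g))) _.
  by rewrite [LHS]compA cE box_proj_nat -[RHS]compA cE.
(* The inverse of [c] is defined on [b V X] through the presentation of [V] by regular modules: [v]
   is sent to the insertion of [v] followed by [q], and the balancing relation is the compatibility
   required. *)
have rexX : right_exact (bfix_r b X) by move=> V1 V2 V3 p f; exact: b_rexl.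
have [uniq_d ex_d] := right_exact_hmod_desc V rexX.
have [||d dE] := ex_d (G0 (box_ob V X)) (fun v => q (box_ob V X) \c bmap b (idm Hreg) (elt X v)).
- by move=> a u v; rewrite pow_elt_lin bmap_linr comp_linr.
- move=> x v /=; rewrite -compA bmap_rl -bmap_lr compA.
  apply: etrans (congr1 (fun h => h \c _) (balancedP (q0 (box_ob V X) x))) _.
  by rewrite -compA -bmap_compr box_act_elt.
rewrite /= in dE uniq_d.
have d_proj : d \c box_proj b V X = q (box_ob V X).
  apply: b_elt_ext => v; rewrite -compA box_proj_elt dE.
  by [].
exists d; split.
- by apply: qepi; rewrite -compA cE d_proj compIm.
- by apply: uniq_d => v; rewrite -compA dE compA cE box_proj_elt compIm.
Qed.

(** * Every module in [C] as a quotient of a free one *)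

Lemma ex_free_action (M : D) : exists p : hom D (box_ob Hreg M) M,
  forall v, smval p \c elt M v = am_act M (col_alg v).
Proof.
have [p pE] : exists p : hom C (pow ab (hm_dim Hreg) M) M,
    forall v, p \c elt M v = am_act M (col_alg v).
  by apply: pow_desc => a u v; rewrite col_alg_lin am_lin.
have [p' p'E] : exists p' : hom D (box_ob Hreg M) M, smval p' = p.
  apply: alg_mod_homI => x; apply: pow_elt_ext => v.
  by rewrite -[LHS]compA box_act_elt -[RHS]compA !pE /= alg_colK am_mul.
by exists p'; rewrite p'E.
Qed.

Definition free_action (M : D) : hom D (box_ob Hreg M) M := projT1 (cid (ex_free_action M)).

Lemma free_action_elt (M : D) v : smval (free_action M) \c elt M v = am_act M (col_alg v).
Proof. exact: projT2 (cid (ex_free_action M)) v. Qed.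

Lemma free_action_nat (M N : D) (f : hom D M N) :
  f \c free_action M = free_action N \c bmap box (idm Hreg) (smval f).
Proof.
apply: box_ext => v; rewrite !smval_comp -[LHS]compA -[RHS]compA box_map_elt !free_action_elt.
by rewrite alg_mod_homP [RHS]compA free_action_elt /= lfunE.
Qed.

Lemma free_action_proj (V : hmod_cat H) (X : C) : free_action (box_ob V X) = box_proj box V X.
Proof.
apply: box_ext => c; rewrite free_action_elt; apply: pow_elt_ext => v.
have e : smval (box_proj box V X) \c (smval (box_map (idm Hreg) (elt X v)) \c elt X c)
    = smval (box_map (eval v) (idm X)) \c elt X c.
  exact: etrans (compA _ _ _) (congr1 (fun h : hom D (box_ob Hreg X) (box_ob V X) =>
    smval h \c elt X c) (@box_proj_elt D box V X v)).
rewrite !box_map_elt lfunE hmod_evalE compmI in e.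
by rewrite -[RHS]compA e box_act_elt.
Qed.

Lemma free_action_epi (M : D) : epi (smval (free_action M)).
Proof.
apply: (epi_compl (f := elt M (alg_col 1))).
by rewrite free_action_elt alg_colK am_one => W u v; rewrite !compmI.
Qed.

Lemma free_action_rel (M : D) x : free_action M \c balanced_rel box M x = 0.
Proof.
rewrite compBr; apply/eqP; rewrite subr_eq0; apply/eqP.
apply: box_ext => v; rewrite !smval_comp -!compA !box_map_elt !compA !free_action_elt compmI.
by rewrite /rmul hmod_evalE /= lfunE !alg_colK am_mul.
Qed.

Lemma free_action_desc (M W : D) (g : hom D (box_ob Hreg M) W) :
  (forall x, g \c balanced_rel box M x = 0) -> exists h, h \c free_action M = g.
Proof.
(* A map out of [H (x) M] that is balanced is determined by its restriction to the unit of [H]. *)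
move=> hg; pose h := smval g \c elt M (alg_col 1).
have hE : h \c smval (free_action M) = smval g.
  apply: pow_elt_ext => v; rewrite -[LHS]compA free_action_elt /h -[LHS]compA.
  have e : smval g \c (smval (box_map (rmul (col_alg v)) (idm (am_car M))) \c elt M (alg_col 1))
      = smval g \c (smval (box_map (idm Hreg) (am_act M (col_alg v))) \c elt M (alg_col 1)).
    rewrite [LHS]compA [RHS]compA.
    have e := @balancedP D box M W g _ (hg (col_alg v)).
    exact: (congr1 (fun u : alg_mod_hom (box_ob Hreg M) W => smval u \c elt M (alg_col 1)) e).
  rewrite !box_map_elt lfunE /= in e; rewrite -e compmI; congr (_ \c elt _ _).
  by rewrite /rmul hmod_evalE /= !alg_colK mul1r col_algK.
have [h' h'E] : exists h' : hom D M W, smval h' = h.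
  apply: alg_mod_homI => x; apply: free_action_epi.
  by rewrite -[LHS]compA -alg_mod_homP [LHS]compA hE -[RHS]compA hE alg_mod_homP.
by exists h'; apply: smval_inj; rewrite smval_comp h'E.
Qed.

(** The relations are indexed by all of [H]; a basis reduces them to one map [F] out of a finite
    direct sum, whose cokernel [G] preserves. *)
Lemma right_exact_free_action (E : lincat k) (G : functor D E) (M : D) : right_exact G ->
  epi (fmap G (free_action M)) /\
  forall W (g : hom E (G (box_ob Hreg M)) W),
    (forall x, g \c fmap G (balanced_rel box M x : hom D (box_ob Hreg M) (box_ob Hreg M)) = 0) ->
    exists h, h \c fmap G (free_action M) = g.
Proof.
move=> G_rex; have abD := alg_mod_abelian H ab.
set d := \dim (@fullv k H).
have [S [e [p bp]]] := direct_sum_ord (ab_zero abD) (ab_sum abD) d (box_ob Hreg M).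
pose f (i : 'I_d) : hom D (box_ob Hreg M) (box_ob Hreg M) := balanced_rel box M hbasis`_i.
pose F := \sum_i f i \c p i.
have Fe i : F \c e i = f i := biproduct_sum f bp i.
have cF : is_cokernel (free_action M) F.
  apply: is_cokernelI.
  - by apply/(comp_sum_eq0 _ (erefl F) Fe) => i; exact: free_action_rel.
  - move=> W u v /(congr1 (fun h : alg_mod_hom _ _ => smval h)).
    by rewrite !smval_comp => /free_action_epi e'; apply: smval_inj.
  - move=> W g /(comp_sum_eq0 g (erefl F) Fe) gf; apply: free_action_desc.
    exact: (@balanced_basis D box M W g).
have cGF := G_rex _ _ _ _ _ cF; split=> [|W g hg]; first exact: cokernel_epi cGF.
apply: (cokernel_desc cGF); rewrite fmap_sum comp_sumr big1 // => i _.
by rewrite fmap_comp compA [g \c _]hg comp0l.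
Qed.

Lemma box_full_faithful (E : lincat k) (G G' : functor D E) : right_exact G -> right_exact G' ->
  forall a : forall V X, hom E (G (box V X)) (G' (box V X)),
  @binatural _ _ _ _ (comp_bifunctor G box) (comp_bifunctor G' box) a ->
  exists! b : forall Z, hom E (G Z) (G' Z), natural b /\ forall V X, b (box V X) = a V X.
Proof.
move=> rG rG' a na.
(* Naturality of [a], applied to the two maps in the relation, carries the relation from [G] to
   [G'], where [free_action] kills it. *)
have ex_b (Z : D) : exists b : hom E (G Z) (G' Z),
    b \c fmap G (free_action Z) = fmap G' (free_action Z) \c a Hreg Z.
  apply: (right_exact_free_action Z rG).2 => x.
  rewrite fmapB -compA compBr [a _ _ \c _]na [X in _ \c (_ - X)]na -compBl -fmapB.
  by rewrite compA -fmap_comp free_action_rel fmap0 comp0l.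
pose b Z := projT1 (cid (ex_b Z)).
have bE Z : b Z \c fmap G (free_action Z) = fmap G' (free_action Z) \c a Hreg Z.
  exact: projT2 (cid (ex_b Z)).
exists b; split; first split.
- move=> Y Z f; apply: (right_exact_free_action Y rG).1.
  rewrite -[LHS]compA -fmap_comp free_action_nat fmap_comp [LHS]compA bE -[LHS]compA.
  rewrite [a _ _ \c _]na [LHS]compA -fmap_comp -free_action_nat fmap_comp -[LHS]compA -bE.
  by rewrite compA.
- move=> V X; apply: (right_exact_free_action (box_ob V X) rG).1.
  rewrite bE free_action_proj !fmap_sum comp_suml comp_sumr.
  by apply: eq_bigr => i _; rewrite [a _ _ \c _]na.
- move=> b' [nb' b'a]; apply: functional_extensionality_dep => Z.
  apply: (right_exact_free_action Z rG).1; rewrite bE -b'a.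
  by rewrite [RHS]nb'.
Qed.

Lemma box_deligne : fin_dim_homs C -> is_deligne_product box.
Proof.
move=> fd; split.
- exact: alg_mod_abelian.
- exact: box_right_exact.
- by move=> E abE F; exact: box_ess_surj.
- by move=> E _ G G' rG rG' a; exact: box_full_faithful.
Qed.

End DeligneProduct.

(** * The antipode *)

Section TensorLift.
Variable k : fieldType.

Lemma ptens_linl (V W : vectType k) (w : W) : linear (fun v : V => ptens v w).
Proof.
move=> a u v; apply/matrixP => i j; rewrite !mxE linearP mulrDl; congr (_ + _).
exact: esym (mulrA _ _ _).
Qed.

Lemma tlift_lin (V W : vectType k) (Z : lmodType k) (f : V -> W -> Z) : linear (tlift f).
Proof.
move=> a s t; rewrite /tlift scaler_sumr -big_split; apply: eq_bigr => i _ /=.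
rewrite scaler_sumr -big_split; apply: eq_bigr => j _ /=.
by rewrite !mxE scalerDl scalerA.
Qed.

Lemma ptens_linr (V W : vectType k) (v : V) : linear (fun w : W => ptens v w).
Proof.
move=> a u w; apply/matrixP => i j; rewrite !mxE linearP mulrDr; congr (_ + _).
exact: mulrCA.
Qed.

Lemma tlift_param_lin (U : lmodType k) (V W : vectType k) (Z : lmodType k)
    (F : U -> V -> W -> Z) t :
  (forall v w, linear (fun x => F x v w)) -> linear (fun x => tlift (F x) t).
Proof.
move=> F_lin a x y; rewrite /tlift scaler_sumr -big_split; apply: eq_bigr => i _ /=.
rewrite scaler_sumr -big_split; apply: eq_bigr => j _ /=.
by rewrite F_lin scalerDr !scalerA mulrC.
Qed.

Lemma tlift_ptens (V W : vectType k) (Z : lmodType k) (f : V -> W -> Z) v w :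
  (forall w, linear (f^~ w)) -> (forall v, linear (f v)) -> tlift f (ptens v w) = f v w.
Proof.
move=> fl fr; rewrite [in RHS](coord_vbasis (memvf v)) (lin_sum _ (fl w)).
apply: eq_bigr => i _; rewrite (linZ (fl w)) [in RHS](coord_vbasis (memvf w)).
rewrite (lin_sum _ (fr _)) scaler_sumr; apply: eq_bigr => j _.
by rewrite mxE (linZ (fr _)) scalerA.
Qed.

End TensorLift.

(** * Bijectivity of the antipode from a spanning matrix of coefficients *)

Section Antipode.
Variables (k : fieldType) (H : hopf_algebra k) (n : nat) (t : 'I_n -> 'I_n -> H).
Hypothesis comul_t : forall i l, comul (t i l) = \sum_j ptens (t j l) (t i j).
Hypothesis counit_t : forall i l, counit (t i l) = (i == l)%:R.
Hypothesis t_span : forall (V : lmodType k) (f : H -> V),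
  linear f -> (forall i j, f (t i j) = 0) -> forall x, f x = 0.

Lemma antipode_mul_linl (z : H) : linear (fun y : H => antipode y * z).
Proof. by move=> a x y; rewrite antipode_lin mulrDl -scalerAl. Qed.

Lemma antipode_mul_linr (y : H) : linear (fun z : H => y * antipode z).
Proof. by move=> a x z; rewrite antipode_lin mulrDr -scalerAr. Qed.

Lemma mulr_linl (z : H) : linear (fun y : H => y * z).
Proof. by move=> a x y; rewrite mulrDl -scalerAl. Qed.

Lemma mulr_linr (y : H) : linear (fun z : H => y * z).
Proof. by move=> a x z; rewrite mulrDr -scalerAr. Qed.

Lemma antipode_tr i l : \sum_j t j l * antipode (t i j) = (i == l)%:R%:A.
Proof.
rewrite -counit_t -antipoder comul_t (lin_sum _ (tlift_lin _)); apply: eq_bigr => j _.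
by rewrite tlift_ptens // => [w|v]; [exact: mulr_linl | exact: antipode_mul_linr].
Qed.

Lemma comul_tt i l p m :
  comul (t i l * t p m) = \sum_q \sum_r ptens (t q l * t r m) (t i q * t p r).
Proof.
rewrite comulM !comul_t (lin_sum _ (tlift_lin _)); apply: eq_bigr => q _.
rewrite tlift_ptens.
- rewrite (lin_sum _ (tlift_lin _)); apply: eq_bigr => r _; rewrite tlift_ptens // => w a u v.
    by rewrite mulr_linr ptens_linl.
  by rewrite mulr_linr ptens_linr.
- move=> w; apply: tlift_param_lin => v v' a u u'.
  by rewrite mulr_linl ptens_linl.
- move=> w; apply: tlift_param_lin => v v' a u u'.
  by rewrite mulr_linl ptens_linr.
Qed.

Lemma antipode_tt i l p m :
  \sum_q \sum_r antipode (t q l * t r m) * (t i q * t p r) = ((i == l)%:R * (p == m)%:R)%:A.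
Proof.
rewrite -!counit_t -counitM -antipodel comul_tt (lin_sum _ (tlift_lin _)).
apply: eq_bigr => q _; rewrite (lin_sum _ (tlift_lin _)); apply: eq_bigr => r _.
by rewrite tlift_ptens // => [w|v]; [exact: antipode_mul_linl | exact: mulr_linr].
Qed.

Lemma antipode1 : antipode 1 = 1 :> H.
Proof.
have := antipodel (1 : H); rewrite comul1 tlift_ptens => [|w|v].
- by rewrite mulr1 counit1 scale1r.
- exact: antipode_mul_linl.
- exact: mulr_linr.
Qed.

Lemma sum_deltal (F : 'I_n -> H) j : \sum_i (i == j)%:R%:A * F i = F j.
Proof.
rewrite (bigD1 j) //= eqxx scale1r mul1r big1 ?addr0 // => i /negbTE ->.
by rewrite scale0r mul0r.
Qed.

Lemma sum_deltar (F : 'I_n -> H) j : \sum_i F i * (j == i)%:R%:A = F j.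
Proof.
rewrite (bigD1 j) //= eqxx scale1r mulr1 big1 ?addr0 // => i; rewrite eq_sym => /negbTE ->.
by rewrite scale0r mulr0.
Qed.

(** The two sides are a left and a right convolution inverse of multiplication, so a triple product
    evaluated in two ways identifies them: contracting by [antipode_tr] gives one, by [antipode_tt]
    the other. *)
Lemma antipode_t_anti p j r l : antipode (t p j * t r l) = antipode (t r l) * antipode (t p j).
Proof.
pose X q m := antipode (t q j * t m l).
transitivity (\sum_i \sum_s (\sum_q \sum_m X q m * (t i q * t s m))
    * (antipode (t r s) * antipode (t p i))).
  have step i : \sum_s (\sum_q \sum_m X q m * (t i q * t s m))
        * (antipode (t r s) * antipode (t p i))
      = \sum_q X q r * (t i q * antipode (t p i)).
    under eq_bigr => s _ do rewrite mulr_suml.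
    rewrite exchange_big; apply: eq_bigr => q _ /=.
    under eq_bigr => s _ do rewrite mulr_suml.
    rewrite exchange_big /=.
    transitivity (\sum_m X q m * t i q * (r == m)%:R%:A * antipode (t p i)).
      apply: eq_bigr => m _; rewrite -antipode_tr mulr_sumr mulr_suml.
      by apply: eq_bigr => s _; rewrite !mulrA.
    by rewrite -mulr_suml (sum_deltar (fun m => X q m * t i q)) mulrA.
  under eq_bigr => i _ do rewrite step.
  rewrite exchange_big /= -[LHS](sum_deltar (fun q => X q r)).
  by apply: eq_bigr => q _; rewrite -mulr_sumr antipode_tr.
rewrite -[RHS](sum_deltal (fun i => antipode (t r l) * antipode (t p i))).
apply: eq_bigr => i _; under eq_bigr => s _ do rewrite antipode_tt.
rewrite -[antipode (t r l)](sum_deltal (fun s => antipode (t r s))) mulr_suml mulr_sumr.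
apply: eq_bigr => s _; rewrite -scalerA -!scalerAl !mul1r.
by [].
Qed.

Lemma antipodeM (x y : H) : antipode (x * y) = antipode y * antipode x.
Proof.
apply/eqP; rewrite -subr_eq0; apply/eqP.
pose f x := antipode (x * y) - antipode y * antipode x.
apply: (t_span (f := f)) => [a u v|i j] /=.
  rewrite /f mulrDl -scalerAl !antipode_lin mulrDr -scalerAr scalerBr opprD addrACA.
  by [].
rewrite /f; apply: (t_span (f := fun y => antipode (t i j * y) - antipode y * antipode (t i j))).
  move=> a u v; rewrite mulrDr -scalerAr !antipode_lin mulrDl -scalerAl scalerBr opprD addrACA.
  by [].
by move=> p q; rewrite antipode_t_anti subrr.
Qed.

(** Applying the anti-multiplicative antipode to the hypothesis inverts the matrix of the
    [antipode (t j l)] on the side where [antipode_tr] inverts it by [t]; inverses are unique. The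
    hypothesis has the order of factors opposite to the antipode axioms, so [r] plays the part of
    the inverse antipode of [t]. *)
Lemma antipode_left_inverse (r : 'I_n -> 'I_n -> H) :
  (forall i l, \sum_j r i j * t j l = (i == l)%:R%:A) ->
  forall i m, antipode (r i m) = t i m.
Proof.
move=> rt i m.
transitivity (\sum_l t l m * (\sum_j antipode (t j l) * antipode (r i j))).
  transitivity (\sum_j (j == m)%:R%:A * antipode (r i j)); first by rewrite sum_deltal.
  under [RHS]eq_bigr => l _ do rewrite mulr_sumr.
  rewrite exchange_big; apply: eq_bigr => j _ /=; rewrite -antipode_tr mulr_suml.
  by apply: eq_bigr => l _; rewrite mulrA.
rewrite -[RHS](sum_deltar (fun l => t l m)); apply: eq_bigr => l _; congr (_ * _).
under eq_bigr => j _ do rewrite -antipodeM.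
rewrite -(lin_sum _ (@antipode_lin k H)) rt (linZ (@antipode_lin k H)) antipode1.
by [].
Qed.

Lemma antipode_bij (r : 'I_n -> 'I_n -> H) :
  (forall i l, \sum_j r i j * t j l = (i == l)%:R%:A) -> bijective (@antipode k H).
Proof.
move=> rt.
pose L := GRing.isLinear.Build _ _ _ _ (@antipode k H) (@antipode_lin k H).
pose S : {linear H -> H} := HB.pack (@antipode k H) L.
have SE x : linfun S x = antipode x by rewrite lfunE.
have im_t i j : t i j \in limg (linfun S).
  by rewrite -(antipode_left_inverse rt) -SE memv_img ?memvf.
(* The image contains the entries of [t], which span, so the antipode is onto; by dimension it is
   injective. *)
have im x : x \in limg (linfun S).
  pose f x := x - projv (limg (linfun S)) x.
  suff : f x = 0 by move/eqP; rewrite subr_eq0 => /eqP ->; exact: memv_proj.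
  apply: (t_span (f := f)) => [a u v|i j]; last by rewrite /f projv_id ?subrr.
  by rewrite /f linearP scalerBr opprD addrACA.
have fullim : limg (linfun S) = fullv by apply/vspaceP => x; rewrite im memvf.
have ker0 : lker (linfun S) == 0%VS.
  have := limg_ker_dim (linfun S) fullv; rewrite fullim capfv.
  by move/eqP; rewrite -{2}[\dim fullv]add0n eqn_add2r dimv_eq0.
exists (fun x => (linfun S)^-1%VF x) => x.
  by rewrite -SE lker0_lfunK.
by rewrite -SE limg_lfunVK.
Qed.

End Antipode.

(** * Modules over the induced Hopf algebra *)

Section TrivialObjects.
Variables (k : closedFieldType) (C : moncat k).
Hypothesis tc : tensor_category C.

Lemma end_one_scalar (f : hom C one one) : exists c : k, f = c *: idm one.
Proof. exact: (end_simple_scalar (tc_abelian tc) (tc_unit tc) (tc_fin_dim tc one one)). Qed.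

Definition one_scalar (f : hom C one one) : k := projT1 (cid (end_one_scalar f)).

Lemma one_scalarE f : one_scalar f *: idm one = f.
Proof. by rewrite -(projT2 (cid (end_one_scalar f))). Qed.

Lemma scale_one_inj (a b : k) : a *: idm (one : C) = b *: idm one -> a = b.
Proof.
move=> /eqP; rewrite -subr_eq0 -scalerBl => /eqP e; apply/eqP; rewrite -subr_eq0.
apply/negPn/negP => nz; have [nz1 _] := tc_unit tc; apply: nz1.
by rewrite /is_zero -[LHS]scale1r -(mulVf nz) -scalerA e scaler0.
Qed.

Lemma one_scalar_lin : linear (one_scalar : _ -> k^o).
Proof.
move=> a f g; apply: scale_one_inj.
transitivity ((a * one_scalar f + one_scalar g) *: idm (one : C)) => //.
by rewrite scalerDl -scalerA !one_scalarE.
Qed.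

Lemma trivial_ord (X : C) : trivial X ->
  exists n (e : 'I_n -> hom C one X) (p : 'I_n -> hom C X one),
    is_biproduct (X := fun _ => one) e p.
Proof.
move=> [I [e [p [pe pe0 ep]]]].
exists #|I|, (fun i => e (enum_val i)), (fun i => p (enum_val i)); split=> [i|i j ij|].
- exact: pe.
- by apply: pe0 => h; apply: ij; exact: enum_val_inj h.
- rewrite -ep [RHS](reindex (fun i : 'I_#|I| => enum_val i)) //.
  by apply: onW_bij; exact: enum_val_bij.
Qed.

Lemma trivial_ext (X Y : C) (f g : hom C X Y) : trivial X ->
  (forall v : hom C one X, f \c v = g \c v) -> f = g.
Proof.
move=> /trivial_ord[n [e [p [_ _ ep]]]] fg.
by rewrite -[f]compmI -[g]compmI -ep !comp_sumr; apply: eq_bigr => i _; rewrite !compA fg.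
Qed.

(** A trivial object is a sum of copies of [one], whose endomorphisms are scalars, so a functional
    is fixed by its values on the injections. *)
Lemma trivial_form (X : C) (a : dual (hom C one X)) : trivial X ->
  exists f : hom C X one, forall v, f \c v = dual_eval a v *: idm one.
Proof.
move=> /trivial_ord[n [e [p [pe pe0 ep]]]].
exists (\sum_i dual_eval a (e i) *: p i) => v.
have vE : v = \sum_i one_scalar (p i \c v) *: e i.
  rewrite -[LHS]compIm -ep comp_suml; apply: eq_bigr => i _.
  transitivity (e i \c (one_scalar (p i \c v) *: idm one)); first by rewrite one_scalarE compA.
  by rewrite compZr compmI.
have a_lin : linear (dual_eval a : _ -> k^o) by exact: (smvalP a).
rewrite {2}vE (lin_sum _ a_lin) scaler_suml comp_suml; apply: eq_bigr => i _.
rewrite (linZ a_lin) compZl; transitivity (dual_eval a (e i) *: (one_scalar (p i \c v) *: idm (one : C))).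
  by rewrite one_scalarE.
by rewrite scalerA mulrC.
Qed.

Program Definition dual_of (X : C) (f : hom C X one) : dual (hom C one X) :=
  @Sublmod _ _ (linear_forms (hom C one X)) (fun v => one_scalar (f \c v)) _.
Next Obligation. by move=> X f a u v; rewrite comp_linr one_scalar_lin. Qed.

Lemma dual_ofE (X : C) (f : hom C X one) v : dual_eval (dual_of f) v = one_scalar (f \c v).
Proof. by []. Qed.

Lemma dual_ext (V : lmodType k) (a b : dual V) : (forall v, dual_eval a v = dual_eval b v) -> a = b.
Proof. by move=> e; apply: smval_inj; apply: functional_extensionality_dep. Qed.

Lemma dual_of_lin (X : C) : linear (@dual_of X).
Proof. by move=> a f g; apply: dual_ext => v; rewrite /dual_eval /= comp_linl one_scalar_lin. Qed.

End TrivialObjects.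

(** * The induced Hopf algebra as the algebra of forms on [T one] *)

Section InducedHopfAlgebra.
Variables (k : closedFieldType) (C : moncat k) (T : hopf_monad C).
Hypotheses (tc : tensor_category C) (T_normal : normal T).
Local Notation K := (ker_forget T).
Local Notation T1 := (T one).
Local Notation scalar := (one_scalar tc).
Local Notation dual_of := (dual_of tc).

Definition conv (f g : hom C T1 one) : hom C T1 one :=
  runit one \c (f \oxm g) \c xi T one one \c fmap T (bwd (runit one)).

Definition free_one : K := @FullOb k (tmod_moncat T) _ (free_tmod T one : tmod_moncat T) T_normal.

Lemma trivial_car (X : K) : trivial (ker_car X).
Proof. exact: (fo_prop X). Qed.

Definition form (X : K) (a : dual (omega X)) : hom C (ker_car X) one :=
  projT1 (cid (trivial_form tc a (trivial_car X))).

Lemma formE (X : K) (a : dual (omega X)) (v : omega X) :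
  form a \c v = dual_eval a v *: idm one.
Proof. exact: (projT2 (cid (trivial_form tc a (trivial_car X)))). Qed.

Lemma form_lin (X : K) : linear (@form X).
Proof.
move=> c a b; apply: (trivial_ext (trivial_car X)) => v.
by rewrite comp_linl !formE scalerA -scalerDl.
Qed.

Lemma form_dual_of (X : K) (f : hom C (ker_car X) one) : form (dual_of f : dual (omega X)) = f.
Proof.
apply: (trivial_ext (trivial_car X)) => v.
by rewrite formE dual_ofE one_scalarE.
Qed.

(** A matrix coefficient: [v] extends to a [T]-linear map from the free module [T one] to [X], which
    is then followed by the form of [a]. *)
Definition coefficient (X : K) (a : dual (omega X)) (v : omega X) : hom C T1 one :=
  form a \c tm_act (fo_val X) \c fmap T v.

Lemma coefficient_wedge : is_wedge coefficient.
Proof.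
split=> [X v a b c|X a c v w|X Y f a v]; rewrite /coefficient.
- by rewrite form_lin !comp_linl.
- by rewrite fmap_lin comp_linr.
- have -> : form (dual_pullback (omega_map_lin f) a) = form a \c smval f.
    apply: (trivial_ext (trivial_car X)) => w.
    by rewrite -compA !formE.
  rewrite fmap_comp -!compA; congr (_ \c _); rewrite !compA; congr (_ \c _).
  exact: (smvalP f).
Qed.

Variables (H : hopf_algebra k) (i : forall X : K, dual (omega X) -> omega X -> H).
Hypothesis i_coend : is_coend i.

Definition bracket : H -> hom C T1 one := projT1 (cid (i_coend.2 _ _ coefficient_wedge)).

Lemma bracket_lin : linear bracket.
Proof. exact: (projT2 (cid (i_coend.2 _ _ coefficient_wedge))).1.1. Qed.

Lemma bracketE (X : K) (a : dual (omega X)) (v : omega X) : bracket (i a v) = coefficient a v.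
Proof. exact: (projT2 (cid (i_coend.2 _ _ coefficient_wedge))).1.2. Qed.

Definition unbracket (f : hom C T1 one) : H :=
  i (dual_of f : dual (omega free_one)) (eta T one : omega free_one).

Lemma unbracket_lin : linear unbracket.
Proof.
by move=> a f g; rewrite /unbracket dual_of_lin (wedge_linl i_coend.1).
Qed.

Lemma coefficient_free (a : dual (omega free_one)) (v : omega free_one) :
  coefficient a v = form a \c (mu T one \c fmap T v).
Proof. by rewrite /coefficient compA. Qed.

Lemma unbracketK f : bracket (unbracket f) = f.
Proof.
by rewrite bracketE coefficient_free mu_etar compmI form_dual_of.
Qed.

(** Both the identity and the round trip respect the universal family, hence coincide. For the round
    trip, the [T]-linear extension [m] of [v] moves the computation from [X] to the free module by
    dinaturality. *)
Lemma bracketK x : unbracket (bracket x) = x.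
Proof.
have [w [_ w_uniq]] := i_coend.2 _ _ i_coend.1.
have e1 : w = id by apply: w_uniq; split=> // a u v.
suff e2 : w = unbracket \o bracket by rewrite -[RHS](congr1 (fun f => f x) e1) e2.
apply: w_uniq; split=> [a u v|X a v]; first by rewrite /= bracket_lin unbracket_lin.
rewrite /= bracketE /unbracket.
have h : tmod_homs (free_tmod T one) (fo_val X) (tm_act (fo_val X) \c fmap T v).
  rewrite /tmod_homs /= fmap_comp compA tm_assoc -!compA; congr (_ \c _).
  by rewrite mu_nat.
pose m : hom K free_one X := @Sublmod _ _ (tmod_homs (free_tmod T one) (fo_val X)) _ h.
have -> : (dual_of (coefficient a v) : dual (omega free_one))
    = dual_pullback (omega_map_lin m) a.
  apply: dual_ext => x'; rewrite dual_ofE /coefficient -!compA; apply: (scale_one_inj tc).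
  by rewrite one_scalarE formE /omega_map /= compA.
rewrite (wedge_dinat i_coend.1); congr i.
rewrite /omega_map /= -compA -eta_nat compA tm_unit compIm.
by [].
Qed.

Lemma bracket_inj : injective bracket.
Proof. exact: can_inj bracketK. Qed.

Hypothesis i_one : forall a : dual (omega one), dual_eval a (omega_unit T) = 1 ->
  i a (omega_unit T) = 1.
Hypothesis i_mul : forall (X Y : K) (a : dual (omega X)) (b : dual (omega Y))
    (c : dual (omega (X \ox Y))),
  (forall v w, dual_eval c (omega_tensor v w) = dual_eval a v * dual_eval b w) ->
  forall v w, i a v * i b w = i c (omega_tensor v w).

Lemma bwd_lunit_one : bwd (lunit one) = bwd (runit (one : C)).
Proof. by apply: bwd_inj; exact: lunit_one. Qed.

Lemma bracket_one : bracket 1 = phi T.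
Proof.
pose a : dual (omega (one : K)) := @dual_of one (idm one).
have a1 : dual_eval a (omega_unit T) = 1.
  by apply: (scale_one_inj tc); rewrite dual_ofE one_scalarE compIm scale1r.
rewrite -(i_one a1) bracketE /coefficient form_dual_of compIm /omega_unit fmap_id.
by rewrite compmI.
Qed.

Lemma bracket_unbracket_mul f g : bracket (unbracket f * unbracket g) = conv f g.
Proof.
pose c0 : hom C (T1 \ox T1) one := runit one \c (f \oxm g).
pose c : dual (omega (free_one \ox free_one)) := @dual_of (T1 \ox T1) c0.
have hc v w : dual_eval c (omega_tensor v w)
    = dual_eval (dual_of f : dual (omega free_one)) v * dual_eval (dual_of g : dual (omega free_one)) w.
  apply: (scale_one_inj tc); rewrite dual_ofE one_scalarE /c0 /omega_tensor.
  rewrite -compA (compA (f \oxm g)) -bmap_comp bwd_lunit_one.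
  rewrite !dual_ofE.
  transitivity (runit (one : C) \c ((scalar (f \c v) *: idm one) \oxm (scalar (g \c w) *: idm one))
    \c bwd (runit (one : C))); first by rewrite !one_scalarE compA.
  rewrite (linZ (bmap_linl tensor _)) (linZ (bmap_linr tensor _)) bmap_id.
  by rewrite !(compZr, compZl) compmI bwdK scalerA.
rewrite (i_mul hc) bracketE /coefficient form_dual_of /c0 /omega_tensor.
have e : (mu T one \oxm mu T one) \c xi T T1 T1 \c fmap T (eta T one \oxm eta T one)
    = xi T one one.
  by rewrite -compA xi_nat compA -bmap_comp !mu_etar bmap_id compIm.
rewrite /conv -e bwd_lunit_one fmap_comp !compA.
by [].
Qed.

Lemma bracketM x y : bracket (x * y) = conv (bracket x) (bracket y).
Proof. by rewrite -bracket_unbracket_mul !bracketK. Qed.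

(** Puts a product of forms into a shape in which the sum over the injections and projections of
    [T one] collapses to the identity. *)
Lemma mul_runit (g : hom C T1 one) (s : hom C (T1 \ox T1) one) (e : hom C one T1) :
  runit one \c ((s \c (idm T1 \oxm e) \c bwd (runit T1)) \oxm g)
  = s \c (idm T1 \oxm (e \c g)).
Proof.
rewrite -bmap_lr compA runit_nat -!compA; congr (_ \c _).
by rewrite (compA (bwd _)) fwdK compIm -bmap_compr.
Qed.

Hypothesis i_counit : forall (X : K) (a : dual (omega X)) (v : omega X),
  counit (i a v) = dual_eval a v.
Hypothesis i_comul : forall (X : K) (n : nat) (b : 'I_n -> dual (omega X)) (e : 'I_n -> omega X),
  (forall v, v = \sum_j dual_eval (b j) v *: e j) ->
  forall (a : dual (omega X)) (v : omega X),
  comul (i a v) = \sum_j ptens (i (b j) v) (i a (e j)).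

(* Right multiplication by the matrix [t] of the coefficients of the free module on [1] is
   precomposition with the left fusion operator, hence bijective. *)
Lemma antipode_anti_bijective :
  (forall x y : H, antipode (x * y) = antipode y * antipode x) /\ bijective (@antipode k H).
Proof.
have [n [e [p [pe pe0 ep]]]] := trivial_ord T_normal.
pose b j : dual (omega free_one) := dual_of (p j).
pose e' j : omega free_one := e j.
have be v : v = \sum_j dual_eval (b j) v *: e' j.
  rewrite -[LHS]compIm -[idm _]ep comp_suml; apply: eq_bigr => j _.
  transitivity (e j \c (scalar (p j \c v) *: idm one)); first by rewrite one_scalarE compA.
  by rewrite compZr compmI.
pose t a l := i (b a) (e' l).
have tE a l : bracket (t a l) = p a \c (mu T one \c fmap T (e l)).
  by rewrite bracketE coefficient_free form_dual_of.
have comul_t a l : comul (t a l) = \sum_j ptens (t j l) (t a j) by exact: i_comul.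
have counit_t a l : counit (t a l) = (a == l)%:R.
  rewrite i_counit; apply: (scale_one_inj tc); rewrite dual_ofE one_scalarE.
  case: eqVneq => [->|ne]; first by rewrite pe scale1r.
  by rewrite pe0 ?scale0r // => /esym/eqP; rewrite (negbTE ne).
have t_span (V : lmodType k) (f : H -> V) : linear f -> (forall a l, f (t a l) = 0) ->
    forall x, f x = 0.
  move=> f_lin f0 x; rewrite -(bracketK x) /unbracket.
  have -> : (dual_of (bracket x) : dual (omega free_one))
      = \sum_a scalar (bracket x \c e a) *: b a.
    rewrite -[in LHS](compmI (bracket x)) -ep comp_sumr (lin_sum _ (@dual_of_lin _ _ tc _)).
    apply: eq_bigr => a _; rewrite -(linZ (@dual_of_lin _ _ tc _)); congr dual_of.
    transitivity ((scalar (bracket x \c e a) *: idm one) \c p a).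
      by rewrite one_scalarE compA.
    by rewrite compZl compIm.
  rewrite (lin_sum _ (wedge_linl i_coend.1 _)) (lin_sum _ f_lin) big1 // => a _.
  rewrite (linZ (wedge_linl i_coend.1 _)) (linZ f_lin) [X in i _ X]be.
  rewrite (lin_sum _ (wedge_linr i_coend.1 _)) (lin_sum _ f_lin) big1 ?scaler0 // => l _.
  by rewrite (linZ (wedge_linr i_coend.1 _)) (linZ f_lin) f0 scaler0.
have ex_r a : exists r : 'I_n -> H, forall l, \sum_j r j * t j l = (a == l)%:R%:A.
  have [Fi [FiF FFi]] := fusionl T one one.
  pose r0 : hom C (T T1) one := phi T \c fmap T (p a).
  (* Chosen so that [s] after the left fusion operator is [r0 \c fmap T (lunit T1)]. The row of the
     inverse matrix is read off by inserting the injections [e j] into the second factor of [s]. *)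
  pose s : hom C (T1 \ox T1) one := r0 \c fmap T (lunit T1) \c Fi.
  exists (fun j => unbracket (s \c (idm T1 \oxm e j) \c bwd (runit T1))) => l.
  apply: bracket_inj; rewrite (lin_sum _ bracket_lin) (linZ bracket_lin) bracket_one.
  have step j : bracket (unbracket (s \c (idm T1 \oxm e j) \c bwd (runit T1)) * t j l)
     = s \c (idm T1 \oxm ((e j \c p j) \c (mu T one \c fmap T (e l))))
       \c (xi T one one \c fmap T (bwd (runit one))).
    by rewrite bracketM unbracketK tE /conv mul_runit !compA.
  under eq_bigr => j _ do rewrite step.
  rewrite -comp_suml -comp_sumr -bmap_sumr -comp_suml ep compIm.
  have xiE : (idm T1 \oxm (mu T one \c fmap T (e l))) \c xi T one one
      = (idm T1 \oxm mu T one) \c xi T one T1 \c fmap T (idm one \oxm e l).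
    by rewrite bmap_compr -compA -[X in X \oxm fmap T _]fmap_id -xi_nat compA.
  have sE : s \c ((idm T1 \oxm mu T one) \c xi T one T1) = r0 \c fmap T (lunit T1).
    by rewrite /s -compA FiF compmI.
  rewrite [LHS]compA -(compA s) xiE (compA s) sE -[LHS]compA -[LHS]compA -!fmap_comp.
  have -> : lunit T1 \c ((idm one \oxm e l) \c bwd (runit one)) = e l.
    by rewrite compA lunit_nat lunit_one -compA bwdK compmI.
  rewrite /r0 -compA -fmap_comp; case: eqVneq => [->|ne].
    by rewrite pe fmap_id compmI scale1r.
  by rewrite pe0 ?fmap0 ?comp0r ?scale0r // => /esym/eqP; rewrite (negbTE ne).
have [r rE] := choice ex_r.
split; first exact: (antipodeM comul_t counit_t t_span).
exact: (antipode_bij comul_t counit_t t_span rE).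
Qed.

(** * From module functors to modules over [H] *)

Definition pairing (x : H) (Z : C) : hom C (T1 \ox Z) Z := lunit Z \c (bracket x \oxm idm Z).

Lemma pairing_lin Z : linear (pairing^~ Z).
Proof. by move=> a x y; rewrite /pairing bracket_lin bmap_linl comp_linr. Qed.

Lemma pairing_nat x Y Z (f : hom C Y Z) :
  pairing x Z \c (idm T1 \oxm f) = f \c pairing x Y.
Proof. by rewrite /pairing -compA -bmap_swap !compA lunit_nat. Qed.

Lemma pairing_one Z : pairing 1 Z = counit_at T Z.
Proof. by rewrite /pairing bracket_one. Qed.

Lemma pairing_mono Y Z (g g' : hom C Y (T1 \ox Z)) :
  (forall x, pairing x Z \c g = pairing x Z \c g') -> g = g'.
Proof.
move=> gg'; have [n [e [p [pe pe0 ep]]]] := trivial_ord T_normal.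
rewrite -[g]compIm -[g']compIm -(bmap_id tensor) -ep bmap_suml !comp_suml.
apply: eq_bigr => j _; rewrite bmap_compl -!compA; congr (_ \c _).
apply: (iso_cancell (f := lunit Z)).
by have := gg' (unbracket (p j)); rewrite /pairing unbracketK !compA.
Qed.

(** As a sum of copies of [one] whose space of forms is [H], the object [T one] acts as the dual of
    [H], so maps into [T one \ox Z] are linear families indexed by [H]. *)
Lemma pairing_corep Y Z (r : H -> hom C Y Z) : linear r ->
  exists g : hom C Y (T1 \ox Z), forall x, pairing x Z \c g = r x.
Proof.
move=> r_lin; have [n [e [p [pe pe0 ep]]]] := trivial_ord T_normal.
exists (\sum_j (e j \oxm idm Z) \c bwd (lunit Z) \c r (unbracket (p j))) => x.
have xE : x = \sum_j scalar (bracket x \c e j) *: unbracket (p j).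
  apply: bracket_inj; rewrite (lin_sum _ bracket_lin) -[LHS]compmI -ep comp_sumr.
  apply: eq_bigr => j _; rewrite (linZ bracket_lin) unbracketK.
  transitivity ((scalar (bracket x \c e j) *: idm one) \c p j).
    by rewrite one_scalarE compA.
  by rewrite compZl compIm.
rewrite [in RHS]xE (lin_sum _ r_lin) comp_sumr; apply: eq_bigr => j _.
rewrite (linZ r_lin) /pairing !compA; transitivity
  (lunit Z \c ((scalar (bracket x \c e j) *: idm one) \oxm idm Z) \c bwd (lunit Z) \c r (unbracket (p j))).
  by rewrite one_scalarE bmap_compl !compA.
by rewrite (linZ (bmap_linl tensor _)) bmap_id !(compZr, compZl) compmI bwdK compIm.
Qed.

Lemma coact_cofree_one Y : coact (cofree T Y) one
  = assoc T1 T1 Y \c ((xi T one one \c fmap T (bwd (runit one))) \oxm idm Y).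
Proof.
rewrite /coact /= -compA -bmap_compl; congr (_ \c (_ \oxm _)).
rewrite runit_bwd_nat fmap_comp /strength compA -(compA _ (xi T _ _)) xi_nat compA.
by rewrite -bmap_comp /= mu_etar fmap_id compIm bmap_id compIm.
Qed.

Lemma pairing_mul x y Y :
  pairing y Y \c (pairing x (T1 \ox Y) \c coact (cofree T Y) one) = pairing (x * y) Y.
Proof.
rewrite compA -pairing_nat coact_cofree_one /pairing bracketM /conv.
have -> : lunit Y \c (bracket x \oxm idm Y) \c (idm T1 \oxm (lunit Y \c (bracket y \oxm idm Y)))
    = lunit Y \c ((idm one \oxm lunit Y) \c (bracket x \oxm (bracket y \oxm idm Y))).
  by rewrite -compA bmap_lr -bmap_comp compIm.
rewrite -!compA; congr (_ \c _).
rewrite (compA (bracket x \oxm (bracket y \oxm idm Y))) -assoc_nat -compA.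
by rewrite (compA (idm one \oxm _)) triangle -!bmap_compl.
Qed.

Local Notation CM := (tmod_modcat T).
Implicit Types F G : modfunctor CM CM.

Definition coact_act F (x : H) : hom C (F one) (F one) := pairing x (F one) \c coact F one.

Lemma coact_act_lin F : linear (coact_act F).
Proof. by move=> a x y; rewrite /coact_act pairing_lin comp_linl. Qed.

Lemma coact_act_one F : coact_act F 1 = idm (F one).
Proof. by rewrite /coact_act pairing_one; exact: counit_coact. Qed.

(** Coassociativity pairs [x] with the outer factor [T one], which is therefore applied first; the
    action is a right one, and [crossed_module] precomposes it with the antipode. *)
Lemma coact_actM F x y : coact_act F (x * y) = coact_act F y \c coact_act F x.
Proof.
have e : (idm T1 \oxm coact F one) \c coact F one = coact (cofree T (F one)) one \c coact F one.
  exact: (coact_modnat (coact_map F) one).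
rewrite /coact_act -pairing_mul; move: (coact F one) (coact (cofree T (F one)) one) e => c c' e.
rewrite -[LHS]compA -[X in _ \c X = _]compA -e [X in _ \c X = _]compA pairing_nat.
by rewrite -[X in _ \c X = _]compA [LHS]compA.
Qed.

Lemma antipode_mul (x y : H) : antipode (x * y) = antipode y * antipode x.
Proof. exact: antipode_anti_bijective.1. Qed.

Definition crossed_module F : alg_mod H C :=
  @AlgMod k H C (F one) (fun x => coact_act F (antipode x))
    (fun a x y => etrans (congr1 (coact_act F) (antipode_lin a x y)) (coact_act_lin F a _ _))
    (fun x y => etrans (congr1 (coact_act F) (antipode_mul x y)) (coact_actM F _ _))
    (etrans (congr1 (coact_act F) (antipode1 H)) (coact_act_one F)).

Lemma coact_act_nat F G (f : hom C (F one) (G one)) x :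
  (idm T1 \oxm f) \c coact F one = coact G one \c f ->
  f \c coact_act F x = coact_act G x \c f.
Proof. by move=> e; rewrite /coact_act [LHS]compA -pairing_nat -[LHS]compA e [LHS]compA. Qed.

Program Definition crossed_functor : functor (modfunctor_cat CM CM) (alg_mod_cat H C) :=
  @Functor k (modfunctor_cat CM CM) (alg_mod_cat H C) crossed_module
    (fun F G (a : modnat F G) =>
       @Sublmod _ _ (alg_mod_homs (crossed_module F) (crossed_module G)) (smval a one) _) _ _ _.
Next Obligation. by move=> F G a x; apply: coact_act_nat; exact: coact_modnat. Qed.
Next Obligation. by move=> F G a f g; apply: smval_inj. Qed.
Next Obligation. by move=> F; apply: smval_inj. Qed.
Next Obligation. by move=> F G L g f; apply: smval_inj. Qed.

Hypotheses (T_faithful : faithful T) (T_lex : left_exact T).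
Variable Q : C.
Hypotheses (Q_nonzero : ~ is_zero Q) (Q_exact : hom_tensor_exact Q one).

Lemma crossed_functor_full F G (g : hom (alg_mod_cat H C) (crossed_module F) (crossed_module G)) :
  exists a : hom (modfunctor_cat CM CM) F G, fmap crossed_functor a = g.
Proof.
have [S' SS' S'S] := antipode_anti_bijective.2.
have [|a aE] := coact_full tc T_faithful T_lex Q_nonzero Q_exact (F := F) (G := G) (f := smval g).
  (* Pairing with [x] tests the comodule equation; linearity of [g] at the inverse antipode of [x]
     is what is needed. *)
  apply: pairing_mono => x; rewrite compA pairing_nat.
  by have := alg_mod_homP g (S' x); rewrite /= S'S /coact_act -!compA.
by exists a; apply: smval_inj.
Qed.

Lemma crossed_functor_ess_surj (Y : alg_mod_cat H C) :
  exists F, exists f : iso (crossed_functor F) Y, True.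
Proof.
have [S' SS' S'S] := antipode_anti_bijective.2.
have S'_lin : linear S'.
  by move=> a x y; apply: (can_inj SS'); rewrite antipode_lin !S'S.
have S'_one : S' 1 = 1 by rewrite -[in LHS](antipode1 H) SS'.
have S'M x y : S' (x * y) = S' y * S' x.
  by apply: (can_inj SS'); rewrite antipode_mul !S'S.
(* The inverse antipode turns the left action into a right one, which [pairing_corep] encodes as a
   coaction. *)
have [|delta deltaE] := @pairing_corep Y Y (fun x => am_act Y (S' x)).
  by move=> a x y; rewrite S'_lin am_lin.
have [||F [f fE]] := coact_ess_surj tc (Y := am_car Y) (delta := delta).
- by rewrite -pairing_one deltaE S'_one am_one.
- apply: pairing_mono => x; apply: pairing_mono => y.
  rewrite compA (compA (pairing y Y)) pairing_mul deltaE S'M am_mul.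
  by rewrite [pairing x _ \c _]compA pairing_nat -compA deltaE compA deltaE.
exists F.
have f_hom : alg_mod_homs (crossed_module F) Y f.
  move=> x; rewrite /= /coact_act compA -pairing_nat -compA -fE compA deltaE SS'.
  by [].
have b_hom : alg_mod_homs Y (crossed_module F) (bwd f).
  move=> x; apply: (iso_cancell (f := f)); rewrite [LHS]compA bwdK compIm [RHS]compA.
  by rewrite [X in _ = X \c _]f_hom -compA bwdK compmI.
pose fh : hom (alg_mod_cat H C) (crossed_module F) Y := Sublmod f_hom.
pose bh : hom (alg_mod_cat H C) Y (crossed_module F) := Sublmod b_hom.
have fb : bh \c fh = idm _ by apply: smval_inj; exact: fwdK.
have bf : fh \c bh = idm _ by apply: smval_inj; exact: bwdK.
by exists (Iso fb bf).
Qed.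

Lemma crossed_product_equivalent : equivalent (modfunctor_cat CM CM) (alg_mod_cat H C).
Proof.
apply: (fully_faithful_equivalent (F := crossed_functor)).
- move=> F G a b /(congr1 (fun h : alg_mod_hom _ _ => smval h)) e.
  exact: (modnat_unit_inj tc T_faithful T_lex Q_nonzero Q_exact e).
- exact: crossed_functor_full.
- exact: crossed_functor_ess_surj.
Qed.

End InducedHopfAlgebra.

Theorem proposition7p3 (k : closedFieldType) (char0 : ([pchar k] =i pred0)%R)
    (C : moncat k) (C_finite_tensor : finite_tensor_category C)
    (T : hopf_monad C) (T_normal : normal T) (T_faithful : faithful T)
    (T_exact : exact T)
    (H : hopf_algebra k) (H_induced : induced_hopf_algebra T H) :
  exists (D : lincat k) (P : bifunctor (hmod_cat H) C D),
    is_deligne_product P /\ equivalent (rev_moncat (crossed_product T)) D.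
Proof.
have [tc [_ covers]] := C_finite_tensor.
have [i [i_coend [i_counit [i_comul [i_one i_mul]]]]] := H_induced.
have [Q [p [Q_proj p_epi _]]] := covers one (tc_unit tc).
have Q_nonzero : ~ is_zero Q.
  move=> zQ; have [nz1 _] := tc_unit tc; apply: nz1.
  by apply: p_epi; rewrite (zero_dom p zQ) !comp0r.
exists (alg_mod_cat H C), (box H (tc_abelian tc)); split.
  exact: box_deligne (tc_fin_dim tc).
(* Reversal changes only the tensor product, so the underlying linear category is that of the module
   endofunctors. *)
exact: (crossed_product_equivalent tc T_normal i_coend i_one i_mul i_counit i_comul
  T_faithful (proj1 T_exact) Q_nonzero (projective_hom_tensor_exact tc Q_proj)).
Qed.
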